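(* Let $a<b$ be real numbers, let $\alpha\in(0,1)$, let $y_a,y_b\in\mathbb{R}$, and let $L=L(x,y,v)\in C^2([a,b]\times\mathbb{R}^2)$ be real-valued. Consider the functional $$J[y]=\int_a^b L\left(x,y(x),{}_aD_x^{\alpha}y(x)\right)dx$$ defined in $\{y \mid y\in C([a,b]),\ y(a)=y_a,\ y(b)=y_b\}$. Let $y^{\ast}\in C([a,b])$ be an extremal of $J$ (with $y^{\ast}(a)=y_a$, $y^{\ast}(b)=y_b$). If $y^{\ast}$ yields a weak relative minimum (respectively, maximum) of $J$ in this set, then $$\frac{\partial^2 L}{\partial v^2}\left(x,y^{\ast}(x),{}_aD_x^{\alpha}y^{\ast}(x)\right)\ge 0\quad(\text{respectively, }\le 0)$$ for all $x\in[a,b]$.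
   Context: For $0<\alpha<1$, the left and right Riemann--Liouville fractional derivatives of order $\alpha$ of a function $f$ on $[a,b]$ are $${}_aD_x^{\alpha}f(x)=\frac{1}{\Gamma(1-\alpha)}\frac{d}{dx}\int_a^x\frac{f(u)}{(x-u)^{\alpha}}\,du,\qquad {}_xD_b^{\alpha}f(x)=-\frac{1}{\Gamma(1-\alpha)}\frac{d}{dx}\int_x^b\frac{f(u)}{(u-x)^{\alpha}}\,du,$$ where $\Gamma$ is the Euler Gamma function. Functions $y$ at which $J$ is evaluated are understood to be such that ${}_aD_x^{\alpha}y$ and the integral defining $J[y]$ exist. The third argument of $L$ is denoted $v$; it is the slot in which ${}_aD_x^{\alpha}y(x)$ is substituted. An extremal of $J$ is a function $y$ satisfying the fractional Euler--Lagrange equation $$\frac{\partial L}{\partial y}\left(x,y(x),{}_aD_x^{\alpha}y(x)\right)+{}_xD_b^{\alpha}\left[\frac{\partial L}{\partial v}\left(x,y(x),{}_aD_x^{\alpha}y(x)\right)\right]=0,\qquad x\in[a,b].$$ Weak relative minimum: there exists $\delta>0$ such that $J[y^{\ast}]\le J[y]$ for every admissible $y$ (that is, $y\in C([a,b])$, $y(a)=y_a$, $y(b)=y_b$) with $\sup_{x}|y(x)-y^{\ast}(x)|+\sup_{x}|{}_aD_x^{\alpha}y(x)-{}_aD_x^{\alpha}y^{\ast}(x)|<\delta$. A weak relative maximum is defined with the reversed inequality $J[y^{\ast}]\ge J[y]$.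
   Formalization: Added: the left fractional derivative of y* is bounded on [c,b] for every c in (a,b] (without this the claim fails); if y_a≠0, that derivative does not exist at x=a, so its existence, the Euler–Lagrange equation, the supremum and the conclusion are taken on (a,b] only. *)

(* Defs.v *)
From HB Require Import structures.
From mathcomp Require Import all_boot all_order all_algebra.
From mathcomp Require Import all_classical all_reals all_analysis.

Set Implicit Arguments.
Unset Strict Implicit.
Unset Printing Implicit Defensive.

Import Order.TTheory GRing.Theory Num.Theory.
Import numFieldNormedType.Exports.

Local Open Scope classical_set_scope.
Local Open Scope ring_scope.

(* Derivative relative to D: the usual one in the interior of D, the one-sided
   one at the endpoints of D = `[a, b]. *)
Definition derivable_in (R : realType) (D : set R) (f : R -> R) (x : R) : Prop :=
  cvg ((f z - f x) / (z - x) @[z --> within D x^']).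

Definition derive_in (R : realType) (D : set R) (f : R -> R) (x : R) : R :=
  lim ((f z - f x) / (z - x) @[z --> within D x^']).

Definition Gamma_fun (R : realType) (s : R) : R :=
  \int[lebesgue_measure]_(t in `]0, +oo[) (t `^ (s - 1) * expR (- t)).

(* In the two kernels below the value at u = x is 0, since 0 `^ alpha = 0 for
   alpha > 0 and division by 0 gives 0; it does not affect the integrals. *)
Definition RL_left_int (R : realType) (a alpha : R) (f : R -> R) (x : R) : R :=
  \int[lebesgue_measure]_(u in `[a, x]) (f u / (x - u) `^ alpha).

Definition RL_right_int (R : realType) (b alpha : R) (f : R -> R) (x : R) : R :=
  \int[lebesgue_measure]_(u in `[x, b]) (f u / (u - x) `^ alpha).

Definition RL_left (R : realType) (a b alpha : R) (f : R -> R) (x : R) : R :=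
  (Gamma_fun (1 - alpha))^-1 *
    derive_in `[a, b] (RL_left_int a alpha f) x.

Definition RL_right (R : realType) (a b alpha : R) (f : R -> R) (x : R) : R :=
  - ((Gamma_fun (1 - alpha))^-1 *
    derive_in `[a, b] (RL_right_int b alpha f) x).

(* Existence at x: the integral converges absolutely for all z in [a, b] close
   to x (x included), and is differentiable at x relative to [a, b]. *)
Definition RL_left_exists (R : realType) (a b alpha : R) (f : R -> R) (x : R) :
    Prop :=
  (\forall z \near within `[a, b] (nbhs x),
     lebesgue_measure.-integrable `[a, z]
       (fun u => (f u / (z - u) `^ alpha)%:E)) /\
  derivable_in `[a, b] (RL_left_int a alpha f) x.

Definition RL_right_exists (R : realType) (a b alpha : R) (f : R -> R) (x : R) :
    Prop :=
  (\forall z \near within `[a, b] (nbhs x),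
     lebesgue_measure.-integrable `[z, b]
       (fun u => (f u / (u - z) `^ alpha)%:E)) /\
  derivable_in `[a, b] (RL_right_int b alpha f) x.

(* Partial derivatives of L(x, y, v) on [a, b] x R^2; the one in x is one-sided
   at x = a and x = b. *)
Definition pdx (R : realType) (a b : R) (L : R -> R -> R -> R) :
    R -> R -> R -> R :=
  fun x y v => derive_in `[a, b] (fun t => L t y v) x.

Definition pdy (R : realType) (L : R -> R -> R -> R) : R -> R -> R -> R :=
  fun x y v => derive1 (fun t => L x t v) y.

Definition pdv (R : realType) (L : R -> R -> R -> R) : R -> R -> R -> R :=
  fun x y v => derive1 (fun t => L x y t) v.

Definition class_C0 (R : realType) (a b : R) (L : R -> R -> R -> R) : Prop :=
  {within [set p : R * R * R | p.1.1 \in `[a, b]],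
    continuous (fun p : R * R * R => L p.1.1 p.1.2 p.2)}.

Definition class_C1 (R : realType) (a b : R) (L : R -> R -> R -> R) : Prop :=
  (forall x y v : R, x \in `[a, b] ->
     [/\ derivable_in `[a, b] (fun t => L t y v) x,
         derivable (fun t => L x t v) y 1 &
         derivable (fun t => L x y t) v 1]) /\
  [/\ class_C0 a b L, class_C0 a b (pdx a b L), class_C0 a b (pdy L) &
      class_C0 a b (pdv L)].

Definition class_C2 (R : realType) (a b : R) (L : R -> R -> R -> R) : Prop :=
  [/\ class_C1 a b L, class_C1 a b (pdx a b L), class_C1 a b (pdy L) &
      class_C1 a b (pdv L)].

(* The points at which the left derivative of a function y with y(a) = ya has
   to exist.  For y continuous with y(a) = ya != 0 it behaves at a like
   ya (x - a)^(-alpha) / Gamma(1 - alpha) and never exists at x = a, so that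
   point is kept exactly when ya = 0. *)
Definition fd_points (R : realType) (a b ya : R) : set R :=
  if ya == 0 then `[a, b]%classic else `]a, b]%classic.

Definition lagrangian (R : realType) (a b alpha : R) (L : R -> R -> R -> R)
    (y : R -> R) (x : R) : R :=
  L x (y x) (RL_left a b alpha y x).

Definition J (R : realType) (a b alpha : R) (L : R -> R -> R -> R)
    (y : R -> R) : R :=
  \int[lebesgue_measure]_(x in `[a, b]) lagrangian a b alpha L y x.

Definition admissible (R : realType) (a b alpha ya yb : R)
    (L : R -> R -> R -> R) (y : R -> R) : Prop :=
  [/\ {within `[a, b], continuous y}, y a = ya, y b = yb,
      (forall x, fd_points a b ya x -> RL_left_exists a b alpha y x) &
      lebesgue_measure.-integrable `[a, b]
        (EFin \o lagrangian a b alpha L y)].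

Definition extremal (R : realType) (a b alpha ya : R) (L : R -> R -> R -> R)
    (y : R -> R) : Prop :=
  forall x, fd_points a b ya x ->
    RL_right_exists a b alpha (lagrangian a b alpha (pdv L) y) x /\
    lagrangian a b alpha (pdy L) y x
      + RL_right a b alpha (lagrangian a b alpha (pdv L) y) x = 0.

(* Extended-real suprema, so that an unbounded difference has distance +oo. *)
Definition weak_dist (R : realType) (a b alpha ya : R) (y z : R -> R) : \bar R :=
  (ereal_sup [set `|y x - z x|%:E | x in `[a, b]]
   + ereal_sup [set `|RL_left a b alpha y x - RL_left a b alpha z x|%:E
                  | x in fd_points a b ya])%E.

Definition weak_minimum (R : realType) (a b alpha ya yb : R)
    (L : R -> R -> R -> R) (ys : R -> R) : Prop :=
  exists2 delta : R, 0 < delta &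
    forall y, admissible a b alpha ya yb L y ->
      (weak_dist a b alpha ya y ys < delta%:E)%E ->
      J a b alpha L ys <= J a b alpha L y.

Definition weak_maximum (R : realType) (a b alpha ya yb : R)
    (L : R -> R -> R -> R) (ys : R -> R) : Prop :=
  exists2 delta : R, 0 < delta &
    forall y, admissible a b alpha ya yb L y ->
      (weak_dist a b alpha ya y ys < delta%:E)%E ->
      J a b alpha L ys >= J a b alpha L y.

(* Main.v *)
Require Import Defs.
From HB Require Import structures.
From mathcomp Require Import all_boot all_order all_algebra.
From mathcomp Require Import all_classical all_reals all_analysis.
From mathcomp Require Import measurable_realfun.
From mathcomp Require Import ring lra.
Set Implicit Arguments.
Unset Strict Implicit.
Unset Printing Implicit Defensive.
Import Order.TTheory GRing.Theory Num.Theory.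
Import numFieldNormedType.Exports.
Local Open Scope classical_set_scope.
Local Open Scope ring_scope.

(** Legendre's argument for a Lagrangian that depends on a fractional
    derivative.  Write f = D^alpha ys, and let sg = 1 for a minimum and
    sg = -1 for a maximum.  If sg * L_vv is negative at
    (x0, ys x0, f x0), one perturbs ys by a function h whose fractional
    derivative g = D^alpha h is a pair of tents of width and height of order r.
    The first variation vanishes (first_variation); in the second one the term
    L_vv g^2 has order r^3, while the terms with h g and h^2 are smaller,
    because h is a smoother function than g (|h| has order r^(1 + alpha), and
    its integral has order r^2).  So the second variation has the sign of L_vv,
    which contradicts optimality.

    The difficulty is that f need not be continuous: it is a derivative, of
    the fractional integral F of ys up to the factor 1 / Gamma(1 - alpha), so
    the sign of L_vv at (x0, ys x0, f x0) says nothing about L_vv at the other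
    points of the graph where f is far from f x0.  Two facts about derivatives
    repair this.  By the Denjoy-Clarkson theorem (denjoy_clarkson) the set E of
    points near x0 where f is close to f x0 has positive measure; at a density
    point s of E (density_window) the tents, supported in [s, s + 4 r], live
    almost entirely on E (needle_set).  And a bounded derivative is integrable
    with the expected integral (bounded_derivative_FTC), which is what the
    integration by parts behind the first variation needs.

    The perturbation vanishes on [a, s] and has to vanish again at b, although
    D^alpha h has short support.  Take for h a combination of truncated powers
    (x - x_i)_+^(1 + alpha): its fractional derivative is the same combination
    of (x - x_i)_+ up to a constant (RL_left_int_spline_derivative), and two
    disjoint tents can be weighted so that the slowly decaying tails of the
    corresponding functions cancel at b (double_hat_weights).

    For the first variation, the Euler-Lagrange equation says that L_y is a
    multiple of the derivative of the right fractional integral P of L_v.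
    Integrating (P h)' and exchanging the order of integration in the integral
    of P h' (fractional_fubini) turns the integral of L_y h into minus the
    integral of L_v g.

    This settles interior points (needle_contradiction).  An endpoint is a
    limit of interior points at which f converges to its value at the endpoint,
    by the mean value theorem for F (interior_derivative_approx). *)

(** * Derivatives relative to a set *)

(** The quotient is multiplied out, so that derivatives combine by algebra alone;
    the set D gives one-sided derivatives at the endpoints of an interval and
    ordinary ones for D = setT. *)
Definition has_derivative_in (R : realType) (D : set R) (F : R -> R) (x d : R) :=
  forall e, 0 < e -> exists2 r, 0 < r &
    forall y, D y -> `|y - x| < r -> `|F y - F x - d * (y - x)| <= e * `|y - x|.

Section derivative_in.
Context {R : realType}.
Implicit Types (D : set R) (F G : R -> R) (x d e c : R).

Lemma has_derivative_in_ext D F G x d : D x -> (forall y, D y -> F y = G y) ->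
  has_derivative_in D F x d -> has_derivative_in D G x d.
Proof.
move=> Dx FG dF e /dF[r r0 Fr]; exists r => // y Dy yr.
by rewrite -!FG//; exact: Fr.
Qed.

Lemma has_derivative_inS D D' F x d : D `<=` D' ->
  has_derivative_in D' F x d -> has_derivative_in D F x d.
Proof. by move=> DD' dF e /dF[r r0 Fr]; exists r => // y /DD' D'y; exact: Fr. Qed.

Lemma has_derivative_in_near D (F G : R -> R) x d r : 0 < r -> D x ->
  (forall y, D y -> `|y - x| < r -> F y = G y) ->
  has_derivative_in D F x d -> has_derivative_in D G x d.
Proof.
move=> r0 Dx FG dF e /dF[s s0 Fs]; exists (Num.min r s); first by rewrite lt_min r0.
move=> y Dy; rewrite lt_min => /andP[yr ys].
by rewrite -!FG// ?subrr ?normr0//; exact: Fs.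
Qed.

Lemma has_derivative_in_cst D c x : has_derivative_in D (fun=> c) x 0.
Proof. by move=> e e0; exists 1 => // y _ _; rewrite subrr mul0r subr0 normr0 mulr_ge0// ltW. Qed.

Lemma has_derivative_in_id D x : has_derivative_in D id x 1.
Proof. by move=> e e0; exists 1 => // y _ _; rewrite mul1r subrr normr0 mulr_ge0// ltW. Qed.

Lemma has_derivative_inD D F G x d e :
  has_derivative_in D F x d -> has_derivative_in D G x e ->
  has_derivative_in D (fun y => F y + G y) x (d + e).
Proof.
move=> dF dG k k0; have k2 : 0 < k / 2 by rewrite divr_gt0.
have [r r0 Fr] := dF _ k2; have [s s0 Gs] := dG _ k2.
exists (Num.min r s); first by rewrite lt_min r0.
move=> y Dy; rewrite lt_min => /andP[yr ys].
have -> : F y + G y - (F x + G x) - (d + e) * (y - x) =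
  (F y - F x - d * (y - x)) + (G y - G x - e * (y - x)) by ring.
rewrite (le_trans (ler_normD _ _))//.
by rewrite [k in leRHS]splitr mulrDl lerD// ?Fr// Gs.
Qed.

Lemma has_derivative_inZ D F x d c :
  has_derivative_in D F x d -> has_derivative_in D (fun y => c * F y) x (c * d).
Proof.
move=> dF e e0.
have c0 : 0 < `|c| + 1 by rewrite ltr_wpDl.
have [r r0 Fr] := dF _ (divr_gt0 e0 c0); exists r => // y Dy yr.
have -> : c * F y - c * F x - c * d * (y - x) = c * (F y - F x - d * (y - x)) by ring.
rewrite normrM (le_trans (ler_wpM2l _ (Fr _ Dy yr)))//.
rewrite mulrA ler_wpM2r// mulrA ler_pdivrMr// mulrC.
by rewrite ler_wpM2l ?(ltW e0)// lerDl.
Qed.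

Lemma has_derivative_in_continuous D F x d : has_derivative_in D F x d ->
  forall e, 0 < e -> exists2 r, 0 < r &
    forall y, D y -> `|y - x| < r -> `|F y - F x| < e.
Proof.
move=> dF e e0; have [r r0 Fr] := dF 1 ltr01.
have d0 : 0 < `|d| + 2 by rewrite ltr_wpDl.
exists (Num.min r (e / (`|d| + 2))); first by rewrite lt_min r0 divr_gt0.
move=> y Dy; rewrite lt_min => /andP[yr]; rewrite ltr_pdivlMr// => ye.
have := Fr _ Dy yr; rewrite mul1r => /(lerD (lexx `|d * (y - x)|)).
move=> /(le_trans (ler_normD _ _)); rewrite [X in `|X|](_ : _ = F y - F x); last by ring.
move=> /le_lt_trans; apply; apply: le_lt_trans ye.
by rewrite normrM; have := normr_ge0 (y - x); nra.
Qed.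

Lemma has_derivative_inM D F G x d e :
  has_derivative_in D F x d -> has_derivative_in D G x e ->
  has_derivative_in D (fun y => F y * G y) x (d * G x + F x * e).
Proof.
move=> dF dG k k0.
pose B := `|F x| + `|d| + `|G x| + 2.
have B0 : 0 < B.
  by rewrite /B; have := normr_ge0 (F x); have := normr_ge0 d; have := normr_ge0 (G x); lra.
have kB : 0 < k / (B + B) by rewrite divr_gt0// addr_gt0.
have kB' : 0 < Num.min 1 (k / (B + B)) by rewrite lt_min ltr01.
have [r r0 Fr] := dF _ kB'; have [s s0 Gs] := dG _ kB.
have [t t0 Gt] := has_derivative_in_continuous dG kB'.
exists (Num.min r (Num.min s t)); first by rewrite !lt_min r0 s0.
move=> y Dy; rewrite !lt_min => /and3P[yr ys yt].
set q := k / (B + B) in kB kB' Fr Gs Gt *.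
have kq : k = q * (B + B) by rewrite /q divfK// gt_eqF// addr_gt0.
have -> : F y * G y - F x * G x - (d * G x + F x * e) * (y - x) =
  (F y - F x - d * (y - x)) * ((G y - G x) + G x) + d * (y - x) * (G y - G x) +
  F x * (G y - G x - e * (y - x)) by ring.
apply: (le_trans (ler_normD _ _)); rewrite normrM.
apply: (le_trans (lerD (ler_normD _ _) (lexx _))); rewrite !normrM.
have := ler_normD (G y - G x) (G x).
have := Fr _ Dy yr; have := Gs _ Dy ys; have /ltW := Gt _ Dy yt.
have : Num.min 1 q <= 1 by rewrite ge_min lexx.
have : Num.min 1 q <= q by rewrite ge_min lexx orbT.
have := normr_ge0 (F y - F x - d * (y - x)).
have := normr_ge0 (G y - G x - e * (y - x)).
have := normr_ge0 (G y - G x + G x).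
have := normr_ge0 (G y - G x).
have := normr_ge0 (y - x).
have := normr_ge0 (F x).
have := normr_ge0 (G x).
have := normr_ge0 d.
rewrite kq; move: (Num.min 1 q) kB' => m m0.
rewrite /B; move: kB; clear.
move: `|F y - F x - d * (y - x)| `|G y - G x - e * (y - x)| `|G y - G x + G x|.
move: `|G y - G x| `|y - x| `|F x| `|G x| `|d| => g h f1 g1 d1 P Q S q0.
move=> d0 G0 F0 h0 g0 S0 Q0 P0 mq m1 gm Qh Ph Sg.
have H1 : P * S <= (q * h) * (1 + g1).
  by apply: ler_pM => //; [apply: (le_trans Ph); rewrite ler_wpM2r | lra].
have H2 : d1 * h * g <= d1 * h * q by apply: ler_wpM2l; [rewrite mulr_ge0|lra].
have H3 : f1 * Q <= f1 * (q * h) by apply: ler_wpM2l.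
have qh0 : 0 <= q * h by rewrite mulr_ge0// ltW.
nra.
Qed.

Lemma is_derive_has_derivative F x d :
  is_derive x 1 F d <-> has_derivative_in setT F x d.
Proof.
have key : (h^-1 *: (F (h *: 1%R + x) - F x) @[h --> 0^'] --> d) <->
    has_derivative_in setT F x d.
  split=> [/cvgrPdist_le H e e0|H].
    have := H _ e0; rewrite near_withinE /= => -[r /= r0 Hr].
    exists r => // y _ yxr.
    have [->|yx] := eqVneq y x.
      by rewrite !subrr mulr0 subr0 normr0 mulr0.
    have := Hr (y - x); rewrite /ball_ /= sub0r normrN subr_eq0 => /(_ yxr yx).
    rewrite /GRing.scale /= mulr1 subrK => He.
    have yx0 : y - x != 0 by rewrite subr_eq0.
    rewrite [X in `|X|](_ : _ = - (d - (y - x)^-1 * (F y - F x)) * (y - x)).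
      by rewrite normrM normrN ler_wpM2r.
    by field.
  apply/cvgrPdist_le => e e0; rewrite near_withinE.
  have [r r0 Fr] := H _ e0; exists r => //= h; rewrite /ball_ /= sub0r normrN => hr h0.
  have := Fr (h + x) I; rewrite addrK => /(_ hr).
  rewrite /GRing.scale /= mulr1 => He.
  rewrite -(ler_pM2r (_ : 0 < `|h|)) ?normr_gt0// -normrM -normrN.
  by rewrite [X in `|X|](_ : _ = F (h + x) - F x - d * h)//; field.
rewrite -key; split => [[dF Fd]|Fd].
  move: dF => /cvg_ex[l /= Fl]; rewrite -Fd /derive.
  suff -> : lim (h^-1 *: ((F \o shift x) (h *: 1%R) - F x) @[h --> 0^'] ) = l by [].
  exact/cvg_lim.
apply: DeriveDef; first by apply/cvg_ex; exists d.
exact/cvg_lim.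
Qed.

Lemma within_dnbhs_itv_proper (a b x : R) : a < b -> x \in `[a, b] ->
  ProperFilter (within `[a, b] x^').
Proof.
move=> ab; rewrite in_itv/= => /andP[ax xb].
split; last exact: within_filter.
rewrite /within /= near_withinE => -[r /= r0 /(_ _) H].
have [xb'|bx] := ltP x b.
  pose y := Num.min b (x + r / 2).
  have xy : x < y by rewrite lt_min xb' ltrDl divr_gt0.
  have := H y; rewrite /ball_ /= distrC gtr0_norm ?subr_gt0//.
  have yr : y <= x + r / 2 by rewrite ge_min lexx orbT.
  have -> : y - x < r by lra.
  rewrite gt_eqF// in_itv/= (ltW (le_lt_trans ax xy))/= => /(_ isT isT); apply.
  by rewrite ge_min lexx.
have xb' : x = b by apply/eqP; rewrite eq_le xb bx.
pose y := Num.max a (x - r / 2).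
have xy : y < x by rewrite gt_max xb' ab/= gtrBl divr_gt0.
have := H y; rewrite /ball_ /= gtr0_norm ?subr_gt0//.
have yr : x - r / 2 <= y by rewrite le_max lexx orbT.
have -> : x - y < r by lra.
rewrite lt_eqF// in_itv/= (le_trans (ltW xy) xb) andbT => /(_ isT isT); apply.
by rewrite le_max lexx.
Qed.

Lemma has_derivative_in_cvg D F x d : has_derivative_in D F x d <->
  ((F z - F x) / (z - x) @[z --> within D x^'] --> d).
Proof.
split=> [H|/cvgrPdist_le H e e0].
  apply/cvgrPdist_le => e e0; have [r r0 Fr] := H _ e0.
  rewrite near_withinE near_withinE; exists r => //= y; rewrite /ball_ /= => yr yx Dy.
  have yx0 : y - x != 0 by rewrite subr_eq0.
  rewrite -(ler_pM2r (_ : 0 < `|y - x|)) ?normr_gt0// -normrM -normrN.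
  rewrite [X in `|X|](_ : _ = F y - F x - d * (y - x)); last by field.
  by apply: Fr => //; rewrite distrC.
have := H _ e0; rewrite near_withinE near_withinE => -[r /= r0 Hr].
exists r => // y Dy yxr.
have [->|yx] := eqVneq y x; first by rewrite !subrr mulr0 subr0 normr0 mulr0.
have yx0 : y - x != 0 by rewrite subr_eq0.
have := Hr y; rewrite /ball_ /= distrC => /(_ yxr yx Dy) He.
rewrite [X in `|X|](_ : _ = - (d - (F y - F x) / (y - x)) * (y - x)).
  by rewrite normrM normrN ler_wpM2r.
by field.
Qed.

Lemma derivable_inP (a b : R) F x : a < b -> x \in `[a, b] ->
  derivable_in `[a, b] F x ->
  has_derivative_in `[a, b] F x (derive_in `[a, b] F x).
Proof.
move=> ab xab H; apply/has_derivative_in_cvg.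
exact: H.
Qed.

Lemma derive_inP (a b : R) F x d : a < b -> x \in `[a, b] ->
  has_derivative_in `[a, b] F x d ->
  derivable_in `[a, b] F x /\ derive_in `[a, b] F x = d.
Proof.
move=> ab xab /has_derivative_in_cvg H; split; first by apply/cvg_ex; exists d.
have := within_dnbhs_itv_proper ab xab => pf.
exact/cvg_lim.
Qed.

Lemma has_derivative_in_itv (a b : R) F x d : x \in `]a, b[ ->
  has_derivative_in `[a, b] F x d <-> has_derivative_in setT F x d.
Proof.
rewrite in_itv/= => /andP[ax xb]; split; last exact: has_derivative_inS.
move=> H e /H[r r0 Fr].
exists (Num.min r (Num.min (x - a) (b - x))); first by rewrite !lt_min r0 !subr_gt0 ax.
move=> y _; rewrite !lt_min => /and3P[yr ya yb]; apply: Fr => //=.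
by rewrite in_itv/=; move: ya yb; rewrite !ltr_norml => /andP[? ?] /andP[? ?]; apply/andP; split; lra.
Qed.

Lemma within_continuousP D F :
  {within D, continuous F} <->
  forall x, D x -> forall e, 0 < e -> exists2 r, 0 < r &
    forall y, D y -> `|y - x| < r -> `|F y - F x| < e.
Proof.
rewrite subspace_continuousP; split=> H x Dx.
  move=> e e0; have /cvgrPdist_lt /(_ _ e0) := H x Dx.
  rewrite near_withinE => -[r /= r0 Hr]; exists r => // y Dy yx.
  by rewrite distrC; apply: Hr => //; rewrite /ball_/= distrC.
apply/cvgrPdist_lt => e e0; have [r r0 Hr] := H x Dx e e0.
rewrite near_withinE; exists r => //= y; rewrite /ball_/= distrC => yx Dy.
by rewrite distrC; exact: Hr.
Qed.

Lemma has_derivative_within_continuous D F (d : R -> R) :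
  (forall x, D x -> has_derivative_in D F x (d x)) -> {within D, continuous F}.
Proof.
move=> dF; apply/within_continuousP => x Dx e e0.
exact: (has_derivative_in_continuous (dF x Dx)).
Qed.

End derivative_in.

(** * Bounded derivatives and the fundamental theorem of calculus *)

Section bounded_derivative.
Context {R : realType}.
Notation mu := (@lebesgue_measure R).
Implicit Types (F G f : R -> R) (a b x d e c M : R).

Lemma mean_value F f a b : a < b -> {within `[a, b], continuous F} ->
  (forall x, x \in `]a, b[ -> has_derivative_in setT F x (f x)) ->
  exists2 c, c \in `]a, b[ & F b - F a = f c * (b - a).
Proof.
move=> ab cF dF; apply: MVT => // x xab.
exact/is_derive_has_derivative/dF.
Qed.

Lemma bounded_derivative_lipschitz F f a b M :
  {within `[a, b], continuous F} ->
  (forall x, x \in `]a, b[ -> has_derivative_in setT F x (f x)) ->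
  (forall x, x \in `]a, b[ -> `|f x| <= M) ->
  forall u v, u \in `[a, b] -> v \in `[a, b] -> `|F u - F v| <= M * `|u - v|.
Proof.
move=> cF dF fM.
have key u v : u \in `[a, b] -> v \in `[a, b] -> u < v ->
    `|F v - F u| <= M * `|v - u|.
  rewrite !in_itv/= => /andP[au ub] /andP[av vb] uv.
  have [||c] := @mean_value F f u v uv.
  - apply: continuous_subspaceW cF => z /=; rewrite !in_itv/= => /andP[uz zv].
    by rewrite (le_trans au uz) (le_trans zv vb).
  - move=> x; rewrite in_itv/= => /andP[ux xv]; apply: dF.
    by rewrite in_itv/= (le_lt_trans au ux) (lt_le_trans xv vb).
  rewrite in_itv/= => /andP[uc cv] ->; rewrite normrM ler_wpM2r// fM//.
  by rewrite in_itv/= (le_lt_trans au uc) (lt_le_trans cv vb).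
move=> u v uab vab; have [uv|vu|->] := ltgtP u v.
- by rewrite distrC (distrC u); exact: key.
- exact: key.
- by rewrite !subrr !normr0 mulr0.
Qed.

Lemma lipschitz_continuous F M : (forall u v, `|F u - F v| <= M * `|u - v|) ->
  continuous F.
Proof.
move=> FM x; apply/cvgrPdist_lt => e e0; exists (e / (`|M| + 1)) => /=.
  by rewrite divr_gt0// ltr_wpDl.
move=> y; rewrite /ball_/= ltr_pdivlMr ?ltr_wpDl// => xy.
apply: (le_lt_trans (FM _ _)); apply: le_lt_trans xy; rewrite mulrC ler_wpM2l//.
by rewrite (le_trans (ler_norm _))// lerDl.
Qed.

Lemma clamp_in a b x : a <= b -> Num.max a (Num.min x b) \in `[a, b].
Proof.
move=> ab; rewrite in_itv/= le_max lexx/= ge_max ab/=.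
by rewrite ge_min lexx orbT.
Qed.

Lemma clamp_id a b x : x \in `[a, b] -> Num.max a (Num.min x b) = x.
Proof. by rewrite in_itv/= => /andP[ax xb]; rewrite (min_idPl xb) (max_idPr ax). Qed.

Lemma clamp_lipschitz a b u v : a <= b ->
  `|Num.max a (Num.min u b) - Num.max a (Num.min v b)| <= `|u - v|.
Proof.
move=> ab.
have := ler_norm (u - v); have := ler_norm (v - u); rewrite distrC ler_norml.
have [ub|bu] := leP u b; have [vb|bv] := leP v b.
- by case: (leP a u) => ?; case: (leP a v) => ? ? ?; apply/andP; split; lra.
- by case: (leP a u) => ?; case: (leP a b) => ? ? ?; apply/andP; split; lra.
- by case: (leP a b) => ?; case: (leP a v) => ? ? ?; apply/andP; split; lra.
- by case: (leP a b) => ? ? ?; apply/andP; split; lra.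
Qed.

Lemma continuous_primitive G a : continuous G ->
  exists H, forall x, a < x -> has_derivative_in setT H x (G x).
Proof.
move=> cG; pose H y := \int[mu]_(t in `[a, y]) G t.
exists H => x ax; apply/is_derive_has_derivative.
have intG : mu.-integrable `[a, x + 1] (EFin \o G).
  apply: continuous_compact_integrable; first exact: segment_compact.
  exact: continuous_subspaceT.
have [dH HG] := continuous_FTC1_closed (ltr_pwDr ltr01 (lexx x)) intG ax (cG x).
apply: (DeriveDef dH).
by rewrite -derive1E.
Qed.

Lemma FTC_continuous (H G : R -> R) a b : a < b -> continuous G ->
  (forall x, a <= x <= b -> has_derivative_in setT H x (G x)) ->
  (\int[mu]_(x in `[a, b]) (G x)%:E = (H b - H a)%:E)%E.
Proof.
move=> ab cG dH; rewrite EFinB; apply: continuous_FTC2 => //.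
- exact: continuous_subspaceT.
- have cH x : a <= x <= b -> {for x, continuous H}.
    move=> xab; apply/cvgrPdist_lt => e e0.
    have [r r0 Hr] := has_derivative_in_continuous (dH _ xab) e0.
    by exists r => //= y; rewrite /ball_/= distrC => /(Hr _ I); rewrite distrC.
  split.
  + move=> x; rewrite in_itv/= => /andP[ax xb].
    have xab : a <= x <= b by rewrite !ltW.
    by have /is_derive_has_derivative[] := dH x xab.
  + by apply: cvg_at_right_filter; apply: cH; rewrite lexx ltW.
  + by apply: cvg_at_left_filter; apply: cH; rewrite lexx ltW.
- move=> x; rewrite in_itv/= => /andP[ax xb].
  have xab : a <= x <= b by rewrite !ltW.
  by rewrite derive1E; have /is_derive_has_derivative[] := dH x xab.
Qed.

Lemma has_derivative_in_quotient F x d : has_derivative_in setT F x d ->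
  n.+1%:R * (F (x + n.+1%:R^-1) - F x) @[n --> \oo] --> d.
Proof.
move=> dF; apply/cvgrPdist_le => e e0.
have [r r0 Fr] := dF _ e0.
have /cvgrPdist_lt/(_ _ r0) := @cvg_harmonic R.
apply: filterS => n; rewrite sub0r normrN /= => nr.
have n0 : 0 < n.+1%:R :> R by rewrite ltr0n.
have := Fr (x + n.+1%:R^-1) I; rewrite [x + _]addrC addrK => /(_ nr) H.
rewrite -(ler_pM2r (_ : 0 < `|n.+1%:R^-1 : R|)) ?normr_gt0 ?invr_eq0 ?gt_eqF//.
rewrite -normrM -normrN [X in `|X|](_ : _ = F (n.+1%:R^-1 + x) - F x - d * n.+1%:R^-1)//.
by field; rewrite addrC natr1 gt_eqF.
Qed.

(** For a derivative f that is bounded but not assumed continuous: extend F by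
    constants outside [a, b].  The difference quotients of the extension with
    step 1/(n+1) are continuous, bounded by the Lipschitz constant M, and tend
    to f, so dominated convergence applies; their integrals telescope to
    averages of F near b minus averages of F near a. *)
Lemma bounded_derivative_FTC F f a b M : a < b ->
  {within `[a, b], continuous F} ->
  (forall x, x \in `]a, b[ -> has_derivative_in setT F x (f x)) ->
  (forall x, x \in `]a, b[ -> `|f x| <= M) ->
  mu.-integrable `]a, b[ (EFin \o f) /\
  \int[mu]_(x in `]a, b[) f x = F b - F a.
Proof.
move=> ab cF dF fM; have ab' := ltW ab.
pose G x := F (Num.max a (Num.min x b)).
have GM u v : `|G u - G v| <= M * `|u - v|.
  apply: (le_trans (bounded_derivative_lipschitz cF dF fM _ _)); rewrite ?clamp_in//.
  rewrite ler_wpM2l ?clamp_lipschitz//.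
  by have := fM ((a + b) / 2); rewrite in_itv/= !midf_lt// => /(_ isT); apply: le_trans.
have cG := lipschitz_continuous GM.
have GF x : x \in `[a, b] -> G x = F x by move=> xab; rewrite /G clamp_id.
have dG x : x \in `]a, b[ -> has_derivative_in setT G x (f x).
  move=> xab; apply/(has_derivative_in_itv _ _ xab).
  apply: (has_derivative_in_ext (F := F)).
  - exact: subset_itv_oo_cc.
  - by move=> y yab; rewrite GF.
  - exact/(has_derivative_in_itv _ _ xab)/dF.
pose q n x := n.+1%:R * (G (x + n.+1%:R^-1) - G x).
have cq n : continuous (q n).
  move=> x; apply: cvgM; first exact: cvg_cst.
  apply: cvgB; last exact: cG.
  apply: continuous_comp; last exact: cG.
  by apply: cvgD; [exact: cvg_id|exact: cvg_cst].
have mq n : measurable_fun `]a, b[ (q n).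
  by apply: measurable_funTS; exact: continuous_measurable_fun.
have qf x : x \in `]a, b[ -> q n x @[n --> \oo] --> f x.
  by move=> /dG/has_derivative_in_quotient.
have mf : measurable_fun `]a, b[ f.
  by apply: (measurable_realfun.measurable_fun_cvg mq).
have qM n x : `|q n x| <= M.
  rewrite /q normrM ger0_norm// -ler_pdivlMl//.
  by rewrite (le_trans (GM _ _))// [x + _]addrC addrK ger0_norm// mulrC.
have fin : (mu `]a, b[ < +oo)%E by rewrite lebesgue_measure_itv/= lte_fin ab -EFinB ltry.
have icst : mu.-integrable `]a, b[ (EFin \o cst M).
  apply: measurable_bounded_integrable => //.
  by exists `|M|; split=> [|y My x _]; rewrite ?num_real//= ltW.
have cvq : {ae mu, forall x, `]a, b[%classic x ->
    (fun n => (q n x)%:E) @ \oo --> (EFin \o f) x}.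
  by apply: aeW => x xab; apply: cvg_EFin; [exact: nearW|exact: qf].
have leq : {ae mu, forall x n, `]a, b[%classic x ->
    (`|(q n x)%:E| <= (EFin \o cst M) x)%E}.
  by apply: aeW => x n _; rewrite /= lee_fin.
have mqE n : measurable_fun `]a, b[ (fun x => (q n x)%:E) by exact/measurable_EFinP.
have mfE : measurable_fun `]a, b[ (EFin \o f) by exact/measurable_EFinP.
have [intf _ cvgf] :=
  @dominated_convergence _ _ _ mu _ (measurable_itv `]a, b[) _ _ _ mqE mfE cvq icst leq.
split=> //.
have [H dH] := @continuous_primitive G (a - 1) cG.
(* The integral of a quotient of G is a difference of two increments of the
   primitive H of G, taken at b and at a. *)
have dHs (s x : R) : 0 <= s -> a <= x -> has_derivative_in setT (fun y => H (y + s)) x (G (x + s)).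
  move=> s0 ax e e0; have [|r r0 Hr] := dH (x + s) _ e e0; first by lra.
  exists r => // y _ yx; have := Hr (y + s) I.
  have -> : y + s - (x + s) = y - x by ring.
  exact.
have qE n : (\int[mu]_(x in `]a, b[) (q n x)%:E =
    (n.+1%:R * (H (b + n.+1%:R^-1) - H b) - n.+1%:R * (H (a + n.+1%:R^-1) - H a))%:E)%E.
  rewrite -(@integral_itv_bndoo _ _ _ _ true false); last exact/measurable_EFinP.
  rewrite (@FTC_continuous (fun x => n.+1%:R * (H (x + n.+1%:R^-1) - H (x + 0))))//.
    by congr EFin; rewrite !addr0; ring.
  move=> x /andP[ax xb]; apply: has_derivative_inZ.
  have n0 : 0 <= n.+1%:R^-1 :> R by rewrite invr_ge0.
  have := has_derivative_inD (dHs n.+1%:R^-1 x n0 ax)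
     (has_derivative_inZ (-1) (dHs 0 x (lexx _) ax)).
  rewrite addr0 mulN1r; apply: has_derivative_in_ext => // y _.
  by rewrite mulN1r.
rewrite /Rintegral.
have -> : (\int[mu]_(x in `]a, b[) (f x)%:E = (F b - F a)%:E)%E; last by [].
have /cvg_lim <- // := cvgf.
apply/cvg_lim => //.
rewrite -(GF b) ?in_itv/= ?lexx ?ab'// -(GF a) ?in_itv/= ?lexx ?ab'//.
under eq_fun do rewrite qE.
apply: cvg_EFin; first exact: nearW.
by apply: cvgB; apply: has_derivative_in_quotient; apply: dH; lra.
Qed.

End bounded_derivative.

(** * The Denjoy-Clarkson property of derivatives *)

Section denjoy_clarkson.
Context {R : realType}.
Notation mu := (@lebesgue_measure R).
Implicit Types (F G f : R -> R) (a b x d e c M : R).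

(** Baire's theorem inside a closed subset K of the line, by nested closed
    intervals centred on K: if no C n contained a whole relatively open piece
    of K, one could shrink around points of K so as to leave every C n, and the
    limit point would lie in K but in none of them. *)
Lemma baire_closed_subset (K : set R) (C : nat -> set R) : K !=set0 ->
  (forall x, (forall r, 0 < r -> exists2 y, K y & `|y - x| < r) -> K x) ->
  (forall n x, K x -> ~ C n x ->
     exists2 r, 0 < r & forall y, K y -> `|y - x| < r -> ~ C n y) ->
  (forall x, K x -> exists n, C n x) ->
  exists n p r, [/\ K p, 0 < r & forall x, K x -> `|x - p| < r -> C n x].
Proof.
move=> [p0 Kp0] Kcl Ccl KC; apply: contrapT => nB.
(* u codes the closed interval of radius u.2 around u.1; v leaves C n. *)
have step n (u : R * R) : exists v : R * R, K u.1 -> 0 < u.2 ->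
    [/\ K v.1, 0 < v.2, v.2 <= n.+1%:R^-1, `|v.1 - u.1| + v.2 <= u.2 &
        forall y, K y -> `|y - v.1| <= v.2 -> ~ C n y].
  have [[Ku u0]|nK] := pselect (K u.1 /\ 0 < u.2); last first.
    by exists u => ? ?; case: nK.
  have [q Kq [qu nCq]] : exists2 q, K q & `|q - u.1| < u.2 /\ ~ C n q.
    apply: contrapT => nq; apply: nB; exists n, u.1, u.2; split=> // x Kx xu.
    by apply: contrapT => nCx; apply: nq; exists x.
  have [r r0 Hr] := Ccl _ _ Kq nCq.
  exists (q, Num.min (r / 2) (Num.min n.+1%:R^-1 (u.2 - `|q - u.1|))) => _ _ /=.
  have m1 : Num.min (r / 2) (Num.min n.+1%:R^-1 (u.2 - `|q - u.1|)) <= r / 2.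
    by rewrite ge_min lexx.
  split=> //.
  - by rewrite !lt_min divr_gt0// invr_gt0 ltr0n/= subr_gt0.
  - by rewrite !ge_min lexx/= orbT.
  - by rewrite -lerBrDl !ge_min lexx/= !orbT.
  - by move=> y Ky yq; apply: Hr => //; lra.
have [g gP] := choice (fun nu : nat * (R * R) => step nu.1 nu.2).
pose u := fix u n := if n is m.+1 then g (m, u m) else (p0, 1 : R).
have uK n : K (u n).1 /\ 0 < (u n).2.
  by elim: n => [//|n [K1 K2]] /=; have [] := gP (n, u n) K1 K2.
have uS n := gP (n, u n) (uK n).1 (uK n).2.
have nest n m : (n <= m)%N -> `|(u m).1 - (u n).1| + (u m).2 <= (u n).2.
  move=> /subnK <-; elim: (m - n)%N => [|k IH]; first by rewrite add0n subrr normr0 add0r.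
  have [_ _ _ /= H _] := uS (k + n)%N.
  have := ler_normD ((u (k.+1 + n)%N).1 - (u (k + n)%N).1) ((u (k + n)%N).1 - (u n).1).
  by rewrite subrKA addSn /=; lra.
have cross n m : (u n).1 - (u n).2 <= (u m).1 + (u m).2.
  have [nm|/ltnW mn] := leqP n m.
    by have := nest _ _ nm; have := (uK m).2; rewrite distrC; have := ler_norm ((u n).1 - (u m).1); lra.
  by have := nest _ _ mn; have := (uK n).2; have := ler_norm ((u n).1 - (u m).1); lra.
pose S := range (fun n => (u n).1 - (u n).2).
have supS : has_sup S.
  split; first by exists ((u 0%N).1 - (u 0%N).2); exists 0%N.
  by exists ((u 0%N).1 + (u 0%N).2) => _ [n _ <-]; exact: cross.
(* The common point of the nested intervals. *)
pose z := sup S.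
have zu n : `|z - (u n).1| <= (u n).2.
  rewrite ler_norml; apply/andP; split.
    by rewrite lerBrDl; apply: ub_le_sup; [exact: supS.2|exists n].
  rewrite lerBlDl; apply: ge_sup; first exact: supS.1.
  by move=> _ [m _ <-]; exact: cross.
have Kz : K z.
  apply: Kcl => r r0.
  have /cvgrPdist_lt/(_ _ r0)[N _ /(_ N (leqnn N))] := @cvg_harmonic R.
  rewrite /= sub0r normrN ger0_norm// => Nr.
  exists (u N.+1).1; first exact: (uK _).1.
  rewrite distrC; apply: (le_lt_trans (zu _)).
  by have [_ _ H _ _] := uS N; apply: le_lt_trans Nr.
have [n Cz] := KC _ Kz.
by have [_ _ _ _ /(_ z Kz (zu n.+1))] := uS n.
Qed.

(** A minimum of x |-> F x - v x is interior, as the slope is negative at a and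
    positive at b, and there the derivative of F is v. *)
Lemma darboux F f a b v : a < b ->
  (forall x, x \in `[a, b] -> has_derivative_in setT F x (f x)) ->
  f a < v < f b -> exists2 c, c \in `]a, b[ & f c = v.
Proof.
move=> ab dF /andP[fav vfb].
pose G x := F x + (- v) * x.
have dG x : x \in `[a, b] -> has_derivative_in setT G x (f x - v).
  move=> xab; have -> : f x - v = f x + - v * 1 by rewrite mulr1.
  by apply: has_derivative_inD; [exact: dF|exact/has_derivative_inZ/has_derivative_in_id].
have cG : {within `[a, b], continuous G}.
  apply: (has_derivative_within_continuous (d := fun x => f x - v)) => x xab.
  exact/(has_derivative_inS (@subsetT _ _))/dG.
have aab : a \in `[a, b] by rewrite in_itv/= lexx ltW.
have bab : b \in `[a, b] by rewrite in_itv/= lexx ltW.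
have [c cab cmin] := EVT_min (ltW ab) cG.
have ca : a < c.
  have ac : a <= c by move: cab; rewrite in_itv/= => /andP[].
  rewrite lt_neqAle ac andbT; apply/negP => /eqP ca.
  have [|r r0 Hr] := dG a aab ((v - f a) / 2); first by rewrite divr_gt0 ?subr_gt0.
  pose y := Num.min b (a + r / 2).
  have ay : a < y by rewrite lt_min ab ltrDl divr_gt0.
  have yr : y <= a + r / 2 by rewrite ge_min lexx orbT.
  have yb : y <= b by rewrite ge_min lexx.
  have := Hr y I; rewrite gtr0_norm ?subr_gt0// => /(_ _)/wrap[]; first lra.
  have := cmin y; rewrite -ca in_itv/= (ltW ay) yb => /(_ isT) ?.
  rewrite ler_norml => /andP[_]; nra.
have cb : c < b.
  have ac : c <= b by move: cab; rewrite in_itv/= => /andP[].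
  rewrite lt_neqAle ac andbT; apply/negP => /eqP cb.
  have [|r r0 Hr] := dG b bab ((f b - v) / 2); first by rewrite divr_gt0 ?subr_gt0.
  pose y := Num.max a (b - r / 2).
  have yb : y < b by rewrite gt_max ab gtrBl divr_gt0.
  have yr : b - r / 2 <= y by rewrite le_max lexx orbT.
  have ay : a <= y by rewrite le_max lexx.
  have := Hr y I; rewrite ltr0_norm ?subr_lt0// => /(_ _)/wrap[]; first lra.
  have := cmin y; rewrite cb in_itv/= (ltW yb) ay => /(_ isT) ?.
  rewrite ler_norml => /andP[_]; nra.
have cab' : c \in `]a, b[ by rewrite in_itv/= ca cb.
exists c => //.
have : is_derive c 1 G 0.
  apply: (@derive1_at_min _ _ a b) => //; first exact: ltW.
    by move=> t tab; have /is_derive_has_derivative[] := dG t (subset_itv_oo_cc tab).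
  by move=> t tab; apply: cmin; exact: subset_itv_oo_cc.
have /is_derive_has_derivative[_ G'c] := dG c cab.
by move=> [_]; rewrite G'c => /eqP; rewrite subr_eq0 => /eqP.
Qed.

(** The symmetry that exchanges left and right below. *)
Lemma has_derivative_reflect F x d : has_derivative_in setT F (- x) d ->
  has_derivative_in setT (fun y => - F (- y)) x d.
Proof.
move=> dF e e0; have [r r0 Hr] := dF e e0; exists r => // y _ yx.
have := Hr (- y) I; rewrite -opprD normrN -opprD => /(_ _)/wrap[//|].
by rewrite -[X in X <= _]normrN; congr (`|_| <= _); ring.
Qed.

(** A derivative at k is a limit of its own values at points to the right of k,
    by the mean value theorem. *)
Lemma derivative_ge_right F f k x v : k < x ->
  (forall y, y \in `[k, x] -> has_derivative_in setT F y (f y)) ->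
  (forall y, y \in `]k, x] -> v <= f y) -> v <= f k.
Proof.
move=> kx dF fv; rewrite leNgt; apply/negP => fkv.
have kk : k \in `[k, x] by rewrite in_itv/= lexx ltW.
have [|r r0 Hr] := dF k kk ((v - f k) / 2); first by rewrite divr_gt0 ?subr_gt0.
pose y := Num.min x (k + r / 2).
have ky : k < y by rewrite lt_min kx ltrDl divr_gt0.
have yr : y <= k + r / 2 by rewrite ge_min lexx orbT.
have yx : y <= x by rewrite ge_min lexx.
have sub z : z \in `[k, y] -> z \in `[k, x].
  by rewrite !in_itv/= => /andP[-> /le_trans -> //].
have [||c] := @mean_value _ F f k y ky.
- apply: (has_derivative_within_continuous (d := f)) => z /sub zkx.
  exact/(has_derivative_inS (@subsetT _ _))/dF.
- by move=> z /subset_itv_oo_cc/sub/dF.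
rewrite in_itv/= => /andP[kc cy] Fc.
have := fv c; rewrite in_itv/= kc (le_trans (ltW cy) yx) => /(_ isT) ?.
have := Hr y I; rewrite gtr0_norm ?subr_gt0// => /(_ _)/wrap[]; first lra.
by rewrite Fc ler_norml => /andP[_]; nra.
Qed.

(** Suppose f x >= be for some x to the right of p, and let k be the last point
    of K before x.  Strictly after k the derivative avoids the open interval
    between al and be, so by Darboux it stays >= be up to x; then also
    f k >= be, although k lies in K. *)
Lemma between_propagates_right F f (K : set R) c d al be p : al < be ->
  (forall x, x \in `]c, d[ -> has_derivative_in setT F x (f x)) ->
  (forall x, (forall r, 0 < r -> exists2 y, K y & `|y - x| < r) -> K x) ->
  (forall x, x \in `]c, d[ -> al < f x < be -> K x) ->
  K p -> (forall x, x \in `]c, d[ -> K x -> f x < be) ->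
  c < p -> forall x, p < x -> x < d -> f x < be.
Proof.
move=> albe dF Kcl EK Kp Kbe cp x px xd; rewrite ltNge; apply/negP => bex.
have nKx : ~ K x.
  by move=> /Kbe; rewrite in_itv/= xd (lt_trans cp px) => /(_ isT); rewrite ltNge bex.
pose S := [set y | K y /\ y <= x].
have Sp : S p by split=> //; exact: ltW.
have supS : has_sup S by split; [exists p|exists x => y []].
pose k := sup S.
have pk : p <= k by apply: ub_le_sup => //; exact: supS.2.
have kx : k <= x by apply: ge_sup; [exists p|move=> y []].
have Kk : K k.
  apply: Kcl => r r0; have [y [Ky yx] ky] := sup_adherent r0 supS.
  exists y => //; rewrite ltr_norml ltrBrDl ky/= ltrBlDl.
  rewrite -[y]addr0 ler_ltD//.
  by apply: ub_le_sup; [exact: supS.2|split].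
have kx' : k < x.
  by rewrite lt_neqAle kx andbT; apply/eqP => kE; apply: nKx; rewrite -kE.
have ck := lt_le_trans cp pk.
have kd := lt_trans kx' xd.
have dF' y : y \in `[k, x] -> has_derivative_in setT F y (f y).
  rewrite in_itv/= => /andP[ky yx]; apply: dF.
  by rewrite in_itv/= (lt_le_trans ck ky) (le_lt_trans yx xd).
have : be <= f k.
  apply: (derivative_ge_right kx' dF') => y; rewrite in_itv/= => /andP[ky yx].
  have ycd : y \in `]c, d[ by rewrite in_itv/= (lt_trans ck ky) (le_lt_trans yx xd).
  have nK z : k < z -> z <= x -> ~ K z.
    by move=> kz zx Kz; have : z <= k; [apply: ub_le_sup; [exact: supS.2|split]|lra].
  rewrite leNgt; apply/negP => ybe.
  have yal : f y <= al.
    by rewrite leNgt; apply/negP => yal; apply: (nK y) => //; apply: EK; rewrite ?yal.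
  have yx' : y < x.
    by rewrite lt_neqAle yx andbT; apply/eqP => yE; move: ybe; rewrite yE ltNge bex.
  have [||z] := @darboux F f y x ((al + be) / 2) yx'.
  - move=> z; rewrite in_itv/= => /andP[yz zx]; apply: dF'.
    by rewrite in_itv/= zx (le_trans (ltW ky) yz).
  - by rewrite (le_lt_trans yal) ?midf_lt//= (lt_le_trans _ bex)// midf_lt.
  rewrite in_itv/= => /andP[yz zx] fz.
  apply: (nK z); rewrite ?(lt_trans ky yz) ?(ltW zx)//.
  apply: EK; last by rewrite fz !midf_lt.
  by rewrite in_itv/= (lt_trans ck (lt_trans ky yz)) (lt_trans zx xd).
by rewrite leNgt Kbe// in_itv/= ck kd.
Qed.

Lemma between_propagates F f (K : set R) c d al be p : al < be ->
  (forall x, x \in `]c, d[ -> has_derivative_in setT F x (f x)) ->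
  (forall x, (forall r, 0 < r -> exists2 y, K y & `|y - x| < r) -> K x) ->
  (forall x, x \in `]c, d[ -> al < f x < be -> K x) ->
  K p -> (forall x, x \in `]c, d[ -> K x -> f x < be) ->
  p \in `]c, d[ -> forall x, x \in `]c, d[ -> f x < be.
Proof.
move=> albe dF Kcl EK Kp Kbe pcd x xcd.
have oppE (y : R) : (y \in `](- d), (- c)[) = (- y \in `]c, d[).
  by rewrite !in_itv/= ltrNl ltrNr andbC.
move: (pcd) (xcd); rewrite !in_itv/= => /andP[cp pd] /andP[cx xd].
have [xp|px|->] := ltgtP x p; last exact: Kbe.
- rewrite -[x]opprK.
  apply: (@between_propagates_right (fun y => - F (- y)) (f \o -%R) (K \o -%R)
    (- d) (- c) al be (- p)); rewrite /= ?opprK ?ltrN2 //.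
  + by move=> y; rewrite oppE => /dF; exact: has_derivative_reflect.
  + move=> y Hy; apply: Kcl => r r0; have [z Kz zy] := Hy r r0.
    by exists (- z) => //; rewrite -opprD normrN.
  + by move=> y; rewrite oppE; exact: EK.
  + by move=> y; rewrite oppE; exact: Kbe.
- exact: (between_propagates_right albe dF Kcl EK Kp Kbe cp).
Qed.

(** If the bound failed at x, F would grow faster than al just to the right of x,
    while its increments are integrals of f, hence at most al times the length. *)
Lemma ae_le_derivative_le F f c d al M :
  (forall x, x \in `]c, d[ -> has_derivative_in setT F x (f x)) ->
  (forall x, x \in `]c, d[ -> `|f x| <= M) ->
  measurable [set x | `]c, d[%classic x /\ al < f x] ->
  mu [set x | `]c, d[%classic x /\ al < f x] = 0%E ->
  forall x, x \in `]c, d[ -> f x <= al.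
Proof.
move=> dF fM; set N := [set x | _] => mN muN x xcd.
move: (xcd); rewrite in_itv/= => /andP[cx xd].
rewrite leNgt; apply/negP => alx.
have [|r r0 Hr] := dF x xcd ((f x - al) / 2); first by rewrite divr_gt0 ?subr_gt0.
pose y := x + Num.min (r / 2) ((d - x) / 2).
have xy : x < y by rewrite ltrDl lt_min !divr_gt0 ?subr_gt0.
have yd : y < d.
  have : Num.min (r / 2) ((d - x) / 2) <= (d - x) / 2 by rewrite ge_min lexx orbT.
  by rewrite /y; lra.
have yr : `|y - x| < r.
  rewrite gtr0_norm ?subr_gt0//.
  have : Num.min (r / 2) ((d - x) / 2) <= r / 2 by rewrite ge_min lexx.
  by rewrite /y; lra.
have sub z : z \in `[x, y] -> z \in `]c, d[.
  by rewrite !in_itv/= => /andP[xz zy]; rewrite (lt_le_trans cx xz) (le_lt_trans zy yd).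
have [||| iF FE] := @bounded_derivative_FTC _ F f x y M xy.
- apply: (has_derivative_within_continuous (d := f)) => z /sub zcd.
  exact/(has_derivative_inS (@subsetT _ _))/dF.
- by move=> z /subset_itv_oo_cc/sub/dF.
- by move=> z /subset_itv_oo_cc/sub/fM.
have : F y - F x <= al * (y - x).
  rewrite -FE /Rintegral (@negligible_integral _ _ _ mu _ _ _ mN _ iF muN)//.
  have mD : measurable (`]x, y[ `\` N) by apply: measurableD.
  have fin : (mu `]x, y[ < +oo)%E by rewrite lebesgue_measure_itv/= lte_fin xy -EFinB ltry.
  have iD : mu.-integrable (`]x, y[ `\` N) (EFin \o f).
    by apply: integrableS iF => // z [].
  have iA : mu.-integrable `]x, y[ (EFin \o cst al).
    apply: measurable_bounded_integrable => //.
    by exists `|al|; split=> [|z My ? _]; rewrite ?num_real//= ltW.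
  have iA' : mu.-integrable (`]x, y[ `\` N) (EFin \o cst al).
    by apply: integrableS iA => // z [].
  have le1 : \int[mu]_(z in `]x, y[ `\` N) f z <= \int[mu]_(z in `]x, y[ `\` N) al.
    apply: le_Rintegral => //.
    move=> z [zxy nN] /=; rewrite leNgt; apply/negP => alz; apply: nN; split=> //.
    exact/sub/subset_itv_oo_cc.
  apply: (le_trans le1).
  rewrite /Rintegral -(@negligible_integral _ _ _ mu _ _ _ mN _ iA muN)//.
  have := @Rintegral_cst _ _ _ mu `]x, y[%classic (measurable_itv _) al.
  rewrite /Rintegral => ->.
  rewrite [X in fine X](_ : _ = (y - x)%:E)//.
  by apply: etrans (lebesgue_measure_itv _) _; rewrite /= lte_fin xy.
have yx0 : 0 < y - x by rewrite subr_gt0.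
have := Hr y I yr; rewrite (gtr0_norm yx0) ler_norml => /andP[+ _].
by nra.
Qed.

(** By between_propagates the points with al < f are exactly those with
    al < f < be, a null set, and ae_le_derivative_le applies. *)
Lemma between_null_empty F f (K : set R) c d al be M p : al < be ->
  (forall x, x \in `]c, d[ -> has_derivative_in setT F x (f x)) ->
  (forall x, x \in `]c, d[ -> `|f x| <= M) ->
  (forall x, (forall r, 0 < r -> exists2 y, K y & `|y - x| < r) -> K x) ->
  (forall x, x \in `]c, d[ -> al < f x < be -> K x) ->
  K p -> (forall x, x \in `]c, d[ -> K x -> f x < be) -> p \in `]c, d[ ->
  measurable [set x | `]c, d[%classic x /\ al < f x < be] ->
  mu [set x | `]c, d[%classic x /\ al < f x < be] = 0%E -> f p <= al.
Proof.
move=> albe dF fM Kcl EK Kp Kbe pcd mE muE.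
have fbe := between_propagates albe dF Kcl EK Kp Kbe pcd.
have EE : [set x | `]c, d[%classic x /\ al < f x] =
    [set x | `]c, d[%classic x /\ al < f x < be].
  by apply/seteqP; split=> x [xcd] => [alx|/andP[]]; split=> //; rewrite alx fbe.
by apply: (ae_le_derivative_le dF fM) => //; rewrite EE.
Qed.

Lemma continuous_clamp F a b : a <= b -> {within `[a, b], continuous F} ->
  continuous (fun x => F (Num.max a (Num.min x b))).
Proof.
move=> ab /within_continuousP cF x; apply/cvgrPdist_lt => e e0.
have [r r0 Hr] := cF _ (clamp_in x ab) e e0.
exists r => //= y; rewrite /ball_/= => xy; rewrite distrC; apply: Hr.
  exact: clamp_in.
by apply: le_lt_trans xy; rewrite distrC; exact: clamp_lipschitz.
Qed.

(** Continuous difference quotients; it makes derivatives, and functions composed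
    with them, measurable. *)
Lemma derivative_limit_continuous F f c d : c < d ->
  (forall x, x \in `]c, d[ -> has_derivative_in setT F x (f x)) ->
  exists q : nat -> R -> R, (forall n, continuous (q n)) /\
    forall x, x \in `]c, d[ -> q n x @[n --> \oo] --> f x.
Proof.
move=> cd dF; have dc0 : 0 < d - c by rewrite subr_gt0.
(* F may have no continuous extension to the endpoints: the n-th quotient uses
   F clamped to a compact subinterval. *)
pose s n : R := (d - c) / 2 * n.+1%:R^-1.
have s0 n : 0 < s n by rewrite !mulr_gt0.
have s1 n : s n <= (d - c) / 2.
  by rewrite ger_pMr ?divr_gt0// invf_le1 ?ltr0n// ler1n.
pose G n x := F (Num.max (c + s n) (Num.min x (d - s n))).
have sle n : c + s n <= d - s n by have := s1 n; lra.
have cG n : continuous (G n).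
  apply: continuous_clamp => //.
  apply: (has_derivative_within_continuous (d := f)) => x; rewrite /= in_itv/= => /andP[cx xd].
  apply: (has_derivative_inS (@subsetT _ _)); apply: dF.
  by rewrite in_itv/=; have := s0 n; move: cx xd; clear; move=> *; apply/andP; split; lra.
exists (fun n x => n.+1%:R * (G n (x + n.+1%:R^-1) - G n x)); split=> [n x|x xcd].
  apply: cvgM; first exact: cvg_cst.
  apply: cvgB; last exact: cG.
  apply: continuous_comp; last exact: cG.
  by apply: cvgD; [exact: cvg_id|exact: cvg_cst].
apply: cvg_trans (has_derivative_in_quotient (dF x xcd)).
apply: near_eq_cvg; move: xcd; rewrite in_itv/= => /andP[cx xd].
pose e := Num.min (x - c) (d - x) / ((d - c) + 2).
have m0 : 0 < Num.min (x - c) (d - x) by rewrite lt_min !subr_gt0 cx.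
have dc2 : 0 < d - c + 2 by rewrite addr_gt0.
have e0 : 0 < e by rewrite divr_gt0.
have /cvgrPdist_lt/(_ _ e0) := @cvg_harmonic R.
apply: filterS => n; rewrite sub0r normrN /= ger0_norm//.
move=> ne; have : n.+1%:R^-1 * (d - c + 2) < Num.min (x - c) (d - x).
  by rewrite -ltr_pdivlMr.
rewrite lt_min => /andP[h1 h2].
have n0 : 0 < n.+1%:R^-1 :> R by rewrite invr_gt0.
have tp : 0 <= n.+1%:R^-1 * (d - c) by rewrite mulr_ge0// ltW.
rewrite /G !clamp_id// in_itv/= /s.
  by move: (n.+1%:R^-1 : R) h1 h2 n0 tp => t; clear -cx xd; move=> *; apply/andP; split; lra.
by move: (n.+1%:R^-1 : R) h1 h2 n0 tp => t; clear -cx xd; move=> *; apply/andP; split; lra.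
Qed.

Lemma derivative_measurable F f c d :
  (forall x, x \in `]c, d[ -> has_derivative_in setT F x (f x)) ->
  measurable_fun `]c, d[ f.
Proof.
move=> dF; have [cd|dc] := ltP c d; last first.
  by rewrite set_itv_ge ?bnd_simp -?leNgt//; exact: measurable_fun_set0.
have [q [cq qf]] := derivative_limit_continuous cd dF.
apply: (measurable_realfun.measurable_fun_cvg (h := q)) => // n.
by apply: measurable_funTS; exact: continuous_measurable_fun.
Qed.

(** Suppose that E, the set where al < f < be, is null, and let K be its closure
    in a compact interval.  At each point of K either all short difference
    quotients of F are at most be', or all are at least al', for fixed
    al < al' < be' < be; the uniform versions of these conditions are closed
    and cover K, so by Baire one of them holds on a whole piece of K near some
    p, and that piece contains a point q of E.  If, say, f < be there on K, then
    between_null_empty gives f q <= al, which contradicts that q lies in E. *)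
Theorem denjoy_clarkson F f a b al be M x0 :
  (forall x, x \in `]a, b[ -> has_derivative_in setT F x (f x)) ->
  (forall x, x \in `]a, b[ -> `|f x| <= M) ->
  x0 \in `]a, b[ -> al < f x0 < be ->
  mu [set x | `]a, b[%classic x /\ al < f x < be] != 0%E.
Proof.
move=> dF fM x0ab x0E; apply/eqP => muE.
have mf : measurable_fun `]a, b[ f by exact: derivative_measurable dF.
have mE c d u v : `]c, d[ `<=` `]a, b[ ->
    measurable [set x | `]c, d[%classic x /\ u < f x < v].
  move=> sub.
  have : measurable (`]c, d[ `&` f @^-1` `]u, v[).
    by apply: (measurable_funS _ sub mf); exact: measurable_itv.
  by congr measurable; apply/seteqP; split=> x /=.
have albe : al < be by case/andP: x0E; exact: lt_trans.
have mu0 c d : `]c, d[ `<=` `]a, b[ ->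
    mu [set x | `]c, d[%classic x /\ al < f x < be] = 0%E.
  move=> sub; apply: (subset_measure0 _ _ _ muE); [exact: mE|exact: mE|].
  by move=> x [xcd xE]; split => //; exact: sub.
move: (x0ab); rewrite in_itv/= => /andP[ax0 x0b].
pose c := (a + x0) / 2; pose d := (x0 + b) / 2.
have ac : a < c by rewrite midf_lt.
have cx0 : c < x0 by rewrite midf_lt.
have x0d : x0 < d by rewrite midf_lt.
have db : d < b by rewrite midf_lt.
have cdab x : x \in `[c, d] -> x \in `]a, b[.
  by rewrite !in_itv/= => /andP[cx xd]; rewrite (lt_le_trans ac cx) (le_lt_trans xd db).
pose E := [set x | (x \in `]c, d[) /\ al < f x < be].
pose K := [set x | forall r, 0 < r -> exists2 y, E y & `|y - x| < r].
have EK x : E x -> K x by move=> Ex r r0; exists x; rewrite ?subrr ?normr0.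
have Kcl x : (forall r, 0 < r -> exists2 y, K y & `|y - x| < r) -> K x.
  move=> H r r0; have [|y Ky yx] := H (r / 2); first by rewrite divr_gt0.
  have [|z Ez zy] := Ky (r / 2); first by rewrite divr_gt0.
  exists z => //; rewrite -(subrKA y) [r]splitr.
  by rewrite (le_lt_trans (ler_normD _ _))// ltrD.
have Kcd x : K x -> x \in `[c, d].
  move=> Kx; rewrite in_itv/=; apply/andP; split; rewrite leNgt; apply/negP => h.
    have [|y [+ _]] := Kx (c - x); first by rewrite subr_gt0.
    by rewrite in_itv/= ltr_norml => /andP[cy _] /andP[_]; lra.
  have [|y [+ _]] := Kx (x - d); first by rewrite subr_gt0.
  by rewrite in_itv/= ltr_norml => /andP[_ yd] /andP[+ _]; lra.
pose al' := al + (be - al) / 3; pose be' := al + (be - al) / 3 * 2.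
have alal' : al < al' by rewrite /al'; lra.
have al'be' : al' < be' by rewrite /al' /be'; lra.
have be'be : be' < be by rewrite /be'; lra.
(* The quotients are multiplied by (y - x)^2, which makes the conditions closed.
   The parity of n chooses between the two families. *)
pose C (s : bool) (n : nat) := [set x | forall y, y \in `[c, d] ->
  `|y - x| < n.+1%:R^-1 ->
  if s then al' * (y - x) ^+ 2 <= (F y - F x) * (y - x)
  else (F y - F x) * (y - x) <= be' * (y - x) ^+ 2].
have cF x : x \in `[c, d] -> forall e, 0 < e -> exists2 r, 0 < r &
    forall y, `|y - x| < r -> `|F y - F x| < e.
  move=> xcd e e0.
  have [r r0 Hr] := has_derivative_in_continuous (dF _ (cdab _ xcd)) e0.
  by exists r => // y; apply: Hr.
have [||||n [p [r [Kp r0 pC]]]] := @baire_closed_subset K (fun n => C (odd n) n).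
- by exists x0; apply: EK; split => //; rewrite in_itv/= cx0.
- exact: Kcl.
- move=> n x Kx; move: (odd n) => s nC.
  have [y [ycd yx yC]] : exists y, [/\ y \in `[c, d], `|y - x| < n.+1%:R^-1 &
      0 < (if s then al' * (y - x) ^+ 2 - (F y - F x) * (y - x)
           else (F y - F x) * (y - x) - be' * (y - x) ^+ 2)].
    apply: contrapT => H; apply: nC => y ycd yx; apply: contrapT => H'.
    apply: H; exists y; split=> //.
    by move/negP: H'; case: s; rewrite -ltNge subr_gt0.
  pose g z := if s then al' * (y - z) ^+ 2 - (F y - F z) * (y - z)
           else (F y - F z) * (y - z) - be' * (y - z) ^+ 2.
  have cFx : F z @[z --> x] --> F x.
    apply/cvgrPdist_lt => e e0; have [q q0 Hq] := cF x (Kcd x Kx) e e0.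
    by exists q => //= z; rewrite /ball_/= distrC => /Hq; rewrite distrC.
  have cy : y - z @[z --> x] --> y - x by apply: cvgB; [exact: cvg_cst|exact: cvg_id].
  have cg : g z @[z --> x] --> g x.
    rewrite /g; case: (s); apply: cvgB.
    + by apply: cvgM; [exact: cvg_cst|exact: cvgM].
    + by apply: cvgM => //; apply: cvgB => //; exact: cvg_cst.
    + by apply: cvgM => //; apply: cvgB => //; exact: cvg_cst.
    + by apply: cvgM; [exact: cvg_cst|exact: cvgM].
  have /cvgrPdist_lt/(_ _ yC)[q /= q0 Hq] := cg.
  exists (Num.min q (n.+1%:R^-1 - `|y - x|)); first by rewrite lt_min q0 subr_gt0.
  move=> z Kz; rewrite lt_min => /andP[zq zy] /(_ y ycd _)/wrap[].
    have -> : y - z = (y - x) + (x - z) by rewrite addrA subrK.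
    by rewrite (le_lt_trans (ler_normD _ _))// (distrC x z) addrC -ltrBrDr.
  have := Hq z; rewrite /ball_/= distrC => /(_ zq).
  rewrite ltr_norml => /andP[_]; rewrite /g; case: (s) => /=; lra.
- move=> x Kx; have xcd := Kcd _ Kx.
  have [lo|hi] := ltP (f x) be'.
    have [|r r0 Hr] := dF x (cdab _ xcd) (be' - f x); first by rewrite subr_gt0.
    have /cvgrPdist_lt/(_ _ r0)[N _ HN] := @cvg_harmonic R.
    exists N.*2; rewrite odd_double => y ycd yN.
    have N2 : (N <= N.*2)%N by rewrite -addnn leq_addl.
    have := HN _ N2; rewrite /= sub0r normrN ger0_norm// => /(lt_trans yN) yr.
    have := Hr y I yr; have [xy|yx] := leP x y.
      by rewrite (ger0_norm (_ : 0 <= y - x)) ?subr_ge0// ler_norml => /andP[_]; nra.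
    by rewrite (ltr0_norm (_ : y - x < 0)) ?subr_lt0// ler_norml => /andP[+ _]; nra.
  have {}hi : al' < f x by exact: lt_le_trans hi.
  have [|r r0 Hr] := dF x (cdab _ xcd) (f x - al'); first by rewrite subr_gt0.
  have /cvgrPdist_lt/(_ _ r0)[N _ HN] := @cvg_harmonic R.
  exists N.*2.+1; rewrite /= odd_double /= => y ycd yN.
  have N2 : (N <= N.*2.+1)%N by rewrite -addnn leqW// leq_addl.
  have := HN _ N2; rewrite /= sub0r normrN ger0_norm// => /(lt_trans yN) yr.
  have := Hr y I yr; have [xy|yx] := leP x y.
    by rewrite (ger0_norm (_ : 0 <= y - x)) ?subr_ge0// ler_norml => /andP[+ _]; nra.
  by rewrite (ltr0_norm (_ : y - x < 0)) ?subr_lt0// ler_norml => /andP[_]; nra.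
have [q [qcd qE] qp] := Kp r r0.
pose c1 := Num.max c (p - r); pose d1 := Num.min d (p + r).
have J1 x : x \in `]c1, d1[ -> (x \in `]c, d[) /\ `|x - p| < r.
  rewrite !in_itv/= gt_max lt_min => /andP[/andP[-> px] /andP[-> xp]]; split=> //.
  by rewrite ltr_norml; apply/andP; split; lra.
have J2 : `]c1, d1[ `<=` `]a, b[.
  by move=> x /= /J1[/subset_itv_oo_cc/cdab].
have dF1 x : x \in `]c1, d1[ -> has_derivative_in setT F x (f x) by move=> /J2; exact: dF.
have fM1 x : x \in `]c1, d1[ -> `|f x| <= M by move=> /J2; exact: fM.
have qJ : q \in `]c1, d1[.
  move: qcd qp; rewrite !in_itv/= gt_max lt_min ltr_norml => /andP[-> ->] /andP[? ?].
  by apply/andP; split; lra.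
have EK1 x : x \in `]c1, d1[ -> al < f x < be -> K x.
  by move=> /J1[xcd _] xE; apply: EK.
have Kq : K q by apply: EK.
(* The first case is the second one for - F. *)
case/boolP: (odd n) pC => odn pC.
- have fK x : x \in `]c1, d1[ -> K x -> al < f x.
    move=> /J1[xcd xp] Kx; rewrite (lt_le_trans alal')// leNgt; apply/negP => fx.
    have Cx := pC x Kx xp.
    have [|s s0 Hs] := dF x (cdab _ (subset_itv_oo_cc xcd)) ((al' - f x) / 2).
      by rewrite divr_gt0 ?subr_gt0.
    move: (xcd); rewrite in_itv/= => /andP[cx xd].
    pose t := Num.min (s / 2) (Num.min (d - x) (n.+1%:R^-1 / 2)).
    have n0 : 0 < n.+1%:R^-1 :> R by rewrite invr_gt0.
    have t0 : 0 < t by rewrite !lt_min subr_gt0 xd !divr_gt0.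
    have ts : t <= s / 2 by rewrite ge_min lexx.
    have td : t <= d - x by rewrite !ge_min lexx !orbT.
    have tn : t <= n.+1%:R^-1 / 2 by rewrite !ge_min lexx !orbT.
    have xt : x + t \in `[c, d].
      by rewrite in_itv/= (le_trans (ltW cx)) ?lerDl ?(ltW t0)// addrC -lerBrDr.
    have t_s : t < s by rewrite (le_lt_trans ts)// ltr_pdivrMr// ltr_pMr// ltr1n.
    have t_n : t < n.+1%:R^-1 by rewrite (le_lt_trans tn)// ltr_pdivrMr// ltr_pMr// ltr1n.
    have := Cx (x + t) xt; have := Hs (x + t) I.
    rewrite [x + t]addrC addrK (gtr0_norm t0) ler_norml => /(_ t_s)/andP[_ h1].
    move=> /(_ t_n) /= h2.
    have h3 := ler_wpM2r (ltW t0) h1.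
    have : 0 < (al' - f x) / 2 * t * t by rewrite !mulr_gt0 ?invr_gt0 ?subr_gt0.
    by move: h2 h3; clear; lra.
  have : - f q <= - be.
    have oppE : [set x | `]c1, d1[%classic x /\ - be < - f x < - al] =
        [set x | `]c1, d1[%classic x /\ al < f x < be].
      by apply/seteqP; split=> x [xJ xE]; split=> //; move: xE; rewrite !ltrN2 andbC.
    apply: (@between_null_empty (fun x => -1 * F x) (fun x => - f x) K c1 d1 (- be) (- al) M q).
    + by rewrite ltrN2.
    + by move=> x /dF1 /(has_derivative_inZ (-1)); rewrite mulN1r.
    + by move=> x; rewrite normrN; exact: fM1.
    + exact: Kcl.
    + by move=> x xJ; rewrite !ltrN2 andbC; exact: EK1.
    + exact: Kq.
    + by move=> x xJ Kx; rewrite ltrN2; exact: fK.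
    + exact: qJ.
    + by rewrite oppE; exact: mE.
    + by rewrite oppE; exact: mu0.
  by move: qE => /andP[_ qbe]; rewrite lerN2 leNgt qbe.
- have fK x : x \in `]c1, d1[ -> K x -> f x < be.
    move=> /J1[xcd xp] Kx; rewrite (le_lt_trans _ be'be)// leNgt; apply/negP => fx.
    have Cx := pC x Kx xp.
    have [|s s0 Hs] := dF x (cdab _ (subset_itv_oo_cc xcd)) ((f x - be') / 2).
      by rewrite divr_gt0 ?subr_gt0.
    move: (xcd); rewrite in_itv/= => /andP[cx xd].
    pose t := Num.min (s / 2) (Num.min (d - x) (n.+1%:R^-1 / 2)).
    have n0 : 0 < n.+1%:R^-1 :> R by rewrite invr_gt0.
    have t0 : 0 < t by rewrite !lt_min subr_gt0 xd !divr_gt0.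
    have ts : t <= s / 2 by rewrite ge_min lexx.
    have td : t <= d - x by rewrite !ge_min lexx !orbT.
    have tn : t <= n.+1%:R^-1 / 2 by rewrite !ge_min lexx !orbT.
    have xt : x + t \in `[c, d].
      by rewrite in_itv/= (le_trans (ltW cx)) ?lerDl ?(ltW t0)// addrC -lerBrDr.
    have t_s : t < s by rewrite (le_lt_trans ts)// ltr_pdivrMr// ltr_pMr// ltr1n.
    have t_n : t < n.+1%:R^-1 by rewrite (le_lt_trans tn)// ltr_pdivrMr// ltr_pMr// ltr1n.
    have := Cx (x + t) xt; have := Hs (x + t) I.
    rewrite [x + t]addrC addrK (gtr0_norm t0) ler_norml => /(_ t_s)/andP[h1 _].
    move=> /(_ t_n) /= h2.
    have h3 := ler_wpM2r (ltW t0) h1.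
    have : 0 < (f x - be') / 2 * t * t by rewrite !mulr_gt0 ?invr_gt0 ?subr_gt0.
    by move: h2 h3; clear; lra.
  have : f q <= al.
    by apply: (@between_null_empty F f K c1 d1 al be M q) => //; [exact: mE|exact: mu0].
  by move: qE => /andP[alq _]; rewrite leNgt alq.
Qed.

End denjoy_clarkson.

(** * Power kernels and the Gamma integral *)

Section power_kernel.
Context {R : realType}.
Notation mu := (@lebesgue_measure R).
Implicit Types (F G f : R -> R) (a b x d e c M p s alpha : R).

Lemma has_derivative_powR p x : 0 < x ->
  has_derivative_in setT (fun y => y `^ p) x (p * x `^ (p - 1)).
Proof.
move=> x0; apply/is_derive_has_derivative.
have xE : x \in `]0, +oo[ by rewrite in_itv/= x0.
have dP := @derivable_powR R 1 p x xE.
by apply: (DeriveDef dP); rewrite -derive1E powR_derive1.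
Qed.

(** Integrability of a nonnegative function with a bounded primitive, through an
    exhaustion by compact subintervals and monotone convergence; it gives the
    integrability of singular kernels. *)
Lemma bounded_primitive_integrable F f a b B : a < b ->
  (forall x, x \in `]a, b[ -> has_derivative_in setT F x (f x)) ->
  (forall x, x \in `]a, b[ -> 0 <= f x) ->
  (forall c d, a < c -> d < b -> exists M, forall x, x \in `]c, d[ -> `|f x| <= M) ->
  (forall x, x \in `]a, b[ -> `|F x| <= B) ->
  measurable_fun `]a, b[ f ->
  mu.-integrable `]a, b[ (EFin \o f).
Proof.
move=> ab dF f0 fb FB mf; have ba0 : 0 < b - a by rewrite subr_gt0.
pose s n : R := (b - a) / 2 * n.+2%:R^-1.
have s0 n : 0 < s n by rewrite !mulr_gt0.
have s1 n : s n < (b - a) / 2.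
  by rewrite gtr_pMr ?divr_gt0// invf_lt1 ?ltr0n// ltr1n.
have sS n m : (n <= m)%N -> s m <= s n.
  by move=> nm; rewrite /s ler_pM2l ?divr_gt0// lef_pV2 ?posrE// ler_nat.
pose I n : set R := `]a + s n, b - s n[%classic.
have Isub n : I n `<=` `]a, b[.
  move=> x; rewrite /I /= !in_itv/= => /andP[h1 h2]; have := s0 n.
  by move: h1 h2; clear; move=> *; apply/andP; split; lra.
have InE n x : I n x = (a + s n < x < b - s n) by rewrite /I /= in_itv.
pose g n := EFin \o (f \_ (I n)).
have mg n : measurable_fun `]a, b[ (g n).
  apply/measurable_EFinP; apply: measurable_funTS.
  apply/measurable_restrict => //; first exact: measurable_itv.
  by rewrite setTI; apply: measurable_funS mf => //; exact: Isub.
have g0 n x : `]a, b[%classic x -> (0 <= g n x)%E.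
  by move=> xab; rewrite lee_fin patchE; case: ifP => // _; exact: f0.
have gnd x : `]a, b[%classic x -> {homo g ^~ x : n m / (n <= m)%N >-> (n <= m)%E}.
  move=> xab n m nm; rewrite lee_fin /= !patchE.
  case: ifPn => [|_]; last by case: ifP => // _; exact: f0.
  rewrite inE InE => /andP[h1 h2]; rewrite mem_set// InE.
  by have := sS _ _ nm; move: h1 h2; clear; move=> *; apply/andP; split; lra.
have gf x : `]a, b[%classic x -> limn (g ^~ x) = (f x)%:E.
  move=> xab; apply/cvg_lim => //; apply: cvg_EFin; first exact: nearW.
  apply/cvgrPdist_lt => e e0.
  move: (xab); rewrite /= in_itv/= => /andP[ax xb].
  have m0 : 0 < Num.min (x - a) (b - x) / (b - a) by rewrite divr_gt0// lt_min !subr_gt0 ax.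
  have /cvgrPdist_lt/(_ _ m0) := @cvg_harmonic R.
  apply: filterS => n; rewrite sub0r normrN /= ger0_norm// ltr_pdivlMr// lt_min => /andP[h1 h2].
  rewrite patchE mem_set ?subrr ?normr0// InE.
  have h3 : s n <= n.+1%:R^-1 * (b - a).
    rewrite /s mulrC; apply: ler_pM; rewrite ?invr_ge0 ?divr_ge0 ?(ltW ba0)//.
      by rewrite lef_pV2 ?posrE// ler_nat.
    by rewrite ler_pdivrMr// ler_pMr// ler1n.
  by move: h1 h2 h3; move: (n.+1%:R^-1 * (b - a)) (s n); clear => *; apply/andP; split; lra.
apply/integrableP; split; first exact/measurable_EFinP.
have -> : (\int[mu]_(x in `]a, b[) `|(EFin \o f) x| = \int[mu]_(x in `]a, b[) limn (g ^~ x))%E.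
  apply: eq_integral => x; rewrite inE => xab; rewrite gf//=.
  by rewrite ger0_norm// f0.
rewrite (@monotone_convergence _ _ _ mu _ (measurable_itv `]a, b[) g mg g0 gnd)//.
have le n : (\int[mu]_(x in `]a, b[) g n x <= (B + B)%:E)%E.
  have absn : a + s n < b - s n by have := s1 n; lra.
  have [||M fM] := fb (a + s n) (b - s n); [by rewrite ltrDl|by rewrite gtrBl|].
  have subc x : x \in `[a + s n, b - s n] -> x \in `]a, b[.
    rewrite !in_itv/= => /andP[h1 h2]; have := s0 n.
    by move: h1 h2; clear; move=> *; apply/andP; split; lra.
  have [|||iF FE] := @bounded_derivative_FTC _ F f _ _ M absn.
  - apply: (has_derivative_within_continuous (d := f)) => x /subc xab.
    exact/(has_derivative_inS (@subsetT _ _))/dF.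
  - by move=> x /subset_itv_oo_cc/subc; exact: dF.
  - by move=> x /fM.
  have -> : (\int[mu]_(x in `]a, b[) g n x = \int[mu]_(x in I n) (f x)%:E)%E.
    have -> : g n = (EFin \o f) \_ (I n).
      by apply/funext => x; rewrite /g /= !patchE; case: ifP.
    by rewrite -integral_mkcondr (setIidr (@Isub n)).
  rewrite -[leLHS]fineK; last exact: (integrable_fin_num _ iF).
  rewrite lee_fin; have := FE; rewrite /Rintegral => ->.
  have := FB (b - s n) (subc _ _); have := FB (a + s n) (subc _ _).
  rewrite !in_itv/= !lexx/= !(ltW absn) => /(_ isT) + /(_ isT).
  by rewrite !ler_norml => /andP[? ?] /andP[? ?]; lra.
apply: (@le_lt_trans _ _ (B + B)%:E); last exact: ltry.
apply: lime_le; last exact: nearW.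
apply: ereal_nondecreasing_is_cvgn => n m nm; apply: ge0_le_integral => //.
- by move=> x; exact: g0.
- exact: mg.
- exact: mg.
- by move=> x xab; exact: gnd.
Qed.

Lemma integrable_powRN alpha : 0 < alpha < 1 ->
  mu.-integrable `]0, 1[ (EFin \o (fun t : R => (t `^ alpha)^-1)).
Proof.
move=> /andP[a0 a1]; have a1' : 0 < 1 - alpha by rewrite subr_gt0.
apply: (@bounded_primitive_integrable (fun t => (1 - alpha)^-1 * t `^ (1 - alpha)) _ _ _ (1 - alpha)^-1) => //.
- move=> x; rewrite in_itv/= => /andP[x0 x1].
  have -> : (x `^ alpha)^-1 = (1 - alpha)^-1 * ((1 - alpha) * x `^ (1 - alpha - 1)).
    by rewrite mulKf ?gt_eqF// -powRN; congr (_ `^ _); ring.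
  exact/has_derivative_inZ/has_derivative_powR.
- by move=> x _; rewrite invr_ge0 powR_ge0.
- move=> c d c0 d1; exists (c `^ alpha)^-1 => x; rewrite in_itv/= => /andP[cx xd].
  have x0 := lt_trans c0 cx.
  rewrite ger0_norm ?invr_ge0 ?powR_ge0// lef_pV2 ?posrE ?powR_gt0//.
  by rewrite ge0_ler_powR ?nnegrE ?ltW.
- move=> x; rewrite in_itv/= => /andP[x0 x1].
  rewrite normrM !ger0_norm ?invr_ge0 ?powR_ge0 ?(ltW a1')// ger_pMr ?invr_gt0//.
  have : x `^ (1 - alpha) <= 1 `^ (1 - alpha) by rewrite ge0_ler_powR ?nnegrE ?ltW.
  by rewrite powR1.
- apply: measurable_funTS; apply: (@eq_measurable_fun _ _ _ _ _ (fun t => t `^ (- alpha))).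
    by move=> x _; rewrite powRN.
  exact: measurable_powR.
Qed.

Lemma has_derivative_onem F x d : has_derivative_in setT F (1 - x) d ->
  has_derivative_in setT (fun y => F (1 - y)) x (- d).
Proof.
move=> dF e e0; have [r r0 Hr] := dF e e0; exists r => // y _ yx.
have yx' : 1 - y - (1 - x) = - (y - x) by ring.
have := Hr (1 - y) I; rewrite yx' normrN => /(_ yx).
by rewrite mulrN mulNr.
Qed.

Lemma integrable_onem_powRN alpha : 0 < alpha < 1 ->
  mu.-integrable `]0, 1[ (EFin \o (fun t : R => ((1 - t) `^ alpha)^-1)).
Proof.
move=> /andP[a0 a1]; have a1' : 0 < 1 - alpha by rewrite subr_gt0.
apply: (@bounded_primitive_integrable (fun t => - (1 - alpha)^-1 * (1 - t) `^ (1 - alpha)) _ _ _ (1 - alpha)^-1) => //.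
- move=> x; rewrite in_itv/= => /andP[x0 x1].
  have -> : ((1 - x) `^ alpha)^-1 = - (1 - alpha)^-1 * - ((1 - alpha) * (1 - x) `^ (1 - alpha - 1)).
    by rewrite mulrNN mulKf ?gt_eqF// -powRN; congr (_ `^ _); ring.
  apply: has_derivative_inZ.
  apply: (@has_derivative_onem (fun z => z `^ (1 - alpha))); apply: has_derivative_powR.
  by rewrite subr_gt0.
- by move=> x _; rewrite invr_ge0 powR_ge0.
- move=> c d c0 d1; exists ((1 - d) `^ alpha)^-1 => x; rewrite in_itv/= => /andP[cx xd].
  have d1' : 0 < 1 - d by rewrite subr_gt0.
  have dx : 1 - d <= 1 - x by rewrite lerD2l lerN2 ltW.
  have x1' := lt_le_trans d1' dx.
  rewrite ger0_norm ?invr_ge0 ?powR_ge0// lef_pV2 ?posrE ?powR_gt0//.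
  by rewrite ge0_ler_powR ?nnegrE// ltW.
- move=> x; rewrite in_itv/= => /andP[x0 x1].
  have x1' : 0 < 1 - x by rewrite subr_gt0.
  rewrite normrM normrN !ger0_norm ?invr_ge0 ?powR_ge0 ?(ltW a1')// ger_pMr ?invr_gt0//.
  have : (1 - x) `^ (1 - alpha) <= 1 `^ (1 - alpha).
    by rewrite ge0_ler_powR ?nnegrE ?ltW// gtrBl.
  by rewrite powR1.
- apply: measurable_funTS; apply: (@eq_measurable_fun _ _ _ _ _ ((fun t => t `^ (- alpha)) \o (fun t => 1 - t))).
    by move=> x _; rewrite /= powRN.
  apply: measurableT_comp; first exact: measurable_powR.
  exact: measurable_funB.
Qed.

(** Change of variables for a measurable function: the Lebesgue measure is k times
    its image under t |-> k t + s, by uniqueness. *)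
Lemma ge0_integral_affine (k s : R) (D : set R) (f : R -> \bar R) : 0 < k ->
  measurable D -> measurable_fun D f -> (forall x, D x -> (0 <= f x)%E) ->
  (\int[mu]_(x in D) f x =
   k%:E * \int[mu]_(t in [set t | D (k * t + s)%R]) f (k * t + s)%R)%E.
Proof.
move=> k0 mD mf f0.
pose phi : measurableTypeR R -> measurableTypeR R := fun t => k * t + s.
have mphi : measurable_fun setT phi.
  by apply: measurable_funD => //; exact: measurable_funM.
pose kk : {nonneg R} := NngNum (ltW k0).
pose nu : {measure set (measurableTypeR R) -> \bar R} :=
  measure_function_pushforward__canonical__measure_function_Measure mu mphi.
have muE (A : set R) : measurable A -> mu A = mscale kk nu A.
  move=> mA; apply: lebesgue_measure_unique => //= _ [[a b]] _ <-.
  rewrite /mscale /pushforward /=.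
  have -> : pushforward mu phi `]a, b]%classic = mu `](a - s) / k, (b - s) / k]%classic.
    congr (mu _); apply/seteqP; split=> t /=; rewrite !in_itv/= /phi => /andP[h1 h2].
      by rewrite ltr_pdivrMr// ler_pdivlMr// ltrBlDr lerBrDr (mulrC t) h1 h2.
    by move: h1 h2; rewrite ltr_pdivrMr// ler_pdivlMr// ltrBlDr lerBrDr (mulrC t) => -> ->.
  rewrite !lebesgue_measure_itv/= !lte_fin ltr_pM2r ?invr_gt0// ltrD2r.
  case: ifPn => _; last by rewrite mule0.
  by rewrite -!EFinB -EFinM; congr EFin; field; rewrite gt_eqF.
transitivity (\int[mscale kk nu]_(x in D) f x)%E.
  by apply: eq_measure_integral => A mA _; exact: muE.
rewrite ge0_integral_mscale// (ge0_integral_pushforward mphi)//.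
by move=> x; rewrite inE; exact: f0.
Qed.

Lemma integral_itv_ccoo (f : R -> \bar R) a b : measurable_fun `]a, b[ f ->
  (\int[mu]_(x in `[a, b]) f x = \int[mu]_(x in `]a, b[) f x)%E.
Proof. by move=> mf; rewrite (@integral_itv_bndoo _ _ _ _ true false). Qed.

Lemma integrable_itv_ccoo (f : R -> \bar R) a b :
  mu.-integrable `]a, b[ f <-> mu.-integrable `[a, b] f.
Proof.
split=> [/integrableP[mf intf]|intf]; last first.
  by apply: integrableS intf => //; exact: subset_itv_oo_cc.
have mfc : measurable_fun `[a, b] f by exact: emeasurable_fun_itv_cc mf.
apply/integrableP; split=> //.
rewrite integral_itv_ccoo//; apply: measurableT_comp => //.
Qed.

(** The Beta integral B(p + 1, 1 - alpha). *)
Definition abel_const p alpha : R :=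
  \int[mu]_(t in `]0, 1[) (t `^ p / (1 - t) `^ alpha).

Lemma measurable_powR_affine (D : set R) p k s :
  measurable_fun D (fun t : R => (k * t + s) `^ p).
Proof.
apply: measurable_funTS.
apply: (@measurableT_comp _ _ _ _ _ _ (fun t => t `^ p)).
  exact: measurable_powR.
by apply: measurable_funD => //; exact: measurable_funM.
Qed.

Lemma measurable_kernel (D : set R) p x : measurable_fun D (fun u : R => ((x - u) `^ p)^-1).
Proof.
apply: (@eq_measurable_fun _ _ _ _ _ (fun u : R => (-1 * u + x) `^ (- p))).
  by move=> u _; rewrite powRN mulN1r addrC.
exact: measurable_powR_affine.
Qed.

Lemma integrable_kernel alpha s x : 0 < alpha < 1 ->
  mu.-integrable `[s, x] (fun u : R => (((x - u) `^ alpha)^-1)%:E).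
Proof.
move=> alpha01; apply/integrable_itv_ccoo.
have [sx|xs] := ltP s x; last first.
  by rewrite set_itv_ge ?bnd_simp -?leNgt//; exact: integrable_set0.
have k0 : 0 < x - s by rewrite subr_gt0.
apply/integrableP; split; first by apply/measurable_EFinP; exact: measurable_kernel.
have -> : (\int[mu]_(u in `]s, x[) `|(((x - u) `^ alpha)^-1)%:E| =
    \int[mu]_(u in `]s, x[) (((x - u) `^ alpha)^-1)%:E)%E.
  by apply: eq_integral => u _; rewrite /= ger0_norm// invr_ge0 powR_ge0.
rewrite (@ge0_integral_affine (x - s) s)//; first last.
- by move=> u _; rewrite lee_fin invr_ge0 powR_ge0.
- by apply/measurable_EFinP; exact: measurable_kernel.
have -> : [set t | `]s, x[%classic ((x - s) * t + s)] = `]0, 1[%classic.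
  by apply/seteqP; split=> t /=; rewrite !in_itv/= ltrDr pmulr_rgt0// -ltrBrDr gtr_pMr.
apply: lte_mul_pinfty => //; first by rewrite lee_fin ltW.
have /integrableP[_] := @integrableZl _ _ _ mu _ (measurable_itv _) ((x - s) `^ alpha)^-1 _
  (integrable_onem_powRN alpha01).
congr (_ < _)%E; apply: eq_integral => t.
rewrite inE/= in_itv/= => /andP[t0 t1].
rewrite /= -invfM -powRM ?subr_ge0 ?ltW//.
have -> : x - ((x - s) * t + s) = (x - s) * (1 - t) by ring.
by rewrite ger0_norm// invr_ge0 powR_ge0.
Qed.

Lemma abel_integrable alpha s x f M : 0 < alpha < 1 ->
  measurable_fun `[s, x] f -> (forall u, u \in `[s, x] -> `|f u| <= M) ->
  mu.-integrable `[s, x] (fun u : R => (f u / (x - u) `^ alpha)%:E).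
Proof.
move=> alpha01 mf fM.
have := @integrableZl _ _ _ mu _ (measurable_itv _) M _ (integrable_kernel s x alpha01).
apply: le_integrable => //.
  apply/measurable_EFinP; apply: measurable_funM => //; exact: measurable_kernel.
move=> u usx.
have kk0 : 0 <= ((x - u) `^ alpha)^-1 by rewrite invr_ge0 powR_ge0.
have M0 : 0 <= M := le_trans (normr_ge0 _) (fM u usx).
rewrite -EFinM /= lee_fin normrM (ger0_norm kk0) (ger0_norm (mulr_ge0 M0 kk0)).
by rewrite ler_wpM2r// fM.
Qed.

Lemma abel_const_integrable p alpha : 0 <= p -> 0 < alpha < 1 ->
  mu.-integrable `]0, 1[ (fun t : R => (t `^ p / (1 - t) `^ alpha)%:E).
Proof.
move=> p0 alpha01.
apply/integrable_itv_ccoo; apply: (@abel_integrable _ _ _ _ 1 alpha01).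
  by apply: measurable_funTS; exact: measurable_powR.
move=> t; rewrite in_itv/= => /andP[t0 t1]; rewrite ger0_norm ?powR_ge0; last by [].
have : t `^ p <= 1 `^ p by rewrite ge0_ler_powR ?nnegrE.
by rewrite powR1.
Qed.

Lemma measurable_abel_kernel (D : set R) p q y z :
  measurable_fun D (fun u : R => (u - y) `^ p / (z - u) `^ q).
Proof.
apply: measurable_funM; last exact: measurable_kernel.
apply: (@eq_measurable_fun _ _ _ _ _ (fun u : R => (1 * u + - y) `^ p)).
  by move=> u _; rewrite mul1r.
exact: measurable_powR_affine.
Qed.

(** The substitution u = s + (x - s) t, which maps [0, 1] onto [s, x]. *)
Lemma abel_kernel p alpha s x : 0 <= p -> 0 < alpha < 1 -> s < x ->
  (\int[mu]_(u in `[s, x]) ((u - s) `^ p / (x - u) `^ alpha)%:E =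
    (abel_const p alpha * (x - s) `^ (p + 1 - alpha))%:E)%E.
Proof.
move=> p0 alpha01 sx.
have k0 : 0 < x - s by rewrite subr_gt0.
rewrite integral_itv_ccoo; last by apply/measurable_EFinP; exact: measurable_abel_kernel.
rewrite (@ge0_integral_affine (x - s) s)//; first last.
- by move=> u _; rewrite lee_fin divr_ge0 ?powR_ge0.
- by apply/measurable_EFinP; exact: measurable_abel_kernel.
have -> : [set t | `]s, x[%classic ((x - s) * t + s)] = `]0, 1[%classic.
  by apply/seteqP; split=> t /=; rewrite !in_itv/= ltrDr pmulr_rgt0// -ltrBrDr gtr_pMr.
have i01 := abel_const_integrable p0 alpha01.
have E : (\int[mu]_(t in `]0%R, 1%R[) (((x - s) * t + s - s) `^ p / (x - ((x - s) * t + s)) `^ alpha)%:E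
   = ((x - s) `^ (p - alpha))%:E * \int[mu]_(t in `]0%R, 1%R[) (t `^ p / (1 - t) `^ alpha)%:E)%E.
  rewrite -(@integralZl _ _ _ mu _ (measurable_itv _) _ i01).
  apply: eq_integral => t; rewrite inE/= in_itv/= => /andP[t0 t1].
  have -> : x - ((x - s) * t + s) = (x - s) * (1 - t) by ring.
  rewrite addrK !powRM ?subr_ge0 ?ltW// powRB ?(gt_eqF k0) ?implybT//=.
  congr EFin; field.
  by rewrite !gt_eqF ?powR_gt0 ?subr_gt0.
have FE : (\int[mu]_(t in `]0%R, 1%R[) (t `^ p / (1 - t) `^ alpha)%:E = (abel_const p alpha)%:E)%E.
  by rewrite /abel_const /Rintegral; symmetry; apply: fineK; exact: (integrable_fin_num _ i01).
apply: (etrans (congr1 (fun z => (x - s)%:E * z)%E E)).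
apply: (etrans (congr1 (fun z => (x - s)%:E * (((x - s) `^ (p - alpha))%:E * z))%E FE)).
rewrite -!EFinM; congr EFin.
rewrite mulrA mulrC; congr (_ * _).
rewrite -{1}[x - s]powRr1 ?ltW// -powRD ?(gt_eqF k0) ?implybT//.
by congr (_ `^ _); ring.
Qed.

Lemma Rintegral_gt0 (D : set R) f : measurable D -> mu.-integrable D (EFin \o f) ->
  (forall x, D x -> 0 < f x) -> mu D != 0%E -> 0 < \int[mu]_(x in D) f x.
Proof.
move=> mD intf f0 D0; rewrite lt_neqAle Rintegral_ge0 ?andbT; last by move=> x /f0/ltW.
apply/negP => /eqP I0; move/eqP: D0; apply.
have I0' : (\int[mu]_(x in D) `|(EFin \o f) x| = 0)%E.
  have -> : (\int[mu]_(x in D) `|(EFin \o f) x| = \int[mu]_(x in D) (EFin \o f) x)%E.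
    by apply: eq_integral => x; rewrite inE => Dx; rewrite /= gtr0_norm// f0.
  rewrite -[LHS]fineK; last exact: integrable_fin_num.
  by move: I0; rewrite /Rintegral => <-.
have mf : measurable_fun D (EFin \o f) by case/integrableP: intf.
have [N [mN N0 DN]] := (ae_eq_integral_abs mu mD mf).1 I0'.
have DN' : D `<=` N.
  by move=> x Dx; apply: DN => /= /(_ Dx) [fx0]; have := f0 x Dx; rewrite fx0 ltxx.
by apply/eqP; rewrite eq_le measure_ge0 andbT -N0 le_measure ?inE.
Qed.

Lemma abel_const_gt0 p alpha : 0 <= p -> 0 < alpha < 1 -> 0 < abel_const p alpha.
Proof.
move=> p0 alpha01; apply: Rintegral_gt0.
- exact: measurable_itv.
- exact: abel_const_integrable.
- move=> t; rewrite /= in_itv/= => /andP[t0 t1].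
  by rewrite divr_gt0 ?powR_gt0 ?subr_gt0.
- by rewrite lebesgue_measure_itv/= lte_fin ltr01 oppr0 addr0.
Qed.

(** Near 0 the integrand is dominated by t^(-alpha), and beyond 1 by the
    exponential density. *)
Lemma gamma_integrable alpha : 0 < alpha < 1 ->
  mu.-integrable `]0, +oo[ (EFin \o (fun t : R => t `^ (1 - alpha - 1) * expR (- t))).
Proof.
move=> alpha01; have /andP[a0 a1] := alpha01.
have i1 : mu.-integrable `]0, +oo[ (EFin \o ((fun t : R => (t `^ alpha)^-1) \_ `]0, 1[)).
  have := integrable_powRN alpha01.
  rewrite integrable_mkcond//= restrict_EFin => iT.
  exact: (@integrableS _ _ _ mu setT).
have i2 : mu.-integrable `]0, +oo[ (EFin \o exponential_pdf (1 : R)).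
  apply: (@integrableS _ _ _ mu setT) => //.
  exact: integrable_exponential_pdf.
have i3 := @integrableD _ _ _ mu _ (measurable_itv _) _ _ i1 i2.
apply: (le_integrable _ _ _ i3) => //.
  apply/measurable_EFinP; apply: measurable_funTS; apply: measurable_funM.
    exact: measurable_powR.
  apply: continuous_measurable_fun => x.
  by apply: continuous_comp; [exact: continuousN|exact: continuous_expR].
move=> t; rewrite /= in_itv/= andbT => t0.
have e1 : expR (- t) <= 1 by rewrite -[leRHS]expR0 ler_expR oppr_le0 ltW.
have pe : exponential_pdf 1 t = expR (- t).
  by rewrite exponential_pdfE ?ltW//= mul1r mulN1r.
have p0 : 0 <= (t `^ alpha)^-1 by rewrite invr_ge0 powR_ge0.
have -> : t `^ (1 - alpha - 1) = (t `^ alpha)^-1.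
  by rewrite -powRN; congr (_ `^ _); ring.
rewrite lee_fin pe ger0_norm ?mulr_ge0 ?expR_ge0// ger0_norm; last first.
  by rewrite addr_ge0 ?expR_ge0// patchE; case: ifP.
have e0 := expR_ge0 (- t); have [t1|t1] := ltP t 1.
  rewrite patchE mem_set; last by rewrite /= in_itv/= t0.
  by apply: ler_wpDr => //; rewrite ler_piMr.
have p1 : (t `^ alpha)^-1 <= 1.
  rewrite invf_le1 ?powR_gt0//.
  have : 1 `^ alpha <= t `^ alpha by rewrite ge0_ler_powR ?nnegrE ?(ltW a0) ?(ltW t0).
  by rewrite powR1.
by apply: ler_wpDl; [rewrite patchE; case: ifP|rewrite ler_piMl].
Qed.

(** Gamma_fun is a real-valued integral, which would be 0 if the integrand were not
    integrable; both constants that the fractional derivative involves have to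
    be positive for the test functions below. *)
Lemma gamma_gt0 alpha : 0 < alpha < 1 -> 0 < Gamma_fun (1 - alpha).
Proof.
move=> alpha01; apply: Rintegral_gt0.
- exact: measurable_itv.
- exact: gamma_integrable.
- by move=> t; rewrite /= in_itv/= andbT => t0; rewrite mulr_gt0 ?powR_gt0 ?expR_gt0.
- by rewrite lebesgue_measure_itv/= ltry.
Qed.

End power_kernel.

(** * Fractional integrals of truncated powers *)

Section truncated_power.
Context {R : realType}.
Notation mu := (@lebesgue_measure R).
Implicit Types (F G f g : R -> R) (a b x y d e c k M p s t r alpha : R).

Lemma eq_ler x y : x = y -> x <= y. Proof. by move=> ->. Qed.

Lemma integrable_fin_add (D : set R) f g : measurable D ->
  mu.-integrable D (EFin \o f) -> mu.-integrable D (EFin \o g) ->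
  mu.-integrable D (EFin \o (fun u => f u + g u)).
Proof. by move=> mD intf intg; have := @integrableD _ _ _ mu _ mD _ _ intf intg. Qed.

Lemma integrable_fin_sub (D : set R) f g : measurable D ->
  mu.-integrable D (EFin \o f) -> mu.-integrable D (EFin \o g) ->
  mu.-integrable D (EFin \o (fun u => f u - g u)).
Proof. by move=> mD intf intg; have := @integrableB _ _ _ mu _ mD _ _ intf intg. Qed.

Lemma integrable_fin_scale (D : set R) k f : measurable D ->
  mu.-integrable D (EFin \o f) -> mu.-integrable D (EFin \o (fun u => k * f u)).
Proof. by move=> mD intf; have := @integrableZl _ _ _ mu _ mD k _ intf. Qed.

Lemma Rintegral_le (D : set R) f g : measurable D ->
  mu.-integrable D (EFin \o f) -> mu.-integrable D (EFin \o g) ->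
  (forall u, D u -> f u <= g u) -> \int[mu]_(u in D) f u <= \int[mu]_(u in D) g u.
Proof. by move=> mD i1 i2 fg; apply: le_Rintegral. Qed.

Lemma Rintegral_scale (D : set R) k f : measurable D -> mu.-integrable D (EFin \o f) ->
  \int[mu]_(u in D) (k * f u) = k * \int[mu]_(u in D) f u.
Proof. by move=> mD i1; apply: RintegralZl. Qed.

Lemma Rintegral_add (D : set R) f g : measurable D ->
  mu.-integrable D (EFin \o f) -> mu.-integrable D (EFin \o g) ->
  \int[mu]_(u in D) (f u + g u) = \int[mu]_(u in D) f u + \int[mu]_(u in D) g u.
Proof. by move=> mD intf intg; rewrite RintegralD. Qed.

Lemma Rintegral_sub (D : set R) f g : measurable D ->
  mu.-integrable D (EFin \o f) -> mu.-integrable D (EFin \o g) ->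
  \int[mu]_(u in D) (f u - g u) = \int[mu]_(u in D) f u - \int[mu]_(u in D) g u.
Proof. by move=> mD intf intg; rewrite RintegralB. Qed.

Lemma Rintegral_scale_sub (D : set R) k f g : measurable D ->
  mu.-integrable D (EFin \o f) -> mu.-integrable D (EFin \o g) ->
  \int[mu]_(u in D) (k * (f u - g u)) =
  k * (\int[mu]_(u in D) f u - \int[mu]_(u in D) g u).
Proof.
move=> mD intf intg; rewrite RintegralZl//; last exact: integrable_fin_sub.
by rewrite RintegralB.
Qed.

(** The truncated power (x - s)_+^p. *)
Definition tpow p s x : R := Num.max 0 (x - s) `^ p.

Lemma tpow_ge0 p s x : 0 <= tpow p s x. Proof. exact: powR_ge0. Qed.

Lemma tpow_eq0 p s x : 0 < p -> x <= s -> tpow p s x = 0.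
Proof. by move=> p0 xs; rewrite /tpow max_l ?subr_le0// powR0// gt_eqF. Qed.

Lemma tpowE p s x : s <= x -> tpow p s x = (x - s) `^ p.
Proof. by move=> sx; rewrite /tpow max_r// subr_ge0. Qed.

Lemma tpow1 s x : tpow 1 s x = Num.max 0 (x - s).
Proof. by rewrite /tpow powRr1// le_max lexx. Qed.

Lemma tpow_le p s x y : 0 <= p -> x <= y -> tpow p s x <= tpow p s y.
Proof.
move=> p0 xy; apply: ge0_ler_powR => //; rewrite ?nnegrE; do 1?by rewrite le_max lexx.
by rewrite ge_max !le_max lexx/= lerD2r xy orbT.
Qed.

Lemma tpow_shift p s x r : tpow p (s + r) x = tpow p s (x - r).
Proof. by rewrite /tpow; congr (Num.max 0 _ `^ _); ring. Qed.

Lemma tpow_has_derivative p s x : 0 < p ->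
  has_derivative_in setT (tpow (1 + p) s) x ((1 + p) * tpow p s x).
Proof.
move=> p0; have p1 : 0 < 1 + p by rewrite addr_gt0.
have [xs|sx|xs] := ltgtP x s.
- rewrite tpow_eq0 ?ltW// mulr0.
  apply: (@has_derivative_in_near _ _ (cst 0) _ _ _ (s - x)) => //.
  + by rewrite subr_gt0.
  + move=> y _; rewrite ltr_norml => /andP[_ yx]; rewrite tpow_eq0//.
    by rewrite -(lerD2r (- x)) ltW.
  + exact: has_derivative_in_cst.
- rewrite tpowE ?ltW//.
  apply: (@has_derivative_in_near _ _ (fun y => (y - s) `^ (1 + p)) _ _ _ (x - s)) => //.
  + by rewrite subr_gt0.
  + move=> y _; rewrite ltr_norml => /andP[yx _]; rewrite tpowE//.
    by rewrite -lerN2 -(lerD2l x) ltW//; move: yx; lra.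
  + move=> e e0.
    have xs0 : 0 < x - s by rewrite subr_gt0.
    have [r r0 Hr] := has_derivative_powR (1 + p) xs0 e0.
    exists r => // y _ yx; have := Hr (y - s) I.
    have -> : y - s - (x - s) = y - x by ring.
    have -> : 1 + p - 1 = p by ring.
    exact.
- rewrite xs tpow_eq0// mulr0 => e e0.
  have ep : 0 < e `^ p^-1 by rewrite powR_gt0.
  exists (e `^ p^-1) => // y _ ys; rewrite mul0r subr0 (tpow_eq0 p1 (lexx s)) subr0.
  rewrite ger0_norm ?tpow_ge0//.
  have [le|lt] := leP y s; first by rewrite tpow_eq0// mulr_ge0// ltW.
  have ys0 : 0 < y - s by rewrite subr_gt0.
  rewrite tpowE ?(ltW lt)// (ger0_norm (ltW ys0)) powRD ?(gt_eqF ys0) ?implybT//.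
  rewrite powRr1 ?(ltW ys0)// mulrC ler_wpM2r ?(ltW ys0)//.
  move: ys; rewrite (gtr0_norm ys0) => /ltW ys.
  have : (y - s) `^ p <= (e `^ p^-1) `^ p.
    by rewrite ge0_ler_powR ?nnegrE ?(ltW p0) ?(ltW ys0) ?(ltW ep).
  by rewrite -powRrM mulVf ?gt_eqF// powRr1// ltW.
Qed.

Lemma tpow_measurable (D : set R) p s : measurable_fun D (tpow p s).
Proof.
apply: measurable_funTS; apply: (@measurableT_comp _ _ _ _ _ _ (fun t => t `^ p)).
  exact: measurable_powR.
by apply: measurable_maxr => //; exact: measurable_funB.
Qed.

(** The mean value theorem for (x - s)_+^(1 + p), whose derivative is monotone. *)
Lemma tpow_increment p s x r : 0 < p -> 0 <= r ->
  r * tpow p s (x - r) <= (tpow (1 + p) s x - tpow (1 + p) s (x - r)) / (1 + p)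
  <= r * tpow p s x.
Proof.
move=> p0; rewrite le_eqVlt => /predU1P[<-|r0].
  by rewrite subr0 subrr !mul0r lexx.
have p1 : 0 < 1 + p by rewrite addr_gt0.
have xr : x - r < x by rewrite gtrBl.
have [||c] := @mean_value _ (tpow (1 + p) s) (fun y => (1 + p) * tpow p s y) _ _ xr.
- apply: (has_derivative_within_continuous (d := fun y => (1 + p) * tpow p s y)) => y _.
  exact/(has_derivative_inS (@subsetT _ _))/tpow_has_derivative.
- by move=> y _; exact: tpow_has_derivative.
rewrite in_itv/= => /andP[xc cx] ->; rewrite subKr.
have -> : (1 + p) * tpow p s c * r / (1 + p) = r * tpow p s c by field; rewrite gt_eqF.
by rewrite !ler_pM2l// !tpow_le ?ltW.
Qed.

Lemma integral_mkleft (f : R -> \bar R) a s x : a <= s ->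
  (forall u, u < s -> f u = 0%E) ->
  (\int[mu]_(u in `[a, x]) f u = \int[mu]_(u in `[s, x]) f u)%E.
Proof.
move=> as_ f0; rewrite integral_mkcond [RHS]integral_mkcond; congr (integral _ _ _).
apply/funext => u; rewrite !patchE.
have [su|us] := leP s u; last by rewrite f0//; do 2!case: ifP.
suff -> : (u \in `[a, x]%classic) = (u \in `[s, x]%classic) by [].
by apply/idP/idP; rewrite !inE /= !in_itv/= => /andP[? ->]; rewrite ?su ?(le_trans as_).
Qed.

Lemma tpow_kernel_integrable p alpha a s x : 0 < p -> 0 < alpha < 1 ->
  mu.-integrable `[a, x] (fun u => (tpow p s u / (x - u) `^ alpha)%:E).
Proof.
move=> p0 alpha01; apply: (@abel_integrable _ _ _ _ _ (tpow p s x)) => //.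
  exact: tpow_measurable.
move=> u; rewrite in_itv/= => /andP[_ ux].
by rewrite ger0_norm ?tpow_ge0// tpow_le ?(ltW p0).
Qed.

Lemma RL_left_int_tpow p alpha a s x : 0 < p -> 0 < alpha < 1 -> a <= s ->
  RL_left_int a alpha (tpow p s) x = abel_const p alpha * tpow (p + 1 - alpha) s x.
Proof.
move=> p0 alpha01 as_; have /andP[a0 a1] := alpha01.
rewrite /RL_left_int /Rintegral (integral_mkleft _ as_); last first.
  by move=> u /ltW us; rewrite tpow_eq0// mul0r.
have [xs|sx] := leP x s.
  rewrite [tpow _ _ x]tpow_eq0//; last by rewrite subr_gt0 ltr_pwDl// ltW.
  rewrite mulr0; move: xs; rewrite le_eqVlt => /predU1P[->|xs].
    by rewrite set_itv1 integral_set1.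
  by rewrite set_itv_ge ?bnd_simp -?ltNge// integral_set0.
have E : (\int[mu]_(u in `[s, x]) (tpow p s u / (x - u) `^ alpha)%:E =
   \int[mu]_(u in `[s, x]) ((u - s) `^ p / (x - u) `^ alpha)%:E)%E.
  apply: eq_integral => u; rewrite inE /= in_itv/= => /andP[su _].
  by rewrite tpowE.
rewrite (congr1 fine E) (congr1 fine (abel_kernel (ltW p0) alpha01 sx)) /=.
by rewrite tpowE// ltW.
Qed.

(** The recursion for the Beta function.  The left fractional integral turns the
    bounds of tpow_increment on increments of step d into bounds between
    quadratic functions of d, and d -> 0 leaves the equality of the constants. *)
Lemma abel_const_rec alpha : 0 < alpha < 1 ->
  abel_const (1 + alpha) alpha / (1 + alpha) = abel_const alpha alpha / 2.
Proof.
move=> alpha01; have /andP[a0 a1] := alpha01.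
have a1' : 0 < 1 + alpha by rewrite addr_gt0.
set K := _ / (1 + alpha); set k := abel_const alpha alpha.
have int (p s : R) := RL_left_int_tpow (a := 0) (s := s) 1 _ alpha01.
pose I p s := RL_left_int 0 alpha (tpow p s) 1.
have IK d : 0 <= d -> d < 1 -> I (1 + alpha) d / (1 + alpha) = K * (1 - d) ^+ 2.
  move=> d0 d1; rewrite /I RL_left_int_tpow// tpowE ?ltW//.
  rewrite (_ : 1 + alpha + 1 - alpha = 2%:R); last by ring.
  by rewrite powR_mulrn ?subr_ge0 ?ltW// /K; ring.
have Ik d : 0 <= d -> d < 1 -> I alpha d = k * (1 - d).
  move=> d0 d1; rewrite /I RL_left_int_tpow// tpowE ?ltW//.
  rewrite (_ : alpha + 1 - alpha = 1); last by ring.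
  by rewrite powRr1 ?subr_ge0 ?ltW.
have iT p s : 0 < p -> mu.-integrable `[0, 1] (EFin \o (fun u => tpow p s u / (1 - u) `^ alpha)).
  by move=> p0; exact: tpow_kernel_integrable.
have bound d : 0 < d -> d < 1 ->
    d * I alpha d <= (1 + alpha)^-1 * (I (1 + alpha) 0 - I (1 + alpha) d) /\
    (1 + alpha)^-1 * (I (1 + alpha) 0 - I (1 + alpha) d) <= d * I alpha 0.
  move=> d0 d1.
  have m01 : measurable (`[0, 1]%classic : set R) by [].
  have i1 := iT _ d a0; have i2 := iT _ 0 a0.
  have i3 := integrable_fin_scale d m01 i1; have i4 := integrable_fin_scale d m01 i2.
  have j3 := integrable_fin_sub m01 (iT _ 0 a1') (iT _ d a1').
  have j4 := integrable_fin_scale (1 + alpha)^-1 m01 j3.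
  have E := Rintegral_scale_sub (1 + alpha)^-1 m01 (iT _ 0 a1') (iT _ d a1').
  have h0 u : 0 <= ((1 - u) `^ alpha)^-1 by rewrite invr_ge0 powR_ge0.
  have inc u := @tpow_increment alpha 0 u d a0 (ltW d0).
  have L1 u : d * (tpow alpha d u / (1 - u) `^ alpha) <= (1 + alpha)^-1 *
      (tpow (1 + alpha) 0 u / (1 - u) `^ alpha - tpow (1 + alpha) d u / (1 - u) `^ alpha).
    rewrite -mulrBl !mulrA ler_wpM2r//.
    have /andP[+ _] := inc u.
    by rewrite -!tpow_shift add0r [(1 + alpha)^-1 * _]mulrC.
  have L2 u : (1 + alpha)^-1 *
      (tpow (1 + alpha) 0 u / (1 - u) `^ alpha - tpow (1 + alpha) d u / (1 - u) `^ alpha)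
      <= d * (tpow alpha 0 u / (1 - u) `^ alpha).
    rewrite -mulrBl !mulrA ler_wpM2r//.
    have /andP[_] := inc u.
    by rewrite -!tpow_shift add0r [(1 + alpha)^-1 * _]mulrC.
  have H1 := Rintegral_le m01 i3 j4 (fun u _ => L1 u).
  have H2 := Rintegral_le m01 j4 i4 (fun u _ => L2 u).
  have Z1 := Rintegral_scale d m01 i1; have Z2 := Rintegral_scale d m01 i2.
  split.
  - exact: (le_trans (eq_ler (esym Z1)) (le_trans H1 (eq_ler E))).
  - exact: (le_trans (eq_ler (esym E)) (le_trans H2 (eq_ler Z2))).
clearbody I.
have K0 : 0 < K by rewrite divr_gt0// abel_const_gt0// ltW.
have k0 : 0 < k by rewrite abel_const_gt0// ltW.
have {}bound d : 0 < d -> d < 1 -> k * (1 - d) <= K * (2 - d) /\ K * (2 - d) <= k.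
  move=> d0 d1; have [] := bound d d0 d1.
  have e1 := IK d (ltW d0) d1; have e2 := IK 0 (lexx 0) ltr01.
  rewrite (Ik d (ltW d0) d1) (Ik 0 (lexx 0) ltr01).
  have -> : (1 + alpha)^-1 * (I (1 + alpha) 0 - I (1 + alpha) d) =
    K * (1 - 0) ^+ 2 - K * (1 - d) ^+ 2 by rewrite -e1 -e2 mulrC mulrBl.
  rewrite !subr0 expr1n !mulr1 => h1 h2.
  split; rewrite -(ler_pM2l d0).
    by rewrite (le_trans h1)// [leLHS](_ : _ = d * (K * (2 - d)))//; ring.
  by rewrite (le_trans _ h2)// [leRHS](_ : _ = d * (K * (2 - d)))//; ring.
(* The bounds hold for all d in ]0, 1[ and are linear in d. *)
have small (X C : R) : 0 < C -> (forall d, 0 < d -> d < 1 -> X <= C * d) -> X <= 0.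
  move=> C0 H; rewrite leNgt; apply/negP => X0.
  have XC : 0 < 2 * (C + X) by rewrite mulr_gt0// addr_gt0.
  have := H (X / (2 * (C + X))); rewrite divr_gt0// ltr_pdivrMr// mul1r.
  rewrite mulrA ler_pdivlMr// => /(_ isT) H'.
  have : X < 2 * (C + X) by lra.
  by move=> /H'; nra.
apply/le_anti/andP; split.
- rewrite -subr_le0; apply: (small _ K K0) => d d0 d1.
  by have [_] := bound d d0 d1; nra.
- rewrite -subr_le0; apply: (small _ k k0) => d d0 d1.
  by have [] := bound d d0 d1; nra.
Qed.

End truncated_power.

(** * Exchange of left and right fractional integrals *)

Section fractional_fubini.
Context {R : realType}.
Notation mu := (@lebesgue_measure R).
Implicit Types (F G f g p psi : R -> R) (a b x y d e c k M s t r alpha : R).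

Lemma integrable_fineZ (D : set R) f k : measurable D ->
  mu.-integrable D (EFin \o f) ->
  (\int[mu]_(x in D) (k * f x)%:E = (k * \int[mu]_(x in D) f x)%:E)%E.
Proof.
move=> mD intf; rewrite -Rintegral_scale// /Rintegral fineK//.
by apply: integrable_fin_num => //; exact: integrable_fin_scale.
Qed.

Lemma abel_const0_integral alpha s x : 0 < alpha < 1 -> s <= x ->
  (\int[mu]_(u in `[s, x]) (((x - u) `^ alpha)^-1)%:E =
    (abel_const 0 alpha * (x - s) `^ (1 - alpha))%:E)%E.
Proof.
move=> alpha01; rewrite le_eqVlt => /predU1P[->|sx].
  rewrite set_itv1 integral_set1 subrr powR0 ?mulr0//.
  by case/andP: alpha01 => _ a1; rewrite gt_eqF// subr_gt0.
have := abel_kernel (lexx 0) alpha01 sx; rewrite add0r => <-.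
by apply: eq_integral => u _; rewrite powRr0 mul1r.
Qed.

Section kernel.
Variables (s b alpha M : R) (p psi : R -> R).
Hypotheses (sb : s < b) (alpha01 : 0 < alpha < 1).
Hypotheses (mp : measurable_fun `[s, b] p) (mpsi : measurable_fun `[s, b] psi).
Hypotheses (pM : forall u, u \in `[s, b] -> `|p u| <= M).
Hypotheses (psiM : forall u, u \in `[s, b] -> `|psi u| <= M).

Let mpsi_sub u : u \in `[s, b] -> measurable_fun `[s, u] psi.
Proof.
rewrite in_itv/= => /andP[_ ub].
by apply: (measurable_funS _ _ mpsi) => //; exact: subset_itvl.
Qed.

Let psi_abel u : u \in `[s, b] ->
  mu.-integrable `[s, u] (EFin \o (fun x => psi x / (u - x) `^ alpha)).
Proof.
move=> usb; apply: (@abel_integrable _ _ _ _ _ M alpha01); first exact: mpsi_sub.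
move: usb; rewrite in_itv/= => /andP[_ ub] x; rewrite in_itv/= => /andP[sx xu].
by apply: psiM; rewrite in_itv/= sx (le_trans xu).
Qed.

Let T := measurableTypeR R.

(* The truncation at 0 makes the kernel vanish off the triangle x <= u, since
   0 to the power alpha is 0 and so is its inverse. *)
Let G (z : T * T) : R := (psi \_ `[s, b]) z.1 * (p \_ `[s, b]) z.2 *
  (Num.max 0 (z.2 - z.1) `^ alpha)^-1.

Let mG : measurable_fun [set: T * T] (EFin \o G).
Proof.
apply/measurable_EFinP; apply: measurable_funM; first apply: measurable_funM.
- apply: measurableT_comp => //; apply/measurable_restrict => //.
  by rewrite setTI.
- apply: measurableT_comp => //; apply/measurable_restrict => //.
  by rewrite setTI.
- apply: (@eq_measurable_fun _ _ _ _ _ (fun z : T * T => Num.max 0 (z.2 - z.1) `^ (- alpha))).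
    by move=> z _; rewrite powRN.
  apply: (@measurableT_comp _ _ _ _ _ _ (fun t => t `^ (- alpha))).
    exact: measurable_powR.
  by apply: measurable_maxr => //; exact: measurable_funB.
Qed.

Let a0 : alpha != 0. Proof. by case/andP: alpha01 => a0 _; rewrite gt_eqF. Qed.

Let G_left u : u \in `[s, b] ->
  (fun x => (G (x, u))%:E) = (fun x => (p u * (psi x / (u - x) `^ alpha))%:E) \_ `[s, u].
Proof.
rewrite in_itv/= => /andP[su ub]; apply/funext => x; rewrite /G /= !patchE.
rewrite (mem_set (_ : `[s, b]%classic u)) /= ?in_itv/= ?su//.
have [xu|ux] := ltP x u; last first.
  rewrite max_l ?subr_le0// powR0// invr0 mulr0.
  case: ifPn => //; rewrite inE /= in_itv/= => /andP[_ xu].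
  have -> : x = u by apply/le_anti; rewrite xu ux.
  by rewrite subrr powR0// invr0 !mulr0.
rewrite max_r ?subr_ge0 ?(ltW xu)//.
have [sx|xs] := leP s x.
  by rewrite !mem_set /= ?in_itv/= ?sx ?(ltW xu) ?(le_trans (ltW xu))//; congr EFin; ring.
by rewrite !memNset ?mul0r//= in_itv/= leNgt xs.
Qed.

Let G_right x : x \in `[s, b] ->
  (fun u => (G (x, u))%:E) = (fun u => (psi x * (p u / (u - x) `^ alpha))%:E) \_ `[x, b].
Proof.
rewrite in_itv/= => /andP[sx xb]; apply/funext => u; rewrite /G /= !patchE.
rewrite (mem_set (_ : `[s, b]%classic x)) /= ?in_itv/= ?sx//.
have [xu|ux] := ltP x u; last first.
  rewrite max_l ?subr_le0// powR0// invr0 mulr0.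
  case: ifPn => //; rewrite inE /= in_itv/= => /andP[xu _].
  have -> : x = u by apply/le_anti; rewrite xu ux.
  by rewrite subrr powR0// invr0 !mulr0.
rewrite max_r ?subr_ge0 ?(ltW xu)//.
have [ub|bu] := leP u b.
  by rewrite !mem_set /= ?in_itv/= ?ub ?(ltW xu) ?(le_trans sx (ltW xu))//; congr EFin; ring.
by rewrite !memNset ?mulr0 ?mul0r//= in_itv/= [u <= b]leNgt bu andbF.
Qed.

Let G_out_left u : u \notin `[s, b] -> (fun x => (G (x, u))%:E) = cst 0%E.
Proof.
move=> usb; apply/funext => x; rewrite /G /= [(p \_ _) u]patchE memNset; last exact/negP.
by rewrite mulr0 mul0r.
Qed.

Let G_out_right x : x \notin `[s, b] -> (fun u => (G (x, u))%:E) = cst 0%E.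
Proof.
move=> xsb; apply/funext => u; rewrite /G /= [(psi \_ _) x]patchE memNset; last exact/negP.
by rewrite !mul0r.
Qed.

Let M0 : 0 <= M.
Proof. by apply: (le_trans (normr_ge0 (p s))); apply: pM; rewrite in_itv/= lexx ltW. Qed.

Let intG : (mu \x mu)%E.-integrable setT (EFin \o G).
Proof.
apply: (proj2 (@integrable21ltyP _ _ _ _ R mu mu _ mG)).
pose C := M * M * (abel_const 0 alpha * (b - s) `^ (1 - alpha)).
apply: (@le_lt_trans _ _ (\int[mu]_(u in `[s, b]) C%:E)%E); last first.
  rewrite integral_cst//= lebesgue_measure_itv/= lte_fin sb -EFinB -EFinM.
  exact: ltry.
rewrite [leRHS]integral_mkcond; apply: ge0_le_integral => //.
- by move=> u _; apply: integral_ge0.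
- have mabs : measurable_fun [set: T * T] (fun z => `|(EFin \o G) z|)%E.
    exact: measurableT_comp.
  have H := @measurable_fun_fubini_tonelli_G _ _ _ _ _ mu _ mabs (fun z => abse_ge0 _).
  exact H.
- apply/(measurable_restrict _ _ _) => //.
- move=> u _; rewrite patchE; case: ifPn => [|usb].
    rewrite inE => usb; move: (usb); rewrite /= in_itv/= => /andP[su ub].
    have -> : (fun x => `|(EFin \o G) (x, u)|)%E =
        (fun x => `|(p u * (psi x / (u - x) `^ alpha))|%:E) \_ `[s, u].
      apply/funext => x.
      apply: (etrans (congr1 abse (congr1 (fun h => h x) (G_left usb)))).
      by rewrite !patchE; case: ifP => //= _; rewrite normr0.
    rewrite -integral_mkcond.
    have le1 : (\int[mu]_(x in `[s, u]) `|(p u * (psi x / (u - x) `^ alpha))|%:E <=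
       \int[mu]_(x in `[s, u]) (M * M * ((u - x) `^ alpha)^-1)%:E)%E.
      apply: ge0_le_integral => //.
      + have /integrableP[m1 _] := integrable_fin_scale (p u) (measurable_itv _) (psi_abel usb).
        exact: (measurableT_comp (@abse_measurable R setT) m1).
      + have /integrableP[m1 _] :=
          integrable_fin_scale (M * M) (measurable_itv _) (integrable_kernel s u alpha01).
        exact: m1.
      + move=> x; rewrite /= in_itv/= => /andP[sx xu]; rewrite lee_fin.
        rewrite !normrM (ger0_norm (_ : 0 <= ((u - x) `^ alpha)^-1)) ?invr_ge0 ?powR_ge0//.
        rewrite mulrA ler_wpM2r ?invr_ge0 ?powR_ge0// ler_pM//.
          exact: pM.
        by apply: psiM; rewrite in_itv/= sx (le_trans xu).
    apply: (le_trans le1); rewrite (integrable_fineZ _ _ (integrable_kernel _ _ alpha01))//.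
    rewrite lee_fin /Rintegral (congr1 fine (abel_const0_integral alpha01 su)) /=.
    rewrite /C ler_wpM2l ?mulr_ge0// ler_wpM2l//.
      by rewrite ltW// abel_const_gt0.
    case/andP: alpha01 => _ a1.
    by rewrite ge0_ler_powR ?nnegrE ?subr_ge0 ?(ltW a1) ?(ltW sb)// lerD2r.
  rewrite [X in (X <= _)%E](_ : _ = 0%E)//.
  have usb' : u \notin `[s, b] by apply: contra usb => usb; rewrite inE.
  apply: integral0_eq => x _.
  by apply: (etrans (congr1 abse (congr1 (fun h => h x) (G_out_left usb')))); rewrite abse0.
Qed.

Let inner_left u : (\int[mu]_x (EFin \o G) (x, u) =
  ((fun u : R => (p u * RL_left_int s alpha psi u)%R%:E) \_ `[s, b]) u)%E.
Proof.
rewrite patchE; case: ifPn => [|usb].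
  rewrite inE => usb; rewrite (G_left usb) -integral_mkcond.
  exact: (integrable_fineZ _ _ (psi_abel usb)).
apply: integral0_eq => x _.
have usb' : u \notin `[s, b] by apply: contra usb => usb; rewrite inE.
exact: (congr1 (fun h => h x) (G_out_left usb')).
Qed.

Hypothesis intp : forall x, x \in `[s, b] ->
  mu.-integrable `[x, b] (EFin \o (fun u => p u / (u - x) `^ alpha)).

Let inner_right x : (\int[mu]_u (EFin \o G) (x, u) =
  ((fun x : R => (psi x * RL_right_int b alpha p x)%R%:E) \_ `[s, b]) x)%E.
Proof.
rewrite patchE; case: ifPn => [|xsb].
  rewrite inE => xsb; rewrite (G_right xsb) -integral_mkcond.
  exact: (integrable_fineZ _ _ (intp xsb)).
apply: integral0_eq => u _.
have xsb' : x \notin `[s, b] by apply: contra xsb => xsb; rewrite inE.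
exact: (congr1 (fun h => h u) (G_out_right xsb')).
Qed.

(** Both sides integrate psi x p u (u - x)^(-alpha) over s <= x <= u <= b.  The
    integrand is dominated by a multiple of the integrable kernel, so Fubini
    applies. *)
Lemma fractional_fubini :
  \int[mu]_(x in `[s, b]) (psi x * RL_right_int b alpha p x) =
  \int[mu]_(u in `[s, b]) (p u * RL_left_int s alpha psi u).
Proof.
have FE := @Fubini _ _ _ _ _ mu mu _ intG.
have E1 := congr1 (integral mu setT) (funext inner_right).
have E2 := congr1 (integral mu setT) (funext inner_left).
have gen (f1 f2 : R -> \bar R) : (\int[mu]_x (f1 \_ `[s, b]) x = \int[mu]_x (f2 \_ `[s, b]) x)%E ->
    (\int[mu]_(x in `[s, b]) f1 x = \int[mu]_(x in `[s, b]) f2 x)%E.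
  by move=> H; rewrite integral_mkcond [RHS]integral_mkcond.
apply: (@congr1 _ _ fine); apply: gen.
exact: (etrans (esym E1) (etrans FE E2)).
Qed.

End kernel.
End fractional_fubini.

(** * Splines of truncated powers and tents *)

Section spline.
Context {R : realType}.
Notation mu := (@lebesgue_measure R).
Implicit Types (F G f g : R -> R) (a b x y d e k M p s t r alpha A B : R).
Implicit Types cs : seq (R * R).

(** A combination of truncated powers, as the list of the pairs
    (coefficient, knot); lists allow induction on the number of knots. *)
Definition spline p cs x : R := \sum_(c <- cs) c.1 * tpow p c.2 x.

Lemma spline_cons p c cs x : spline p (c :: cs) x = c.1 * tpow p c.2 x + spline p cs x.
Proof. by rewrite /spline big_cons. Qed.

Lemma spline_nil p x : spline p [::] x = 0.
Proof. by rewrite /spline big_nil. Qed.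

Lemma spline_eq0 p cs s x : 0 < p -> all (fun c => s <= c.2) cs -> x <= s ->
  spline p cs x = 0.
Proof.
move=> p0 /allP cs_s xs; rewrite /spline big1_seq// => c /andP[_ /cs_s sc].
by rewrite tpow_eq0 ?mulr0// (le_trans xs).
Qed.

Lemma spline_has_derivative p cs x : 0 < p ->
  has_derivative_in setT (spline (1 + p) cs) x ((1 + p) * spline p cs x).
Proof.
move=> p0; elim: cs => [|c cs IH].
  rewrite spline_nil mulr0; apply: has_derivative_in_ext (has_derivative_in_cst setT 0 x) => //.
  by move=> y _; rewrite spline_nil.
rewrite spline_cons mulrDr mulrCA.
apply: has_derivative_in_ext (has_derivative_inD (has_derivative_inZ c.1 (tpow_has_derivative c.2 x p0)) IH) => //.
by move=> y _; rewrite spline_cons.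
Qed.

Lemma spline_measurable (D : set R) p cs : measurable_fun D (spline p cs).
Proof.
elim: cs => [|c cs IH].
  by apply: (eq_measurable_fun (fun=> 0 : R)) => // x _; rewrite spline_nil.
apply: (eq_measurable_fun (fun x => c.1 * tpow p c.2 x + spline p cs x)).
  by move=> x _; rewrite spline_cons.
by apply: measurable_funD => //; apply: measurable_funM => //; exact: tpow_measurable.
Qed.

Lemma spline_bounded p cs b : 0 <= p ->
  exists M, forall x, x <= b -> `|spline p cs x| <= M.
Proof.
move=> p0; elim: cs => [|c cs [M HM]].
  by exists 0 => x _; rewrite spline_nil normr0.
exists (`|c.1| * tpow p c.2 b + M) => x xb; rewrite spline_cons.
rewrite (le_trans (ler_normD _ _))// lerD ?HM// normrM ler_wpM2l//.
by rewrite ger0_norm ?tpow_ge0// tpow_le.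
Qed.

Lemma spline_kernel_integrable p alpha a cs x : 0 < p -> 0 < alpha < 1 ->
  mu.-integrable `[a, x] (EFin \o (fun u => spline p cs u / (x - u) `^ alpha)).
Proof.
move=> p0 alpha01; have [M HM] := spline_bounded cs x (ltW p0).
apply: (@abel_integrable _ _ _ _ _ M alpha01); first exact: spline_measurable.
by move=> u; rewrite in_itv/= => /andP[_]; exact: HM.
Qed.

Lemma RL_left_int_add alpha a f g c x :
  mu.-integrable `[a, x] (EFin \o (fun u => f u / (x - u) `^ alpha)) ->
  mu.-integrable `[a, x] (EFin \o (fun u => g u / (x - u) `^ alpha)) ->
  RL_left_int a alpha (fun u => f u + c * g u) x =
  RL_left_int a alpha f x + c * RL_left_int a alpha g x.
Proof.
move=> intf intg; rewrite /RL_left_int -RintegralZl// -RintegralD//; last first.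
  exact: integrable_fin_scale.
by apply: eq_Rintegral => u _; rewrite mulrDl mulrA.
Qed.

Lemma RL_left_int_spline p alpha a cs x : 0 < p -> 0 < alpha < 1 ->
  all (fun c => a <= c.2) cs ->
  RL_left_int a alpha (spline p cs) x = abel_const p alpha * spline (p + 1 - alpha) cs x.
Proof.
move=> p0 alpha01; elim: cs => [_|c cs IH /= /andP[ac acs]].
  rewrite spline_nil mulr0 /RL_left_int.
  under eq_Rintegral do rewrite spline_nil mul0r.
  by rewrite Rintegral_cst ?mul0r.
have -> : spline p (c :: cs) = (fun u => spline p cs u + c.1 * tpow p c.2 u).
  by apply/funext => u; rewrite spline_cons addrC.
rewrite RL_left_int_add; [|exact: spline_kernel_integrable|exact: tpow_kernel_integrable].
by rewrite (RL_left_int_tpow _ p0 alpha01 ac) (IH acs) spline_cons; ring.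
Qed.

(** The constant D for which the fractional derivative of order alpha of
    (x - s)_+^(1 + alpha) is D (x - s)_+. *)
Definition rl_spline_const alpha : R :=
  (Gamma_fun (1 - alpha))^-1 * ((1 + alpha) * abel_const alpha alpha).

Lemma rl_spline_const_gt0 alpha : 0 < alpha < 1 -> 0 < rl_spline_const alpha.
Proof.
move=> alpha01; have /andP[a0 a1] := alpha01.
by rewrite mulr_gt0 ?invr_gt0 ?gamma_gt0// mulr_gt0 ?addr_gt0// abel_const_gt0// ltW.
Qed.

(** The left fractional integral raises the exponent 1 + alpha to 2 and the
    derivative lowers it to 1, for each knot separately. *)
Lemma RL_left_int_spline_derivative alpha a cs x : 0 < alpha < 1 ->
  all (fun c => a <= c.2) cs ->
  has_derivative_in setT (RL_left_int a alpha (spline (1 + alpha) cs)) x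
    ((1 + alpha) * abel_const alpha alpha * spline 1 cs x).
Proof.
move=> alpha01 acs; have /andP[a0 a1] := alpha01.
have a1' : 0 < 1 + alpha by rewrite addr_gt0.
have -> : RL_left_int a alpha (spline (1 + alpha) cs) =
    (fun x => abel_const (1 + alpha) alpha * spline (1 + 1) cs x).
  apply/funext => y; rewrite RL_left_int_spline//.
  by rewrite (_ : 1 + alpha + 1 - alpha = 1 + 1)//; ring.
have -> : (1 + alpha) * abel_const alpha alpha * spline 1 cs x =
    abel_const (1 + alpha) alpha * ((1 + 1) * spline 1 cs x).
  rewrite mulrA; congr (_ * _); have := abel_const_rec alpha01.
  by move=> /(canRL (divfK _)) ->; [field|rewrite gt_eqF].
exact/has_derivative_inZ/spline_has_derivative.
Qed.

End spline.

Section hat.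
Context {R : realType}.
Notation mu := (@lebesgue_measure R).
Implicit Types (a b x y d e k M p s t r alpha A B : R).

(** The weights of a second difference of step r: for exponent 1 the spline is the tent of
    height r on [s, s + 2 r]. *)
Definition hat s r : seq (R * R) := [:: (1, s); (-2, s + r); (1, s + 2 * r)].

Lemma spline_hat p s r x : spline p (hat s r) x =
  tpow p s x - 2 * tpow p (s + r) x + tpow p (s + 2 * r) x.
Proof. by rewrite !spline_cons spline_nil /=; ring. Qed.

Lemma hat_le s r x : 0 < r -> 0 <= spline 1 (hat s r) x <= r.
Proof.
move=> r0; rewrite spline_hat !tpow1.
case: (leP 0 (x - s)) => h1; case: (leP 0 (x - (s + r))) => h2;
  case: (leP 0 (x - (s + 2 * r))) => h3; apply/andP; split; lra.
Qed.

Lemma hat_eq0 s r x : 0 < r -> (x <= s) || (s + 2 * r <= x) -> spline 1 (hat s r) x = 0.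
Proof.
move=> r0; rewrite spline_hat !tpow1 => /orP[|] xs.
  by rewrite !max_l ?subr0 ?addr0; lra.
by rewrite !max_r; lra.
Qed.

Lemma hat_ge s r x : 0 < r -> s + r / 2 <= x <= s + 3 * r / 2 ->
  r / 2 <= spline 1 (hat s r) x.
Proof.
move=> r0 /andP[h1 h2]; rewrite spline_hat !tpow1.
rewrite (@max_r _ _ 0 (x - s)) ?(@max_l _ _ 0 (x - (s + 2 * r))); try lra.
by case: (leP 0 (x - (s + r))) => h3; lra.
Qed.

(** By concavity z^p >= z for 0 <= z <= 1, applied to the proportions of x and y
    in x + y. *)
Lemma powR_subadditive p x y : 0 < p < 1 -> 0 <= x -> 0 <= y ->
  (x + y) `^ p <= x `^ p + y `^ p.
Proof.
move=> /andP[p0 p1] x0 y0.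
have [->|xn0] := eqVneq x 0; first by rewrite powR0 ?gt_eqF// !add0r.
have [->|yn0] := eqVneq y 0; first by rewrite powR0 ?gt_eqF// !addr0.
have {}x0 : 0 < x by rewrite lt_neqAle eq_sym xn0.
have {}y0 : 0 < y by rewrite lt_neqAle eq_sym yn0.
have xy0 : 0 < x + y by rewrite addr_gt0.
have P0 : 0 < (x + y) `^ p by rewrite powR_gt0.
have key z : 0 < z -> z <= x + y -> z / (x + y) * (x + y) `^ p <= z `^ p.
  move=> z0 zxy; have q0 : 0 < z / (x + y) by rewrite divr_gt0.
  have q1 : z / (x + y) <= 1 by rewrite ler_pdivrMr// mul1r.
  have := @ger1_powR _ (z / (x + y)) p; rewrite q0 q1 => /(_ isT (ltW p1)).
  move=> /(ler_wpM2r (ltW P0)) /le_trans; apply.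
  by rewrite -powRM ?(ltW q0) ?(ltW xy0)// divfK// gt_eqF.
have := lerD (key x x0 _) (key y y0 _); rewrite -mulrDl -mulrDl divff ?gt_eqF// mul1r.
by apply; rewrite ?lerDl ?lerDr ltW.
Qed.

Lemma tpow_hoelder alpha s x t : 0 < alpha < 1 -> 0 <= t ->
  tpow alpha s x - tpow alpha s (x - t) <= t `^ alpha.
Proof.
move=> alpha01 t0; have /andP[a0 a1] := alpha01.
have [xs|sx] := leP x s.
  by rewrite (tpow_eq0 a0 xs) sub0r (le_trans (_ : _ <= 0)) ?powR_ge0// oppr_le0 tpow_ge0.
have [h|h] := leP (x - t) s.
  rewrite (tpow_eq0 a0 h) subr0 (tpowE _ (ltW sx)).
  by rewrite ge0_ler_powR ?nnegrE ?(ltW a0)//; lra.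
rewrite (tpowE _ (ltW sx)) (tpowE _ (ltW h)) lerBlDl.
have {1}-> : x - s = (x - t - s) + t by ring.
by rewrite powR_subadditive// subr_ge0 ltW.
Qed.

(** A second difference is a difference of two increments. *)
Lemma spline_hat_bound p s r x : 0 < p -> 0 <= r ->
  0 <= spline (1 + p) (hat s r) x <= (1 + p) * r * (tpow p s x - tpow p s (x - 2 * r)).
Proof.
move=> p0 r0; have p1 : 0 < 1 + p by rewrite addr_gt0.
rewrite spline_hat !tpow_shift.
have /andP[] := tpow_increment s x p0 r0.
rewrite ler_pdivlMr// ler_pdivrMr// => h1 h2.
have /andP[] := tpow_increment s (x - r) p0 r0.
rewrite ler_pdivlMr// ler_pdivrMr// => h3 h4.
have e : x - r - r = x - 2 * r by ring.
by rewrite e in h3 h4; apply/andP; split; lra.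
Qed.

(** Hoelder continuity of (x - s)_+^alpha: while the tent, its fractional derivative
    up to a constant, has height r, the function itself is of order r^(1 + alpha). *)
Lemma spline_hat_le alpha s r x : 0 < alpha < 1 -> 0 <= r ->
  0 <= spline (1 + alpha) (hat s r) x <= (1 + alpha) * r * (2 * r) `^ alpha.
Proof.
move=> alpha01 r0; have /andP[a0 a1] := alpha01.
have /andP[-> /=] := spline_hat_bound s x a0 r0; move=> /le_trans; apply.
rewrite ler_wpM2l ?mulr_ge0 ?addr_ge0 ?(ltW a0)//.
by rewrite tpow_hoelder// mulr_ge0.
Qed.

(** Although the function does not vanish beyond its knots, its integral is only
    of order r^2: integrating raises the exponent, and spline_hat_bound for the
    primitive leaves an increment of step 2 r. *)
Lemma integral_spline_hat alpha s r b : 0 < alpha < 1 -> 0 < r -> s < b ->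
  mu.-integrable `]s, b[ (EFin \o spline (1 + alpha) (hat s r)) /\
  \int[mu]_(x in `]s, b[) spline (1 + alpha) (hat s r) x <=
    2 * (1 + alpha) * r ^+ 2 * (b - s) `^ alpha.
Proof.
move=> alpha01 r0 sb; have /andP[a0 a1] := alpha01.
have a1' : 0 < 1 + alpha by rewrite addr_gt0.
have a2' : 0 < 1 + (1 + alpha) by rewrite addr_gt0.
pose F x := (1 + (1 + alpha))^-1 * spline (1 + (1 + alpha)) (hat s r) x.
have dF x : has_derivative_in setT F x (spline (1 + alpha) (hat s r) x).
  rewrite -[X in has_derivative_in _ _ _ X](mulKf (lt0r_neq0 a2')).
  exact/has_derivative_inZ/spline_has_derivative.
have [M HM] := spline_bounded (hat s r) b (ltW a1').
have [|||intH intE] := @bounded_derivative_FTC _ F (spline (1 + alpha) (hat s r)) s b M sb.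
- apply: (has_derivative_within_continuous (d := spline (1 + alpha) (hat s r))) => x _.
  exact/(has_derivative_inS (@subsetT _ _))/dF.
- by move=> x _; exact: dF.
- by move=> x; rewrite in_itv/= => /andP[_ /ltW]; exact: HM.
split=> //; rewrite intE.
have -> : F s = 0.
  rewrite /F (@spline_eq0 _ _ _ s)// ?mulr0//= lexx !lerDl ltW//=.
  by rewrite mulr_ge0// ltW.
rewrite subr0 /F mulrC ler_pdivrMr//.
have /andP[_ /le_trans] := spline_hat_bound s b a1' (ltW r0); apply.
have r2 : 0 <= 2 * r by rewrite mulr_ge0// ltW.
have /andP[_] := tpow_increment s b a0 r2.
rewrite ler_pdivrMr// (tpowE alpha (ltW sb)) => h.
have := ler_wpM2l (ltW a2') (ler_wpM2l (ltW r0) h).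
move: (tpow (1 + alpha) s b - tpow (1 + alpha) s (b - 2 * r)) ((b - s) `^ alpha).
by move=> u v {}h; apply: le_trans (_ : (1 + (1 + alpha)) * (r * (2 * r * ((1 + alpha) * v))) <= _); [lra|apply: eq_ler; ring].
Qed.

(** Two adjacent tents with weights A and - B.  One tent would not do, since the
    perturbation it produces does not vanish at b. *)
Definition double_hat A B s r : seq (R * R) :=
  [seq (A * c.1, c.2) | c <- hat s r] ++ [seq (- B * c.1, c.2) | c <- hat (s + 2 * r) r].

Lemma spline_scale_cat p A cs cs' x :
  spline p ([seq (A * c.1, c.2) | c <- cs] ++ cs') x = A * spline p cs x + spline p cs' x.
Proof.
elim: cs => [|c cs IH] /=; first by rewrite spline_nil mulr0 add0r.
by rewrite !spline_cons IH /=; ring.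
Qed.

Lemma spline_double_hat p A B s r x : spline p (double_hat A B s r) x =
  A * spline p (hat s r) x - B * spline p (hat (s + 2 * r) r) x.
Proof.
rewrite /double_hat spline_scale_cat.
have := spline_scale_cat p (- B) (hat (s + 2 * r) r) [::] x.
by rewrite cats0 spline_nil => ->; ring.
Qed.

Lemma double_hat_knots A B s r : 0 < r -> all (fun c => s <= c.2) (double_hat A B s r).
Proof. by move=> r0; rewrite /= lexx !lerDl/=; apply/and4P; split; lra. Qed.

(** The larger weight is normalized to 1, so that at least one of the tents is
    present at full height. *)
Lemma double_hat_weights (u v : R) : exists A B, [/\ A * u = B * v,
  `|A| <= 1, `|B| <= 1 & (`|A| = 1) \/ (`|B| = 1)].
Proof.
have [uv|vu] := leP `|u| `|v|.
  have [->|v0] := eqVneq v 0.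
    exists 0, 1; rewrite mul0r mulr0 normr0 normr1 ler01 lexx; split=> //; by right.
  exists 1, (u / v); rewrite mul1r divfK// normr1 lexx; split=> //; last by left.
  by rewrite normrM normfV ler_pdivrMr ?normr_gt0// mul1r.
have u0 : 0 < `|u| by apply: le_lt_trans vu.
exists (v / u), 1; rewrite mul1r divfK -?normr_gt0// normr1 lexx; split=> //; last by right.
by rewrite normrM normfV ler_pdivrMr// mul1r ltW.
Qed.

End hat.

(** * Composition with the Lagrangian and its Taylor bound *)

Section lagrangian_regularity.
Context {R : realType}.
Notation mu := (@lebesgue_measure R).
Implicit Types (F G f g : R -> R) (a b x y v k l d e c K B s t : R).
Implicit Types L M : R -> R -> R -> R.

Lemma class_C0_eps a b M x0 y0 v0 e : class_C0 a b M -> x0 \in `[a, b] -> 0 < e ->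
  exists2 r, 0 < r & forall x y v, x \in `[a, b] -> `|x - x0| < r ->
    `|y - y0| < r -> `|v - v0| < r -> `|M x y v - M x0 y0 v0| < e.
Proof.
rewrite /class_C0 subspace_continuousP => H x0ab e0.
have /cvgrPdist_lt /(_ _ e0) := H (x0, y0, v0) x0ab.
rewrite near_withinE => /nbhs_ballP[r /= r0 Hr]; exists r => // x y v xab xx yy vv.
rewrite distrC; apply: (Hr (x, y, v)) => //.
by split=> /=; [split|] => /=; rewrite -ball_normE /ball_/= distrC.
Qed.

Lemma class_C0_bounded a b M B : class_C0 a b M ->
  exists2 K, 0 < K & forall x y v, x \in `[a, b] -> `|y| <= B -> `|v| <= B -> `|M x y v| <= K.
Proof.
move=> H; pose box : set (R * R * R) := (`[a, b] `*` `[- B, B]) `*` `[- B, B].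
have cbox : compact box.
  by apply: compact_setX; [apply: compact_setX|]; exact: segment_compact.
have Hbox : {within box, continuous (fun p : R * R * R => M p.1.1 p.1.2 p.2)}.
  by apply: continuous_subspaceW H => p [[]].
have /compact_bounded[K [_ HK]] := continuous_compact Hbox cbox.
exists (`|K| + 1) => [|x y v xab yB vB]; first by rewrite ltr_wpDl.
apply: HK; first by rewrite (le_lt_trans (ler_norm _))// ltrDl.
by exists (x, y, v) => //; split=> /=; rewrite ?in_itv/= -?ler_norml//; split=> //=; rewrite in_itv/= -ler_norml.
Qed.

(** A limit of compositions with the continuous difference quotients. *)
Lemma class_C0_measurable a b M F f (y : R -> R) c d k : c < d -> `]c, d[ `<=` `[a, b] ->
  class_C0 a b M -> {within `[a, b], continuous y} ->
  (forall x, x \in `]c, d[ -> has_derivative_in setT F x (f x)) ->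
  measurable_fun `]c, d[ (fun x => M x (y x) (k * f x)).
Proof.
move=> cd cdab HM /within_continuousP cy dF.
have [q [cq qf]] := derivative_limit_continuous cd dF.
apply: (measurable_realfun.measurable_fun_cvg (h := fun n x => M x (y x) (k * q n x))) => // [n|x xcd].
  apply: subspace_continuous_measurable_fun => //.
  apply/within_continuousP => x xcd e e0.
  have [r r0 Hr] := class_C0_eps (y x) (k * q n x) HM (cdab _ xcd) e0.
  have [r1 r10 Hr1] := cy x (cdab _ xcd) r r0.
  have /within_continuousP/(_ x I r r0)[r2 r20 Hr2] : {within setT, continuous (fun x => k * q n x)}.
    by apply: continuous_subspaceT => z; apply: cvgZr; exact: cq.
  exists (Num.min r (Num.min r1 r2)); first by rewrite !lt_min r0 r10.
  move=> z zcd; rewrite !lt_min => /and3P[z0 z1 z2].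
  by apply: Hr => //; [exact: cdab|apply: Hr1 => //; exact: cdab|exact: Hr2].
apply/cvgrPdist_lt => e e0.
have [r r0 Hr] := class_C0_eps (y x) (k * f x) HM (cdab _ xcd) e0.
have /cvgrPdist_lt/(_ _ r0) : k * q n x @[n --> \oo] --> k * f x.
  by apply: cvgZr; exact: qf.
apply: filterS => n qn; rewrite distrC; apply: Hr; rewrite ?subrr ?normr0//; first exact: cdab.
by rewrite distrC.
Qed.

Lemma derive1_has_derivative F x : derivable F x 1 ->
  has_derivative_in setT F x (derive1 F x).
Proof.
by move=> dF; apply/is_derive_has_derivative; rewrite derive1E; exact: DeriveDef.
Qed.

(** The intermediate point is described by 0 <= (t - v) l and |t - v| <= |l|, which
    covers both signs of the increment l. *)
Lemma mean_value_between F f v l : (forall t, has_derivative_in setT F t (f t)) ->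
  exists2 t, F (v + l) - F v = f t * l & 0 <= (t - v) * l /\ `|t - v| <= `|l|.
Proof.
move=> dF; have cF D : {within D, continuous F}.
  by apply: (has_derivative_within_continuous (d := f)) => x _; exact: has_derivative_inS (dF x).
have [l0|l0|->] := ltgtP l 0.
- have vl : v + l < v by rewrite gtrDl.
  have [t] := mean_value vl (cF _) (fun x _ => dF x).
  rewrite in_itv/= => /andP[t1 t2] e; exists t; first by rewrite -opprB e; ring.
  split; first by rewrite mulr_le0//; lra.
  by rewrite !ltr0_norm//; lra.
- have vl : v < v + l by rewrite ltrDl.
  have [t] := mean_value vl (cF _) (fun x _ => dF x).
  rewrite in_itv/= => /andP[t1 t2] e; exists t; first by rewrite e; ring.
  split; first by rewrite mulr_ge0//; lra.
  by rewrite !gtr0_norm//; lra.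
- by exists v; rewrite ?addr0 ?subrr ?mulr0 ?mul0r ?normr0.
Qed.

(** The mean value theorem, twice, for the difference between the increment of g
    and the quadratic bound. *)
Lemma taylor2_le g g' (g'' : R -> R) v l (sg : R) c :
  (forall t, has_derivative_in setT g t (g' t)) ->
  (forall t, has_derivative_in setT g' t (g'' t)) ->
  (forall t, `|t - v| <= `|l| -> sg * g'' t <= c) ->
  sg * (g (v + l) - g v - g' v * l) <= c / 2 * l ^+ 2.
Proof.
move=> dg dg' Hc.
(* The derivative of phi at t is (sg g'' - c) (t - v), with g'' taken at a point
   between v and t. *)
pose phi t := sg * (g t - g' v * t) - c / 2 * (t - v) ^+ 2.
pose dphi t := sg * (g' t - g' v) - c * (t - v).
have dphiP t : has_derivative_in setT phi t (dphi t).
  have dB := has_derivative_inD (has_derivative_in_id setT t) (has_derivative_in_cst setT (- v) t).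
  have d1 := has_derivative_inZ sg
    (has_derivative_inD (dg t) (has_derivative_inZ (- g' v) (has_derivative_in_id setT t))).
  have d2 := has_derivative_inZ (- (c / 2)) (has_derivative_inM dB dB).
  have -> : dphi t = sg * (g' t + - g' v * 1) +
      - (c / 2) * ((1 + 0) * (t - v) + (t - v) * (1 + 0)) by rewrite /dphi; field.
  apply: has_derivative_in_ext (has_derivative_inD d1 d2) => // z _.
  by rewrite /phi; ring.
have [t e [tl0 tl]] := mean_value_between v l dphiP.
have [u e' [ut0 ut]] := mean_value_between v (t - v) dg'.
have -> : sg * (g (v + l) - g v - g' v * l) = c / 2 * l ^+ 2 + (phi (v + l) - phi v).
  by rewrite /phi; ring.
rewrite gerDl e /dphi.
have -> : g' t - g' v = g'' u * (t - v) by rewrite -e'; congr (g' _ - _); ring.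
have -> : (sg * (g'' u * (t - v)) - c * (t - v)) * l = (sg * g'' u - c) * ((t - v) * l) by ring.
by rewrite mulr_le0_ge0// subr_le0 Hc// (le_trans ut).
Qed.

(** One variable at a time, first v and then y, so that only one-variable
    derivatives are used.  The increment in y costs K (k^2 + |k| |l|), and only
    the one in v carries the sign information on L_vv. *)
Lemma taylor_lagrangian a b L B K c sg x y v k l : class_C2 a b L -> x \in `[a, b] ->
  (forall y' v', `|y'| <= B -> `|v'| <= B -> `|pdy (pdy L) x y' v'| <= K) ->
  (forall y' v', `|y'| <= B -> `|v'| <= B -> `|pdv (pdy L) x y' v'| <= K) ->
  (forall v', `|v' - v| <= `|l| -> sg * pdv (pdv L) x y v' <= c) ->
  `|sg| = 1 -> `|y| + `|k| <= B -> `|v| + `|l| <= B ->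
  sg * (L x (y + k) (v + l) - L x y v - pdy L x y v * k - pdv L x y v * l) <=
    K * (k ^+ 2 + `|k| * `|l|) + c / 2 * l ^+ 2.
Proof.
move=> [[HL _] _ [HLy _] [HLv _]] xab Kyy Kyv cvv sg1 yB vB.
have dLy v' t := derive1_has_derivative (let: And3 _ h _ := HL x t v' xab in h).
have dLv t y' := derive1_has_derivative (let: And3 _ _ h := HL x y' t xab in h).
have dLyy v' t := derive1_has_derivative (let: And3 _ h _ := HLy x t v' xab in h).
have dLyv y' t := derive1_has_derivative (let: And3 _ _ h := HLy x y' t xab in h).
have dLvv y' t := derive1_has_derivative (let: And3 _ _ h := HLv x y' t xab in h).
have T2 := taylor2_le (dLv ^~ y) (dLvv y) cvv.
have [y1 e1 [_ y1k]] := mean_value_between y k (dLy (v + l)).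
have [y2 e2 [_ y2k]] := mean_value_between y (y1 - y) (dLyy (v + l)).
have [v2 e3 [_ v2l]] := mean_value_between v l (dLyv y).
have inB (z w h C : R) : `|z - w| <= h -> `|w| + h <= C -> `|z| <= C.
  move=> h1 h2; apply: le_trans h2; rewrite -{1}(subrK w z) addrC.
  by apply: le_trans (ler_normD _ _) _; rewrite lerD2l.
have vlB : `|v + l| <= B by apply: le_trans (ler_normD _ _) _.
have B1 : `|pdy (pdy L) x y2 (v + l)| <= K.
  by apply: Kyy => //; apply: inB (le_trans y2k y1k) yB.
have B2 : `|pdv (pdy L) x y v2| <= K.
  by apply: Kyv; [rewrite (le_trans _ yB)// lerDl|apply: inB v2l vB].
have split_L : L x (y + k) (v + l) - L x y v - pdy L x y v * k - pdv L x y v * l =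
    (pdy (pdy L) x y2 (v + l) * (y1 - y) + pdv (pdy L) x y v2 * l) * k +
    (L x y (v + l) - L x y v - pdv L x y v * l).
  have alg (A0 A1 A2 A3 A4 A5 A6 q w : R) : A0 - A1 = A4 * k -> A4 - A5 = q ->
      A5 - A6 = w -> A0 - A2 - A6 * k - A3 * l = (q + w) * k + (A1 - A2 - A3 * l).
    by move=> + <- <- => /(canRL (subrK _)) ->; ring.
  apply: (alg _ _ _ _ _ _ _ _ _ e1 _ e3).
  by rewrite -[X in pdy L x X (v + l) - _ = _](subrKC y y1) -[RHS]e2.
rewrite split_L mulrDr; apply: (lerD _ T2).
apply: le_trans (ler_norm _) _; rewrite !normrM sg1 mul1r.
apply: le_trans (ler_wpM2r (normr_ge0 _) (ler_normD _ _)) _.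
rewrite !normrM.
have -> : K * (k ^+ 2 + `|k| * `|l|) = (K * `|k| + K * `|l|) * `|k|.
  by rewrite -(real_normK (num_real k)); ring.
apply: (ler_wpM2r (normr_ge0 k)); apply: lerD.
  exact: (ler_pM (normr_ge0 _) (normr_ge0 _) B1 y1k).
exact: (ler_wpM2r (normr_ge0 l) B2).
Qed.

End lagrangian_regularity.

(** * The first variation along a spline *)

Section first_variation.
Context {R : realType}.
Notation mu := (@lebesgue_measure R).
Implicit Types (F G f g p q h : R -> R) (a b x y v k l d e K B s t M alpha : R).

Lemma bounded_integrable s b f M : measurable_fun `[s, b] f ->
  (forall x, x \in `[s, b] -> `|f x| <= M) -> mu.-integrable `[s, b] (EFin \o f).
Proof.
move=> mf fM; apply: measurable_bounded_integrable => //.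
  by rewrite [X in (X < _)%E]lebesgue_measure_itv/=; case: ifP => _; rewrite ltry.
exists M; split; first exact: num_real.
by move=> y My x xsb; apply: le_trans (fM x xsb) _; exact: ltW.
Qed.

Lemma Rintegral_itv_ccoo f s b : measurable_fun `]s, b[ f ->
  \int[mu]_(x in `[s, b]) f x = \int[mu]_(x in `]s, b[) f x.
Proof. by move=> mf; rewrite /Rintegral integral_itv_ccoo//; exact/measurable_EFinP. Qed.

Lemma RL_left_int_spline_kernel alpha s (cs : seq (R * R)) u : 0 < alpha < 1 ->
  all (fun c => s <= c.2) cs ->
  RL_left_int s alpha (spline alpha cs) u = abel_const alpha alpha * spline 1 cs u.
Proof.
move=> alpha01 scs; have /andP[a0 _] := alpha01.
by rewrite (RL_left_int_spline u a0 alpha01 scs) (_ : alpha + 1 - alpha = 1)//; ring.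
Qed.

(** Let P be the right fractional integral of p.  The Euler-Lagrange equation says
    P' = Gamma(1 - alpha) q, so (P h)' = Gamma(1 - alpha) q h + P h' is a bounded
    derivative, with integral 0 as h vanishes at s and at b.  Exchanging the
    integrals in P h' moves the fractional integral from p to h', which is a
    spline of exponent alpha. *)
Lemma first_variation a b alpha s (cs : seq (R * R)) p q M : 0 < alpha < 1 -> s \in `]a, b[ ->
  all (fun c => s <= c.2) cs -> spline (1 + alpha) cs b = 0 ->
  measurable_fun `[s, b] p -> measurable_fun `[s, b] q ->
  (forall x, x \in `[s, b] -> `|p x| <= M) ->
  (forall x, x \in `[s, b] -> `|q x| <= M) ->
  (forall x, x \in `[s, b] -> RL_right_exists a b alpha p x /\
     q x + RL_right a b alpha p x = 0) ->
  mu.-integrable `[s, b] (EFin \o (fun x =>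
    q x * spline (1 + alpha) cs x + p x * (rl_spline_const alpha * spline 1 cs x))) /\
  \int[mu]_(x in `[s, b])
    (q x * spline (1 + alpha) cs x + p x * (rl_spline_const alpha * spline 1 cs x)) = 0.
Proof.
move=> alpha01 sab scs hb mp mq pM qM EL.
have /andP[a0 a1] := alpha01.
have a1' : 0 < 1 + alpha by rewrite addr_gt0.
move: (sab); rewrite in_itv/= => /andP[as_ sb].
have ab : a < b := lt_trans as_ sb.
pose P := RL_right_int b alpha p.
have G0 : 0 < Gamma_fun (1 - alpha) by exact: gamma_gt0.
set Gam := Gamma_fun (1 - alpha) in G0.
have sub x : x \in `[s, b] -> x \in `[a, b].
  by rewrite !in_itv/= => /andP[sx ->]; rewrite (le_trans (ltW as_)).
have dP x : x \in `[s, b] -> has_derivative_in `[a, b] P x (Gam * q x).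
  move=> xsb; have [[_ dPx]] := EL x xsb.
  rewrite /RL_right => /eqP; rewrite subr_eq0 => /eqP ->.
  by rewrite mulVKf ?gt_eqF//; apply: derivable_inP => //; exact: sub.
have dPo x : x \in `]s, b[ -> has_derivative_in setT P x (Gam * q x).
  move=> xsb; have xsb' := subset_itv_oo_cc xsb.
  have xab : x \in `]a, b[.
    by move: xsb; rewrite !in_itv/= => /andP[sx ->]; rewrite (lt_trans as_).
  by apply/(has_derivative_in_itv _ _ xab)/dP.
have cP : {within `[s, b], continuous P}.
  apply: (has_derivative_within_continuous (d := fun x => Gam * q x)) => x xsb.
  by apply: has_derivative_inS (dP x xsb) => z; exact: sub.
have s_in : s \in `[s, b] by rewrite in_itv/= lexx ltW.
have b_in : b \in `[s, b] by rewrite in_itv/= lexx ltW.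
have M0 : 0 <= M := le_trans (normr_ge0 _) (pM s s_in).
have bq x : x \in `]s, b[ -> `|Gam * q x| <= Gam * M.
  by move=> xsb; rewrite normrM (gtr0_norm G0) ler_pM2l// qM//; exact: subset_itv_oo_cc.
have lipP := bounded_derivative_lipschitz cP dPo bq.
pose K := `|P b| + Gam * M * (b - s).
have PK x : x \in `[s, b] -> `|P x| <= K.
  move=> xsb; rewrite -(subrKC (P b) (P x)) (le_trans (ler_normD _ _))// lerD2l.
  apply: le_trans (lipP _ _ xsb b_in) _; rewrite ler_wpM2l ?mulr_ge0 ?(ltW G0)//.
  by move: xsb; rewrite in_itv/= => /andP[sx xb]; rewrite ler0_norm; lra.
have [M1 HM1] := spline_bounded cs b (ltW a1').
have [M2 HM2] := spline_bounded cs b (ltW a0).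
have [M3 HM3] := @spline_bounded R 1 cs b ler01.
have leb x : x \in `[s, b] -> x <= b by rewrite in_itv/= => /andP[].
pose w x := Gam * q x * spline (1 + alpha) cs x + P x * ((1 + alpha) * spline alpha cs x).
have dPh x : x \in `]s, b[ -> has_derivative_in setT (fun x => P x * spline (1 + alpha) cs x) x (w x).
  by move=> xsb; exact: has_derivative_inM (dPo x xsb) (spline_has_derivative cs x a0).
have cPh : {within `[s, b], continuous (fun x => P x * spline (1 + alpha) cs x)}.
  apply: (has_derivative_within_continuous (d := w)) => x xsb.
  apply: has_derivative_inM; first by apply: has_derivative_inS (dP x xsb) => z; exact: sub.
  by apply: has_derivative_inS (spline_has_derivative cs x a0).
have wB x : x \in `]s, b[ -> `|w x| <= Gam * M * M1 + K * ((1 + alpha) * M2).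
  move=> /[dup] /subset_itv_oo_cc xsb' xsb; rewrite (le_trans (ler_normD _ _))//.
  rewrite (normrM (Gam * q x)) (normrM (P x)) (normrM (1 + alpha)) (gtr0_norm a1').
  apply: lerD; first by apply: ler_pM => //; [exact: bq|exact/HM1/leb].
  apply: ler_pM => //; [by rewrite mulr_ge0 ?(ltW a1')|exact: PK|].
  by rewrite ler_pM2l//; exact/HM2/leb.
have [intw intwE] := bounded_derivative_FTC sb cPh dPh wB.
have mP : measurable_fun `[s, b] P by exact: subspace_continuous_measurable_fun.
have intqh : mu.-integrable `[s, b] (EFin \o (fun x => q x * spline (1 + alpha) cs x)).
  apply: (@bounded_integrable _ _ _ (M * M1)).
    by apply: measurable_funM => //; exact: spline_measurable.
  by move=> x xsb; rewrite normrM; apply: ler_pM => //; [exact: qM|exact/HM1/leb].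
have intPh : mu.-integrable `[s, b] (EFin \o (fun x => spline alpha cs x * P x)).
  apply: (@bounded_integrable _ _ _ (M2 * K)).
    by apply: measurable_funM => //; exact: spline_measurable.
  by move=> x xsb; rewrite normrM; apply: ler_pM => //; [exact/HM2/leb|exact: PK].
have intpg : mu.-integrable `[s, b] (EFin \o (fun x => p x * spline 1 cs x)).
  apply: (@bounded_integrable _ _ _ (M * M3)).
    by apply: measurable_funM => //; exact: spline_measurable.
  by move=> x xsb; rewrite normrM; apply: ler_pM => //; [exact: pM|exact/HM3/leb].
have W0 : Gam * \int[mu]_(x in `[s, b]) (q x * spline (1 + alpha) cs x) +
    (1 + alpha) * \int[mu]_(x in `[s, b]) (spline alpha cs x * P x) = 0.
  rewrite -!Rintegral_scale//.
  rewrite -(@RintegralD _ _ _ mu)//; [|exact: integrable_fin_scale..].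
  rewrite Rintegral_itv_ccoo; last first.
    by apply: measurable_funD; apply: measurable_funM => //; apply: measurable_funM;
      try (by apply: measurable_funS (mq); [|exact: subset_itv_oo_cc]);
      try (by apply: measurable_funS (mP); [|exact: subset_itv_oo_cc]);
      exact: spline_measurable.
  transitivity (\int[mu]_(x in `]s, b[) w x).
    by apply: eq_Rintegral => x _; rewrite /w; ring.
  have hs : spline (1 + alpha) cs s = 0 by exact: spline_eq0 scs _.
  apply: (etrans intwE); rewrite hb hs.
  by move: (P b) (P s) => u v; ring.
have M2' x : x \in `[s, b] -> `|spline alpha cs x| <= Num.max M M2.
  by move=> /leb/HM2 h; rewrite (le_trans h)// le_max lexx orbT.
have M1' x : x \in `[s, b] -> `|p x| <= Num.max M M2.
  by move=> /pM h; rewrite (le_trans h)// le_max lexx.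
have intp x : x \in `[s, b] ->
    mu.-integrable `[x, b] (EFin \o (fun u => p u / (u - x) `^ alpha)).
  move=> xsb; have [[/nbhs_singleton h _] _] := EL x xsb.
  exact/h/sub.
have fub := fractional_fubini sb alpha01 mp (@spline_measurable _ `[s, b] alpha cs) M1' M2' intp.
have kap : \int[mu]_(u in `[s, b]) (p u * RL_left_int s alpha (spline alpha cs) u) =
    abel_const alpha alpha * \int[mu]_(u in `[s, b]) (p u * spline 1 cs u).
  apply: (etrans _ (Rintegral_scale _ (measurable_itv _) intpg)).
  apply: eq_Rintegral => u _.
  by rewrite (RL_left_int_spline_kernel u alpha01 scs) mulrCA.
have -> : (fun x => q x * spline (1 + alpha) cs x + p x * (rl_spline_const alpha * spline 1 cs x)) =
    (fun x => q x * spline (1 + alpha) cs x + rl_spline_const alpha * (p x * spline 1 cs x)).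
  by apply/funext => x; rewrite mulrCA.
split.
  exact: integrable_fin_add (measurable_itv _) intqh
    (integrable_fin_scale (rl_spline_const alpha) (measurable_itv _) intpg).
apply: (etrans (Rintegral_add (measurable_itv _) intqh
  (integrable_fin_scale (rl_spline_const alpha) (measurable_itv _) intpg))).
have scE := Rintegral_scale (rl_spline_const alpha) (measurable_itv _) intpg.
apply: (etrans (congr1 _ scE)).
move: W0; rewrite fub kap /rl_spline_const -/Gam.
move: (\int[mu]_(x in _) _) (\int[mu]_(x in _) _) => I1 I2 W0.
apply/(mulfI (lt0r_neq0 G0)); rewrite mulr0 -[RHS]W0.
by field; rewrite gt_eqF.
Qed.

End first_variation.

(** * Admissible perturbations *)

Section perturbation.
Context {R : realType}.
Notation mu := (@lebesgue_measure R).
Implicit Types (F G f g p q h : R -> R) (a b x v k l d e K B s t M alpha : R).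
Implicit Types cs : seq (R * R).

(** derive_in is a total limit operator; it depends only on the germ even where the
    derivative does not exist. *)
Lemma derive_in_near (D : set R) F G x r : 0 < r -> D x ->
  (forall y, D y -> `|y - x| < r -> F y = G y) -> derive_in D F x = derive_in D G x.
Proof.
move=> r0 Dx FG; rewrite /derive_in; congr (lim _).
have FGx : F x = G x by apply: FG => //; rewrite subrr normr0.
have nearE : \forall z \near within D x^', (F z - F x) / (z - x) = (G z - G x) / (z - x).
  rewrite near_withinE near_withinE; exists r => //= z; rewrite /ball_/= distrC => zx _ Dz.
  by rewrite FGx FG.
by rewrite predeqE => A; split; rewrite /= /fmap/=; apply: filterS2 nearE => z /= ->.
Qed.

(** Linearity, and the fractional derivative of a spline. *)
Lemma RL_left_perturb a b alpha ys cs x : a < b -> 0 < alpha < 1 -> x \in `[a, b] ->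
  all (fun c => a <= c.2) cs -> RL_left_exists a b alpha ys x ->
  RL_left_exists a b alpha (fun z => ys z + spline (1 + alpha) cs z) x /\
  RL_left a b alpha (fun z => ys z + spline (1 + alpha) cs z) x =
    RL_left a b alpha ys x + rl_spline_const alpha * spline 1 cs x.
Proof.
move=> ab alpha01 xab acs [ker dF]; have /andP[a0 a1] := alpha01.
have a1' : 0 < 1 + alpha by rewrite addr_gt0.
set h := spline (1 + alpha) cs.
have kerh z : mu.-integrable `[a, z] (EFin \o (fun u => h u / (z - u) `^ alpha)).
  exact: spline_kernel_integrable.
have ker' : \forall z \near within `[a, b] (nbhs x), mu.-integrable `[a, z]
    (EFin \o (fun u => (ys u + h u) / (z - u) `^ alpha)).
  move: ker; apply: filterS => z kz.
  have := integrable_fin_add (measurable_itv _) kz (kerh z).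
  congr (mu.-integrable _ (EFin \o _)).
  by apply/funext => u; rewrite mulrDl.
have [r r0 Hr] : exists2 r, 0 < r & forall z, z \in `[a, b] -> `|z - x| < r ->
    RL_left_int a alpha ys z + RL_left_int a alpha h z =
    RL_left_int a alpha (fun u => ys u + h u) z.
  move: ker; rewrite near_withinE => -[r /= r0 Hr]; exists r => // z zab zx.
  have kz := Hr z; rewrite /ball_/= distrC in kz.
  have := RL_left_int_add 1 (kz zx zab) (kerh z); rewrite mul1r => <-.
  by congr (RL_left_int _ _ _ _); apply/funext => u; rewrite mul1r.
have dh : has_derivative_in `[a, b] (RL_left_int a alpha h) x
    ((1 + alpha) * abel_const alpha alpha * spline 1 cs x).
  exact: has_derivative_inS (RL_left_int_spline_derivative x alpha01 acs).
have dy := has_derivative_in_near r0 xab Hr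
  (has_derivative_inD (derivable_inP ab xab dF) dh).
have [d1 d2] := derive_inP ab xab dy.
split; first by split.
by rewrite /RL_left d2 mulrDr /rl_spline_const !mulrA.
Qed.

Lemma lagrangian_measurable a b alpha (M : R -> R -> R -> R) (y : R -> R) s : a < b ->
  s \in `]a, b[ -> class_C0 a b M -> {within `[a, b], continuous y} ->
  (forall x, x \in `]a, b[ -> RL_left_exists a b alpha y x) ->
  measurable_fun `[s, b] (lagrangian a b alpha M y).
Proof.
move=> ab sab HM cy ex.
have : measurable_fun `]a, b[ (lagrangian a b alpha M y).
  apply: (@class_C0_measurable _ a b M (RL_left_int a alpha y)
    (derive_in `[a, b] (RL_left_int a alpha y))) => //.
    by move=> x; exact: subset_itv_oo_cc.
  move=> x xab; apply/(has_derivative_in_itv _ _ xab).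
  have xab' : x \in `[a, b] by apply: subset_itv_oo_cc.
  exact: derivable_inP ab xab' (ex x xab).2.
move: sab; rewrite in_itv/= => /andP[as_ sb] m.
have : measurable_fun `]s, b[ (lagrangian a b alpha M y).
  apply: measurable_funS m => // x/=; rewrite !in_itv/= => /andP[sx ->].
  by rewrite (lt_trans as_).
by move=> /measurable_EFinP h; apply/measurable_EFinP; exact: emeasurable_fun_itv_cc h.
Qed.

Lemma continuous_bounded a b F : {within `[a, b], continuous F} ->
  exists2 K, 0 < K & forall x, x \in `[a, b] -> `|F x| <= K.
Proof.
move=> cF; have /compact_bounded[K [_ HK]] := continuous_compact cF (@segment_compact _ a b).
exists (`|K| + 1) => [|x xab]; first by rewrite ltr_wpDl.
apply: HK; first by rewrite (le_lt_trans (ler_norm _))// ltrDl.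
by exists x.
Qed.

(** Near x < s the left fractional integral only sees the values on [a, s]. *)
Lemma RL_left_causal a b alpha f g s x : a < b -> x \in `[a, b] -> x < s ->
  (forall u, u \in `[a, s] -> f u = g u) -> RL_left a b alpha f x = RL_left a b alpha g x.
Proof.
move=> ab xab xs fg; congr (_ * _).
apply: (@derive_in_near _ _ _ _ (s - x)); rewrite ?subr_gt0// => z zab.
rewrite ltr_norml => /andP[_ zs]; apply: eq_Rintegral => u.
rewrite inE/= in_itv/= => /andP[au uz]; rewrite fg// in_itv/= au (le_trans uz)//; lra.
Qed.

Lemma integral_supported_right (f : R -> R) a s b : a <= s ->
  (forall x, x \in `[a, s[ -> f x = 0) -> mu.-integrable `[s, b] (EFin \o f) ->
  mu.-integrable `[a, b] (EFin \o f) /\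
  \int[mu]_(x in `[a, b]) f x = \int[mu]_(x in `[s, b]) f x.
Proof.
move=> as_ f0 intf.
have fE : f \_ `[a, b] = f \_ `[s, b].
  apply/funext => x; rewrite !patchE.
  rewrite !mem_setE !in_itv/=; have [xs|sx] := ltP x s.
    by rewrite /=; case: ifP => // /andP[ax _]; rewrite f0// in_itv/= ax.
  by rewrite /= (le_trans as_ sx).
split; last by rewrite Rintegral_mkcond fE -Rintegral_mkcond.
apply/(@integrable_mkcond _ _ _ mu _ _ (measurable_itv `[a, b])).
have -> : (EFin \o f) \_ `[a, b] = (EFin \o f) \_ `[s, b].
  by rewrite !restrict_EFin fE.
by apply/(@integrable_mkcond _ _ _ mu _ _ (measurable_itv `[s, b])).
Qed.

Lemma lagrangian_bounded a b alpha (M : R -> R -> R -> R) (y : R -> R) s B :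
  a <= s -> class_C0 a b M -> {within `[a, b], continuous y} ->
  (forall x, x \in `[s, b] -> `|RL_left a b alpha y x| <= B) ->
  exists2 K, 0 < K & forall x, x \in `[s, b] -> `|lagrangian a b alpha M y x| <= K.
Proof.
move=> as_ HM cy yB; have [C C0 HC] := continuous_bounded cy.
have [K K0 HK] := class_C0_bounded (Num.max B C) HM.
have sab x : x \in `[s, b] -> x \in `[a, b].
  by rewrite !in_itv/= => /andP[sx ->]; rewrite (le_trans as_).
exists K => // x xsb; apply: HK; first exact: sab.
  by rewrite le_max (HC _ (sab _ xsb)) orbT.
by rewrite le_max (yB _ xsb).
Qed.

(** The perturbation changes nothing on [a, s[, so the integrability of the new
    Lagrangian and the difference of the two functionals only concern [s, b],
    where f is bounded. *)
Lemma perturbation a b alpha ya yb L ys s cs B H : a < b -> 0 < alpha < 1 ->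
  class_C0 a b L -> admissible a b alpha ya yb L ys -> s \in `]a, b[ ->
  (forall x, x \in `[s, b] -> `|RL_left a b alpha ys x| <= B) ->
  all (fun c => s <= c.2) cs -> spline (1 + alpha) cs b = 0 ->
  (forall x, x \in `[a, b] -> `|spline (1 + alpha) cs x| <= H) ->
  (forall x, x \in `[a, b] -> `|rl_spline_const alpha * spline 1 cs x| <= H) ->
  let y x := ys x + spline (1 + alpha) cs x in
  let dL x := L x (ys x + spline (1 + alpha) cs x)
     (RL_left a b alpha ys x + rl_spline_const alpha * spline 1 cs x) -
     L x (ys x) (RL_left a b alpha ys x) in
  [/\ admissible a b alpha ya yb L y,
      (weak_dist a b alpha ya y ys <= (H + H)%:E)%E,
      mu.-integrable `[s, b] (EFin \o dL) &
      J a b alpha L y - J a b alpha L ys = \int[mu]_(x in `[s, b]) dL x].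
Proof.
move=> ab alpha01 HL [cys ysa ysb exs ints] sab fB scs hb hH gH y dL.
have /andP[a0 a1] := alpha01.
have a1' : 0 < 1 + alpha by rewrite addr_gt0.
move: (sab); rewrite in_itv/= => /andP[as_ sb].
have acs : all (fun c => a <= c.2) cs.
  by apply: sub_all scs => c /=; exact/le_trans/ltW.
have fdab x : fd_points a b ya x -> x \in `[a, b].
  by rewrite /fd_points; case: ifP => _ //=; exact: subset_itv_oc_cc.
have abfd x : x \in `]a, b] -> fd_points a b ya x.
  by rewrite /fd_points; case: ifP => _ //=; exact: subset_itv_oc_cc.
have pert x : fd_points a b ya x -> RL_left_exists a b alpha y x /\
    RL_left a b alpha y x = RL_left a b alpha ys x + rl_spline_const alpha * spline 1 cs x.
  by move=> fx; apply: RL_left_perturb => //; [exact: fdab|exact: exs].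
have sbab x : x \in `[s, b] -> x \in `]a, b].
  by rewrite !in_itv/= => /andP[sx ->]; rewrite (lt_le_trans as_).
have cy : {within `[a, b], continuous y}.
  move=> x; apply: cvgD; first exact: cys.
  apply: (has_derivative_within_continuous (d := fun x => (1 + alpha) * spline alpha cs x)) => z _.
  exact: has_derivative_inS (spline_has_derivative cs z a0).
have dLE x : x \in `[s, b] -> dL x = lagrangian a b alpha L y x - lagrangian a b alpha L ys x.
  by move=> xsb; rewrite /lagrangian (pert x _).2//; exact/abfd/sbab.
have dL0 x : x \in `[a, s[ -> lagrangian a b alpha L y x - lagrangian a b alpha L ys x = 0.
  rewrite in_itv/= => /andP[ax xs]; apply/eqP; rewrite subr_eq0; apply/eqP.
  have yE u : u \in `[a, s] -> y u = ys u.
    by rewrite in_itv/= => /andP[_ us]; rewrite /y (spline_eq0 a1' scs us) addr0.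
  have xab : x \in `[a, b] by rewrite in_itv/= ax (le_trans (ltW xs) (ltW sb)).
  rewrite /lagrangian yE; last by rewrite in_itv/= ax ltW.
  by rewrite (RL_left_causal alpha ab xab xs yE).
have yB x : x \in `[s, b] -> `|RL_left a b alpha y x| <= B + H.
  move=> xsb; rewrite (pert x _).2; last exact/abfd/sbab.
  rewrite (le_trans (ler_normD _ _))// lerD ?fB// gH//.
  by apply: fdab; exact/abfd/sbab.
have exo z x : x \in `]a, b[ -> (forall x, fd_points a b ya x -> RL_left_exists a b alpha z x) ->
    RL_left_exists a b alpha z x.
  by move=> xab; apply; apply: abfd; exact: subset_itv_oo_oc.
have mLy : measurable_fun `[s, b] (lagrangian a b alpha L y).
  apply: (lagrangian_measurable ab sab HL cy) => x xab.
  by apply: (exo _ _ xab) => w /pert[].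
have mLs : measurable_fun `[s, b] (lagrangian a b alpha L ys).
  apply: (lagrangian_measurable ab sab HL cys) => x xab.
  exact: exo xab exs.
have [K1 _ HK1] := lagrangian_bounded (ltW as_) HL cy yB.
have [K2 _ HK2] := lagrangian_bounded (ltW as_) HL cys fB.
have intd : mu.-integrable `[s, b]
    (EFin \o (fun x => lagrangian a b alpha L y x - lagrangian a b alpha L ys x)).
  exact: integrable_fin_sub (measurable_itv _) (bounded_integrable mLy HK1)
    (bounded_integrable mLs HK2).
have [intd' intdE] := integral_supported_right (ltW as_) dL0 intd.
have inty : mu.-integrable `[a, b] (EFin \o lagrangian a b alpha L y).
  have := integrable_fin_add (measurable_itv _) intd' ints.
  by congr (mu.-integrable _ (EFin \o _)); apply/funext => x; rewrite /= subrK.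
split.
- split; [exact: cy| | |by move=> x /pert[]|exact: inty].
    by rewrite /y (spline_eq0 a1' acs (lexx a)) addr0.
  by rewrite /y hb addr0.
- rewrite EFinD; apply: leeD; apply: ge_ereal_sup => _ /= [x xab <-]; rewrite lee_fin.
    by rewrite /y addrAC subrr add0r hH.
  by rewrite (pert x xab).2 addrAC subrr add0r gH//; exact: fdab.
- apply: eq_integrable intd => // x; rewrite inE/= => xsb.
  by rewrite dLE.
- rewrite /J -(Rintegral_sub (measurable_itv _) inty ints) intdE.
  by apply: eq_Rintegral => x; rewrite inE/= => xsb; rewrite dLE.
Qed.

End perturbation.

(** * Narrow perturbations at a density point *)

Section needle.
Context {R : realType}.
Notation mu := (@lebesgue_measure R).
Implicit Types (F G f g q h : R -> R) (a b x y v k l d e m p B D s r t M alpha : R).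
Implicit Types cs : seq (R * R).

(** The test function: it vanishes at b, it is controlled by two nonnegative
    functions of small integral, and its tents are at most r high, live on
    [s, s + 4 r] and reach at least r / 2 on an interval of length r. *)
Lemma double_hat_test alpha s r b : 0 < alpha < 1 -> 0 < r -> exists cs t,
  [/\ all (fun c => s <= c.2) cs, spline (1 + alpha) cs b = 0,
    forall x, `|spline (1 + alpha) cs x| <=
      spline (1 + alpha) (hat s r) x + spline (1 + alpha) (hat (s + 2 * r) r) x,
    forall x, `|spline 1 cs x| <= r * \1_(`[s, s + 4 * r]) x &
    [/\ s <= t, t + r <= s + 4 * r &
      forall x, x \in `[t, t + r] -> r / 2 <= `|spline 1 cs x|]].
Proof.
move=> alpha01 r0.
have [A [B [hb A1 B1 AB]]] := double_hat_weights (spline (1 + alpha) (hat s r) b)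
  (spline (1 + alpha) (hat (s + 2 * r) r) b).
have E p x := spline_double_hat p A B s r x.
have h1 x : (s + 2 * r <= x) -> spline 1 (hat s r) x = 0.
  by move=> h; rewrite hat_eq0// h orbT.
have h2 x : x <= s + 2 * r -> spline 1 (hat (s + 2 * r) r) x = 0.
  by move=> h; rewrite hat_eq0// h.
have [t [st tr tg]] : exists t, [/\ s <= t, t + r <= s + 4 * r &
      forall x, x \in `[t, t + r] -> r / 2 <= `|spline 1 (double_hat A B s r) x|].
  have [A1'|B1'] := AB.
    exists (s + r / 2); split; [lra|lra|] => x; rewrite in_itv/= => /andP[x1 x2].
    rewrite E (h2 x) ?mulr0 ?subr0; last by lra.
    rewrite normrM A1' mul1r; apply: le_trans (ler_norm _).
    by apply: hat_ge => //; apply/andP; split; lra.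
  exists (s + 2 * r + r / 2); split; [lra|lra|] => x; rewrite in_itv/= => /andP[x1 x2].
  rewrite E (h1 x) ?mulr0 ?sub0r; last by lra.
  rewrite normrN normrM B1' mul1r; apply: le_trans (ler_norm _).
  by apply: hat_ge => //; apply/andP; split; lra.
exists (double_hat A B s r), t; split=> //.
- exact: double_hat_knots.
- by rewrite E hb subrr.
- move=> x; rewrite E (le_trans (ler_normB _ _))// !normrM lerD//.
    have /andP[H0 _] := spline_hat_le s x alpha01 (ltW r0).
    by rewrite (ger0_norm H0) ler_piMl.
  have /andP[H0 _] := spline_hat_le (s + 2 * r) x alpha01 (ltW r0).
  by rewrite (ger0_norm H0) ler_piMl.
- move=> x; rewrite E indicE mem_setE in_itv/=.
  have /andP[p1 p2] := hat_le s x r0; have /andP[p3 p4] := hat_le (s + 2 * r) x r0.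
  have [sx|xs] := leP s x; last first.
    by rewrite h2 ?hat_eq0 ?(ltW xs)//= ?mulr0 ?subr0 ?normr0//; lra.
  have [xs4|sx4] := leP x (s + 4 * r); last first.
    rewrite h1 ?(@hat_eq0 _ (s + 2 * r))//= ?mulr0 ?subr0 ?normr0//; last by lra.
    by apply/orP; right; lra.
  rewrite mulr1; have [x2|x2] := leP x (s + 2 * r).
    by rewrite h2// mulr0 subr0 normrM (ger0_norm p1) -[leRHS]mul1r ler_pM.
  by rewrite h1 ?(ltW x2)// mulr0 sub0r normrN normrM (ger0_norm p3) -[leRHS]mul1r ler_pM.
Qed.

(** A density point of E in E, where the balls of radius 5 r contain the windows
    [s, s + 4 r]. *)
Lemma density_window (E : set R) : measurable E -> mu E != 0%E ->
  exists2 s, E s & forall e, 0 < e -> exists2 r0, 0 < r0 & forall r, 0 < r -> r < r0 ->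
    (mu (`[s, (s + 4 * r)%R] `\` E) <= (e * r)%:E)%E.
Proof.
move=> mE E0; have [N [mN N0 HN]] := lebesgue_density mE.
have [s Es Ns] : exists2 s, E s & ~ N s.
  apply: contrapT => h; move/eqP: E0; apply.
  apply/eqP; rewrite -measure_le0 -N0 le_measure ?inE// => s Es.
  by apply: contrapT => Ns; apply: h; exists s.
have Hs : (mu (E `&` ball s r) * (mu (ball s r))^-1)%E @[r --> 0^'+] --> (\1_E s)%:E.
  by apply: contrapT => h; apply: Ns; apply: HN.
exists s => // e e0.
move: Hs; rewrite indicE mem_set//= => /fine_cvgP[_ /cvgrPdist_lt/(_ (e / 10))].
rewrite divr_gt0// => /(_ isT); rewrite near_withinE => -[r0 /= r00 Hr].
exists (r0 / 5) => [|r rp rr0]; first by rewrite divr_gt0.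
have r5 : 0 < 5 * r by lra.
have := Hr (5 * r); rewrite /ball_/= sub0r normrN gtr0_norm// r5.
have -> : 5 * r < r0 by lra.
move=> /(_ isT isT).
have mb : mu (ball s (5 * r)) = (10 * r)%:E.
  rewrite lebesgue_measure_ball ?ltW//; congr (_%:E); ring.
have mball : measurable (ball s (5 * r)) by exact: measurable_ball.
have DI : mu (ball s (5 * r)) = (mu (ball s (5 * r)%R `\` E) + mu (E `&` ball s (5 * r)%R))%E.
  by rewrite setIC; exact: measureDI.
rewrite mb.
have fE : (mu (E `&` ball s (5 * r)) \is a fin_num).
  rewrite ge0_fin_numE// (le_lt_trans (_ : _ <= mu (ball s (5 * r)))%E) ?mb ?ltry//.
  by rewrite -mb le_measure ?inE//; exact: measurableI.
have fD : (mu (ball s (5 * r) `\` E) \is a fin_num).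
  rewrite ge0_fin_numE// (le_lt_trans (_ : _ <= mu (ball s (5 * r)))%E) ?mb ?ltry//.
  by rewrite -mb le_measure ?inE//; exact: measurableD.
have sub : (mu (`[s, (s + 4 * r)%R] `\` E) <= mu (ball s (5 * r) `\` E))%E.
  rewrite le_measure ?inE//; [exact: measurableD|exact: measurableD|].
  move=> x [/= + nE]; rewrite in_itv/= => /andP[sx xs]; split=> //.
  by rewrite -ball_normE/ball_/= ler0_norm; lra.
have eq10 := congr1 fine DI; rewrite mb (fineD fD fE)/= in eq10.
rewrite -(fineK fE).
rewrite inver gt_eqF ?mulr_gt0// -EFinM/= => dens.
apply: (le_trans sub); rewrite -(fineK fD) lee_fin.
move: dens; rewrite ltr_norml => /andP[_].
rewrite ltrBlDl -ltrBlDr ltr_pdivlMr ?mulr_gt0//.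
move: (fine _) (fine _) eq10 => u v eq10 h.
by clear - eq10 h; lra.
Qed.

Lemma indic_integral s b (A : set R) : measurable A ->
  mu.-integrable `[s, b] (EFin \o \1_A) /\
  \int[mu]_(x in `[s, b]) \1_A x = fine (mu (A `&` `[s, b])).
Proof.
move=> mA; split; last by rewrite /Rintegral integral_indic.
apply: (@bounded_integrable _ _ _ _ 1); first exact: measurable_indic.
by move=> x _; rewrite ger0_norm indicE//; case: (_ \in _).
Qed.

Lemma powR_small alpha e : 0 < alpha -> 0 < e ->
  exists2 r0, 0 < r0 & forall r, 0 < r -> r < r0 -> (2 * r) `^ alpha <= e.
Proof.
move=> a0 e0; exists (e `^ alpha^-1 / 2); first by rewrite divr_gt0 ?powR_gt0.
move=> r rp rr; have -> : e = (e `^ alpha^-1) `^ alpha.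
  by rewrite -powRrM mulVf ?gt_eqF// powRr1// ltW.
by rewrite ge0_ler_powR ?nnegrE ?powR_ge0 ?(ltW a0)//; lra.
Qed.

Lemma integral_upper_bound s b r t (E : set R) (G H1 H2 : R -> R) c1 c2 c3 c4 e I :
  0 < r -> s + 4 * r <= b -> s <= t -> t + r <= s + 4 * r -> measurable E ->
  0 <= c1 -> 0 <= c2 -> 0 <= c3 ->
  mu.-integrable `[s, b] (EFin \o G) -> mu.-integrable `[s, b] (EFin \o H1) ->
  mu.-integrable `[s, b] (EFin \o H2) ->
  \int[mu]_(x in `[s, b]) H1 x <= I -> \int[mu]_(x in `[s, b]) H2 x <= I ->
  (mu (`[s, (s + 4 * r)%R] `\` E) <= (e * r)%:E)%E ->
  (forall x, x \in `[s, b] -> G x <= c1 * (H1 x + H2 x) + (c2 * \1_(`[s, s + 4 * r]) x +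
    (c3 * \1_(`[s, s + 4 * r] `\` E) x - c4 * \1_(`[t, t + r]) x))) ->
  \int[mu]_(x in `[s, b]) G x <= c1 * (I + I) + (c2 * (4 * r) + (c3 * (e * r) - c4 * r)).
Proof.
move=> r0 sb st tr mE c10 c20 c30 intG intH1 intH2 I1 I2 muE GB.
have mab := measurable_itv `[s, b].
have mSE : measurable (`[s, s + 4 * r] `\` E) by exact: measurableD.
have [i1 e1] := indic_integral s b (measurable_itv `[s, s + 4 * r]).
have [i2 e2] := indic_integral s b mSE.
have [i3 e3] := indic_integral s b (measurable_itv `[t, t + r]).
have iH := integrable_fin_add mab intH1 intH2.
have j1 := integrable_fin_scale c2 mab i1.
have j2 := integrable_fin_scale c3 mab i2.
have j3 := integrable_fin_scale c4 mab i3.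
have j4 := integrable_fin_scale c1 mab iH.
have j5 := integrable_fin_sub mab j2 j3.
have j6 := integrable_fin_add mab j1 j5.
have j7 := integrable_fin_add mab j4 j6.
apply: (le_trans (Rintegral_le mab intG j7 GB)).
rewrite (Rintegral_add mab j4 j6) (Rintegral_add mab j1 j5) (Rintegral_sub mab j2 j3).
rewrite (Rintegral_scale _ mab iH) (Rintegral_scale _ mab i1) (Rintegral_scale _ mab i2).
rewrite (Rintegral_scale _ mab i3) (Rintegral_add mab intH1 intH2) e1 e2 e3.
have m1 : (mu (`[s, (s + 4 * r)%R] `&` `[s, b]) <= (4 * r)%:E)%E.
  have -> : (4 * r)%:E = mu `[s, (s + 4 * r)%R].
    by rewrite lebesgue_measure_itv/= lte_fin ltrDl mulr_gt0// -EFinB addrAC subrr add0r.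
  by rewrite le_measure ?inE//; exact: measurableI.
have m2 : (mu ((`[s, (s + 4 * r)%R] `\` E) `&` `[s, b]) <= (e * r)%:E)%E.
  by apply: le_trans muE; rewrite le_measure ?inE//; exact: measurableI.
have m3 : mu (`[t, (t + r)%R] `&` `[s, b]) = r%:E.
  rewrite setIidl; last by apply: subset_itvScc; rewrite ?bnd_simp; lra.
  by rewrite lebesgue_measure_itv/= lte_fin ltrDl r0 -EFinB addrAC subrr add0r.
have fle (u : \bar R) c : (0 <= u)%E -> (u <= c%:E)%E -> fine u <= c.
  by move=> u0 uc; rewrite -lee_fin fineK// ge0_fin_numE// (le_lt_trans uc)// ltry.
rewrite m3 /=.
apply: lerD; first by apply: ler_wpM2l => //; exact: lerD.
apply: lerD; first by apply: ler_wpM2l => //; exact: fle.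
by apply: lerB => //; apply: ler_wpM2l => //; exact: fle.
Qed.

End needle.

(** * The Legendre condition *)

Section legendre.
Context {R : realType}.
Notation mu := (@lebesgue_measure R).
Implicit Types (F G f q : R -> R) (a b x y v l d e m B D s r t M K alpha eta ya yb delta sg : R).
Implicit Types cs : seq (R * R).

(** The Taylor bound on the window, for a test function h whose fractional
    derivative is D g: in S but outside E the second derivative is only known to
    be at most K, on E it is at most - eta, and T is where g is large.  The
    correction eta / 8 on S minus E pays for the part of T that lies outside E. *)
Lemma needle_pointwise (E S T : set R) x K m eta D r h H g c : 0 <= K -> 0 <= m ->
  0 <= eta -> 0 < D -> 0 < r -> T `<=` S -> `|h| <= H -> `|h| <= m ->
  `|g| <= r * \1_S x -> (T x -> r / 2 <= `|g|) -> c <= K -> (E x -> c <= - eta) ->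
  K * (h ^+ 2 + `|h| * `|D * g|) + c / 2 * (D * g) ^+ 2 <=
  K * m * H + (K * m * (D * r) * \1_S x +
    ((K / 2 + eta / 8) * (D * r) ^+ 2 * \1_(S `\` E) x - eta / 8 * (D * r) ^+ 2 * \1_T x)).
Proof.
move=> K0 m0 eta0 D0 r0 TS hH hm gS gT cK cE.
have i1 (A : set R) : A x -> \1_A x = 1 :> R by move=> Ax; rewrite indicE mem_set.
have i0 (A : set R) : ~ A x -> \1_A x = 0 :> R by move=> Ax; rewrite indicE memNset.
have D2 : 0 <= D ^+ 2 by rewrite exprn_ge0// ltW.
have -> : h ^+ 2 = `|h| * `|h| by rewrite -expr2 real_normK ?num_real.
have -> : (D * g) ^+ 2 = D ^+ 2 * `|g| ^+ 2 by rewrite exprMn real_normK ?num_real.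
rewrite normrM (gtr0_norm D0).
have h0 := normr_ge0 h; have g0 := normr_ge0 g.
move: (`|h|) (`|g|) hH hm gS gT h0 g0 => u w uH um wS wT u0 w0.
rewrite mulrDr -addrA; apply: lerD; first by rewrite -mulrA; apply: ler_wpM2l => //; exact: ler_pM.
apply: lerD.
  have -> : K * m * (D * r) * \1_S x = K * (m * (D * (r * \1_S x))) by rewrite !mulrA.
  by do 3![apply: ler_wpM2l => //; first exact: ltW|apply: ler_pM => //;
    rewrite ?mulr_ge0 ?(ltW D0)//].
have rw : w <= r by apply: le_trans wS _; rewrite ler_piMr ?(ltW r0)// indicE; case: (_ \in _).
have w2r : w ^+ 2 <= r ^+ 2 by rewrite lerXn2r ?nnegrE// ltW.
have -> : c / 2 * (D ^+ 2 * w ^+ 2) = D ^+ 2 * (c / 2 * w ^+ 2) by ring.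
have -> : (K / 2 + eta / 8) * (D * r) ^+ 2 * \1_(S `\` E) x - eta / 8 * (D * r) ^+ 2 * \1_T x =
  D ^+ 2 * ((K / 2 + eta / 8) * r ^+ 2 * \1_(S `\` E) x - eta / 8 * r ^+ 2 * \1_T x).
  by rewrite exprMn; ring.
apply: ler_wpM2l => //.
have r2 : 0 <= r ^+ 2 by rewrite exprn_ge0// ltW.
have w2 : 0 <= w ^+ 2 by rewrite exprn_ge0.
have er : 0 <= eta * r ^+ 2 by rewrite mulr_ge0.
have [Sx|nSx] := pselect (S x); last first.
  have nT : ~ T x by move=> /TS.
  rewrite (i0 S nSx) mulr0 in wS.
  have -> : w = 0 by apply/eqP; rewrite eq_le wS w0.
  rewrite expr0n/= mulr0 (i0 T nT) (i0 (S `\` E)) ?mulr0 ?subr0//.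
  by case.
have [Ex|nEx] := pselect (E x).
  rewrite (i0 (S `\` E)); last by case.
  rewrite mulr0 sub0r; have ceta := cE Ex.
  have cw : c / 2 * w ^+ 2 <= - eta / 2 * w ^+ 2 by apply: ler_wpM2r => //; lra.
  apply: (le_trans cw); have [Tx|nTx] := pselect (T x).
    rewrite (i1 T Tx) mulr1.
    have : (r / 2) ^+ 2 <= w ^+ 2.
      by rewrite lerXn2r ?nnegrE ?divr_ge0 ?(ltW r0)//; exact: wT.
    have -> : (r / 2) ^+ 2 = r ^+ 2 / 4 by field.
    by move=> /(ler_wpM2l eta0); lra.
  rewrite (i0 T nTx) mulr0 oppr0.
  by have := mulr_ge0 eta0 w2; lra.
rewrite (i1 (S `\` E)) ?mulr1; last by [].
have t1 : eta / 8 * r ^+ 2 * \1_T x <= eta / 8 * r ^+ 2.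
  by rewrite ler_piMr//; lra.
have : c / 2 * w ^+ 2 <= K / 2 * r ^+ 2.
  apply: (@le_trans _ _ (K / 2 * w ^+ 2)); first by apply: ler_wpM2r => //; lra.
  by apply: ler_wpM2l => //; lra.
lra.
Qed.

(** For M = L_vv: by continuity of M and ys, sg * M stays negative along the points
    x near x0 where f x is near f x0, and denjoy_clarkson makes this set non-negligible. *)
Lemma needle_set a b alpha (M : R -> R -> R -> R) (ys : R -> R) sg x0 : a < b ->
  class_C0 a b M -> {within `[a, b], continuous ys} ->
  (forall x, x \in `]a, b[ -> RL_left_exists a b alpha ys x) ->
  (forall c, c \in `]a, b] ->
       exists B : R, forall x, x \in `[c, b] -> `|RL_left a b alpha ys x| <= B) ->
  x0 \in `]a, b[ -> `|sg| = 1 -> sg * M x0 (ys x0) (RL_left a b alpha ys x0) < 0 ->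
  exists eta d s (E : set R), [/\ 0 < eta, 0 < d, measurable E, s \in `]a, b[ &
    (forall x v, E x -> `|v - RL_left a b alpha ys x| < d -> sg * M x (ys x) v <= - eta) /\
    (forall e, 0 < e -> exists2 r0, 0 < r0 & forall r, 0 < r -> r < r0 ->
      (mu (`[s, (s + 4 * r)%R] `\` E) <= (e * r)%:E)%E)].
Proof.
move=> ab HM cys exs bnd x0ab sg1 neg.
set f := RL_left a b alpha ys in bnd neg *.
pose eta := - (sg * M x0 (ys x0) (f x0)) / 2.
have eta0 : 0 < eta by rewrite /eta; lra.
have x0ab' : x0 \in `[a, b] := subset_itv_oo_cc x0ab.
have [r r0 Hr] := class_C0_eps (ys x0) (f x0) HM x0ab' eta0.
have [r1 r10 Hr1] := (within_continuousP _ _).1 cys x0 x0ab' r r0.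
move: (x0ab); rewrite in_itv/= => /andP[ax0 x0b].
pose d := Num.min (Num.min (r / 2) r1) (Num.min ((x0 - a) / 2) (b - x0)).
have [d0 dr dr1 da db] : [/\ 0 < d, d <= r / 2, d <= r1, d <= (x0 - a) / 2 & d <= b - x0].
  by split; rewrite /d ?lt_min ?ge_min ?lexx ?orbT//; apply/andP; split; apply/andP; split; lra.
have cab : x0 - d \in `]a, b] by rewrite in_itv/=; apply/andP; split; lra.
have [B HB] := bnd _ cab.
have Iab x : x \in `]x0 - d, x0 + d[ -> x \in `]a, b[.
  by rewrite !in_itv/= => /andP[h1 h2]; apply/andP; split; lra.
have dF x : x \in `]x0 - d, x0 + d[ -> has_derivative_in setT
    (fun x => (Gamma_fun (1 - alpha))^-1 * RL_left_int a alpha ys x) x (f x).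
  move=> /Iab xab; apply: has_derivative_inZ; apply/(has_derivative_in_itv _ _ xab).
  exact: derivable_inP ab (subset_itv_oo_cc xab) (exs x xab).2.
pose E := [set x | `]x0 - d, x0 + d[%classic x /\ f x0 - d < f x < f x0 + d].
have mE : measurable E.
  have -> : E = `]x0 - d, x0 + d[ `&` f @^-1` `]f x0 - d, f x0 + d[.
    by apply/seteqP; split=> x [/= h1 h2]; split=> //; move: h2; rewrite /= in_itv.
  by apply: (derivative_measurable dF) => //; exact: measurable_itv.
have E0 : mu E != 0%E.
  apply: (denjoy_clarkson (x0 := x0) (M := B) dF) => [x||]; last 2 first.
  - by rewrite in_itv/=; apply/andP; split; lra.
  - by apply/andP; split; lra.
  rewrite in_itv/= => /andP[h1 h2]; apply: HB.
  by rewrite in_itv/=; apply/andP; split; lra.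
have [s Es window] := density_window mE E0.
exists eta, d, s, E; split=> //; first exact: Iab Es.1.
split=> // x v [/= xI xf] vf; have xab := subset_itv_oo_cc (Iab _ xI).
move: xI; rewrite in_itv/= => /andP[x1 x2].
have xx0 : `|x - x0| < d by rewrite ltr_norml; apply/andP; split; lra.
have vv0 : `|v - f x0| < r.
  move: xf vf; rewrite !ltr_norml => /andP[f1 f2] /andP[v1 v2].
  by apply/andP; split; lra.
have yy0 : `|ys x - ys x0| < r by apply: Hr1 => //; exact: lt_le_trans dr1.
have xxr : `|x - x0| < r by apply: lt_le_trans xx0 _; lra.
have := Hr x (ys x) v xab xxr yy0 vv0.
set u := M x (ys x) v; set w := M x0 (ys x0) (f x0) => uw.
have : sg * (u - w) <= eta by apply: le_trans (ler_norm _) _; rewrite normrM sg1 mul1r ltW.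
have : sg * w = - (2 * eta) by rewrite /eta -/w; field.
by rewrite mulrBr; lra.
Qed.

(** With m of order q r and I of order r^2, where q = (2 r)^alpha, all the terms
    are r^3 times a coefficient; those from h tend to 0 with q, and e makes the
    contribution of the window outside E half as large as the gain. *)
Lemma needle_arith K D eta (p C q : R) r : 0 < K -> 0 < D -> 0 < eta -> 0 < p -> 0 <= C -> 0 < r ->
  0 <= q -> q <= D ^+ 2 * eta / 32 / (8 * K * p * (p * C + D)) ->
  forall m I e, m = 2 * (p * r * q) -> I = 2 * p * r ^+ 2 * C ->
  e = eta / 16 / (K / 2 + eta / 8) ->
  K * m * (I + I) + (K * m * (D * r) * (4 * r) +
    ((K / 2 + eta / 8) * (D * r) ^+ 2 * (e * r) - eta / 8 * (D * r) ^+ 2 * r)) < 0.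
Proof.
move=> K0 D0 eta0 p0 C0 r0 q0 qle m I e mE IE eE.
have pC : 0 < p * C + D by rewrite ltr_wpDl// mulr_ge0// ltW.
have den : 0 < 8 * K * p * (p * C + D) by rewrite !mulr_gt0.
have ke : 0 < K / 2 + eta / 8 by lra.
have -> : K * m * (I + I) + (K * m * (D * r) * (4 * r) +
    ((K / 2 + eta / 8) * (D * r) ^+ 2 * (e * r) - eta / 8 * (D * r) ^+ 2 * r)) =
    r ^+ 3 * (q * (8 * K * p * (p * C + D)) - D ^+ 2 * eta / 16).
  by rewrite mE IE eE; field; rewrite gt_eqF//; lra.
rewrite pmulr_rlt0 ?exprn_gt0// subr_lt0.
move: qle; rewrite ler_pdivlMr// => /le_lt_trans; apply.
have : 0 < D ^+ 2 * eta by rewrite mulr_gt0// exprn_gt0.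
lra.
Qed.

Lemma integral_spline_hat_le alpha s s' r b : 0 < alpha < 1 -> 0 < r -> s <= s' -> s' < b ->
  mu.-integrable `[s, b] (EFin \o spline (1 + alpha) (hat s' r)) /\
  \int[mu]_(x in `[s, b]) spline (1 + alpha) (hat s' r) x <=
    2 * (1 + alpha) * r ^+ 2 * (b - s) `^ alpha.
Proof.
move=> alpha01 r0 ss sb; have /andP[a0 a1] := alpha01.
have p0 : 0 < 1 + alpha by rewrite addr_gt0.
have [ih Ih] := integral_spline_hat alpha01 r0 sb.
have hcc := (integrable_itv_ccoo _ _ _).1 ih.
have h0 x : x \in `[s, s'[ -> spline (1 + alpha) (hat s' r) x = 0.
  rewrite in_itv/= => /andP[_ /ltW xs]; apply: spline_eq0 xs => //=.
  by rewrite lexx !lerDl (ltW r0)/= mulr_ge0// ltW.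
have [h1 h2] := integral_supported_right ss h0 hcc.
split=> //; rewrite h2 Rintegral_itv_ccoo; last exact: spline_measurable.
apply: (le_trans Ih); apply: ler_wpM2l.
  by rewrite !mulr_ge0 ?sqr_ge0// ltW.
by rewrite ge0_ler_powR ?nnegrE ?subr_ge0 ?(ltW a0) ?(ltW sb) ?(le_trans ss (ltW sb))// lerB.
Qed.

(** Integrate the Taylor bound along the test function for a small r.  The first
    variation contributes nothing, so optimality makes the integral nonnegative,
    while needle_arith makes it negative. *)
Lemma needle_contradiction a b alpha ya yb L (ys : R -> R) sg delta eta d s (E : set R) :
  a < b -> 0 < alpha < 1 -> class_C2 a b L -> admissible a b alpha ya yb L ys ->
  extremal a b alpha ya L ys ->
  (forall c, c \in `]a, b] ->
       exists B : R, forall x, x \in `[c, b] -> `|RL_left a b alpha ys x| <= B) ->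
  `|sg| = 1 -> 0 < delta ->
  (forall y : R -> R, admissible a b alpha ya yb L y -> (weak_dist a b alpha ya y ys < delta%:E)%E ->
    0 <= sg * (J a b alpha L y - J a b alpha L ys)) ->
  0 < eta -> 0 < d -> measurable E -> s \in `]a, b[ ->
  (forall x v, E x -> `|v - RL_left a b alpha ys x| < d ->
     sg * pdv (pdv L) x (ys x) v <= - eta) ->
  (forall e, 0 < e -> exists2 r0, 0 < r0 & forall r, 0 < r -> r < r0 ->
      (mu (`[s, (s + 4 * r)%R] `\` E) <= (e * r)%:E)%E) ->
  False.
Proof.
move=> ab alpha01 HL adm ext bnd sg1 delta0 mini eta0 d0 mE sab Leta window.
have /andP[a0 a1] := alpha01.
have p0 : 0 < 1 + alpha by rewrite addr_gt0.
have D0 := rl_spline_const_gt0 alpha01.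
set D := rl_spline_const alpha in D0.
move: (sab); rewrite in_itv/= => /andP[as_ sb].
have sbab x : x \in `[s, b] -> x \in `[a, b].
  by rewrite !in_itv/= => /andP[sx ->]; rewrite (le_trans (ltW as_)).
have sbfd x : x \in `[s, b] -> fd_points a b ya x.
  rewrite /fd_points; case: ifP => _ /=; first exact: sbab.
  by rewrite !in_itv/= => /andP[sx ->]; rewrite (lt_le_trans as_).
have oofd x : x \in `]a, b[ -> fd_points a b ya x.
  by rewrite /fd_points; case: ifP => _ /=; [exact: subset_itv_oo_cc|exact: subset_itv_oo_oc].
have [cys ysa ysb exs ints] := adm.
have exo x : x \in `]a, b[ -> RL_left_exists a b alpha ys x by move=> /oofd/exs.
have [B HB] := bnd s (subset_itv_oo_oc sab).
have [By By0 HBy] := continuous_bounded cys.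
have [[_ [HL0 _ HLy HLv]] _ [_ [_ _ HLyy HLyv]] [_ [_ _ _ HLvv]]] := HL.
pose box := Num.max B By + 1.
have [K1 K10 HK1] := class_C0_bounded box HLyy.
have [K2 K20 HK2] := class_C0_bounded box HLyv.
have [K3 K30 HK3] := class_C0_bounded box HLvv.
pose K := K1 + K2 + K3.
have K0 : 0 < K by rewrite !addr_gt0.
(* H bounds the perturbation and its fractional derivative: below 1 for the box
   where K bounds the second derivatives, below d for the sign of L_vv on E, and
   below delta / 3 for the neighbourhood in which ys is optimal. *)
pose H := Num.min 1 (Num.min (d / 2) (delta / 3)).
have [H0 H1 Hd Hdelta] : [/\ 0 < H, H <= 1, H < d & H + H < delta].
  have : H <= d / 2 by rewrite /H !ge_min lexx !orbT.
  have : H <= delta / 3 by rewrite /H !ge_min lexx !orbT.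
  split; [|by rewrite /H ge_min lexx|lra|lra].
  by rewrite /H !lt_min ltr01/=; apply/andP; split; lra.
pose C := (b - s) `^ alpha.
have C0 : 0 <= C by exact: powR_ge0.
pose q0 := Num.min (H / (2 * (1 + alpha)))
  (D ^+ 2 * eta / 32 / (8 * K * (1 + alpha) * ((1 + alpha) * C + D))).
have q00 : 0 < q0.
  rewrite lt_min; apply/andP; split; first by apply: divr_gt0 => //; exact: mulr_gt0.
  apply: divr_gt0; first by apply: divr_gt0 => //; apply: mulr_gt0 => //; exact: exprn_gt0.
  apply: mulr_gt0; first by apply: mulr_gt0 => //; exact: mulr_gt0.
  by rewrite ltr_wpDl// mulr_ge0// ltW.
have [r1 r10 Hr1] := powR_small a0 q00.
(* e and q0 are the smallness conditions of needle_arith. *)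
pose e := eta / 16 / (K / 2 + eta / 8).
have e0 : 0 < e by rewrite /e !divr_gt0//; lra.
have [r2 r20 Hr2] := window e e0.
pose r := Num.min (Num.min (r1 / 2) (r2 / 2)) (Num.min 1 (Num.min (H / D) ((b - s) / 4))).
have HD0 : 0 < H / D by rewrite divr_gt0.
(* The last three bounds on r keep h, together with q0, and D g below H, and the
   window inside [s, b]. *)
have [r0 rr1 rr2 r_1] : [/\ 0 < r, r <= r1 / 2, r <= r2 / 2 & r <= 1].
  split; rewrite /r ?lt_min ?ge_min ?lexx ?orbT//.
  by rewrite ltr01 HD0 !divr_gt0//= subr_gt0.
have rHD : r <= H / D by rewrite /r !ge_min lexx !orbT.
have rbs : r <= (b - s) / 4 by rewrite /r !ge_min lexx !orbT.
have s4 : s + 4 * r <= b by lra.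
have sb2 : s + 2 * r < b by clear - s4 r0; lra.
have ss2 : s <= s + 2 * r by clear - r0; lra.
have K1K : K1 <= K by rewrite /K; clear - K10 K20 K30; lra.
have K2K : K2 <= K by rewrite /K; clear - K10 K20 K30; lra.
have K3K : K3 <= K by rewrite /K; clear - K10 K20 K30; lra.
have Bmax : B <= Num.max B By by rewrite le_max lexx.
have Bymax : By <= Num.max B By by rewrite le_max lexx orbT.
have Bybox : By <= box by rewrite (le_trans Bymax)// lerDl.
pose q := (2 * r) `^ alpha.
have qq0 : q <= q0 by apply: Hr1 => //; lra.
have qge0 : 0 <= q by exact: powR_ge0.
have muE := Hr2 r r0 (le_lt_trans rr2 (_ : r2 / 2 < r2)).
have {}muE : (mu (`[s, (s + 4 * r)%R] `\` E) <= (e * r)%:E)%E by apply: muE; lra.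
have [cs [t [scs hb hle gle [st tr gt]]]] := double_hat_test s b alpha01 r0.
set h := spline (1 + alpha) cs in hb hle *.
set g := spline 1 cs in gle gt.
set h1 := spline (1 + alpha) (hat s r) in hle.
set h2 := spline (1 + alpha) (hat (s + 2 * r) r) in hle.
pose m := 2 * ((1 + alpha) * r * q).
have m0 : 0 <= m by rewrite /m !mulr_ge0// ltW.
have Tsub : `[t, t + r]%classic `<=` `[s, s + 4 * r].
  by apply: subset_itvScc; rewrite ?bnd_simp.
have c1ge0 : 0 <= K * m by rewrite mulr_ge0// ltW.
have c2ge0 : 0 <= K * m * (D * r) by rewrite mulr_ge0// mulr_ge0// ltW.
have c3ge0 : 0 <= (K / 2 + eta / 8) * (D * r) ^+ 2.
  by rewrite mulr_ge0 ?sqr_ge0// addr_ge0// divr_ge0// ltW.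
have qlast : q <= D ^+ 2 * eta / 32 / (8 * K * (1 + alpha) * ((1 + alpha) * C + D)).
  by apply: (le_trans qq0); rewrite /q0 ge_min lexx orbT.
have hm x : `|h x| <= m.
  apply: (le_trans (hle x)).
  have /andP[_ l1] := spline_hat_le s x alpha01 (ltW r0).
  have /andP[_ l2] := spline_hat_le (s + 2 * r) x alpha01 (ltW r0).
  by apply: (le_trans (lerD l1 l2)); rewrite /m /q; apply: eq_ler; ring.
have mH : m <= H.
  have qH : q <= H / (2 * (1 + alpha)) by apply: (le_trans qq0); rewrite /q0 ge_min lexx.
  move: qH; rewrite ler_pdivlMr ?mulr_gt0// => qH; apply: le_trans qH.
  have -> : m = q * (2 * (1 + alpha)) * r by rewrite /m; ring.
  by rewrite ler_piMr// mulr_ge0// mulr_ge0// ltW.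
have gr x : `|g x| <= r.
  by apply: (le_trans (gle x)); rewrite ler_piMr ?(ltW r0)// indicE; case: (_ \in _).
have DgH x : `|D * g x| <= H.
  rewrite normrM (gtr0_norm D0) -ler_pdivlMl//; apply: (le_trans (gr x)).
  by rewrite mulrC.
have [admy wdy intdL JE] := perturbation ab alpha01 HL0 adm sab HB scs hb
  (fun x _ => le_trans (hm x) mH) (fun x _ => DgH x).
have Jge0 := mini _ admy (le_lt_trans wdy (_ : (H + H)%:E < delta%:E)%E).
rewrite lte_fin in Jge0; have {}Jge0 := Jge0 Hdelta; rewrite JE in Jge0.
pose Lq := lagrangian a b alpha (pdy L) ys.
pose Lp := lagrangian a b alpha (pdv L) ys.
have [Mq _ HMq] := lagrangian_bounded (ltW as_) HLy cys HB.
have [Mp _ HMp] := lagrangian_bounded (ltW as_) HLv cys HB.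
have mq : measurable_fun `[s, b] Lq := lagrangian_measurable ab sab HLy cys exo.
have mp : measurable_fun `[s, b] Lp := lagrangian_measurable ab sab HLv cys exo.
have HMq' x : x \in `[s, b] -> `|Lq x| <= Num.max Mq Mp.
  by move=> /HMq h'; rewrite le_max h'.
have HMp' x : x \in `[s, b] -> `|Lp x| <= Num.max Mq Mp.
  by move=> /HMp h'; rewrite le_max h' orbT.
have [intFV FV] := first_variation alpha01 sab scs hb mp mq HMp' HMq'
  (fun x xsb => ext x (sbfd x xsb)).
have mab := measurable_itv `[s, b].
have intG := integrable_fin_scale sg mab (integrable_fin_sub mab intdL intFV).
have IG := Rintegral_scale sg mab (integrable_fin_sub mab intdL intFV).
rewrite (Rintegral_sub mab intdL intFV) FV subr0 in IG.
rewrite -IG in Jge0.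
have [ih1 Ih1] := integral_spline_hat_le alpha01 r0 (lexx s) sb.
have [ih2 Ih2] := integral_spline_hat_le alpha01 r0 ss2 sb2.
have pointwise x : x \in `[s, b] ->
    sg * (L x (ys x + h x) (RL_left a b alpha ys x + D * g x) -
      L x (ys x) (RL_left a b alpha ys x) - (Lq x * h x + Lp x * (D * g x))) <=
    K * m * (h1 x + h2 x) + (K * m * (D * r) * \1_(`[s, s + 4 * r]) x +
    ((K / 2 + eta / 8) * (D * r) ^+ 2 * \1_(`[s, s + 4 * r] `\` E) x -
     eta / 8 * (D * r) ^+ 2 * \1_(`[t, t + r]) x)).
  move=> xsb; have xab := sbab _ xsb.
  pose c := if x \in E then - eta else K.
  have cE : E x -> c <= - eta by move=> Ex; rewrite /c mem_set.
  have cK : c <= K by rewrite /c; case: ifP => // _; rewrite (le_trans _ (ltW K0))// oppr_le0 ltW.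
  apply: le_trans (needle_pointwise (ltW K0) m0 (ltW eta0) D0 r0 Tsub (hle x) (hm x) (gle x)
    (gt x) cK cE).
  rewrite opprD addrA.
  apply: (taylor_lagrangian (B := box) HL xab) => //.
  - by move=> y' v' yB vB; exact: le_trans (HK1 _ _ _ xab yB vB) K1K.
  - by move=> y' v' yB vB; exact: le_trans (HK2 _ _ _ xab yB vB) K2K.
  - move=> v' vl; rewrite /c; case: ifPn => [/set_mem Ex|_].
      by apply: Leta => //; exact: le_lt_trans vl (le_lt_trans (DgH x) Hd).
    apply: le_trans (ler_norm _) _; rewrite normrM sg1 mul1r.
    apply: le_trans (HK3 _ _ _ xab _ _) K3K.
      exact: le_trans (HBy _ xab) Bybox.
    have -> : v' = RL_left a b alpha ys x + (v' - RL_left a b alpha ys x) by rewrite subrKC.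
    apply: le_trans (ler_normD _ _) (lerD (le_trans (HB x xsb) Bmax) _).
    exact: le_trans vl (le_trans (DgH x) H1).
  - exact: lerD (le_trans (HBy x xab) Bymax) (le_trans (hm x) (le_trans mH H1)).
  - exact: lerD (le_trans (HB x xsb) Bmax) (le_trans (DgH x) H1).
have bound := integral_upper_bound r0 s4 st tr mE c1ge0 c2ge0 c3ge0 intG ih1 ih2 Ih1 Ih2 muE
  pointwise.
have arith := needle_arith K0 D0 eta0 p0 C0 r0 qge0 qlast (erefl m) (erefl _) (erefl e).
by have := le_lt_trans (le_trans Jge0 bound) arith; rewrite ltxx.
Qed.

(** The mean value theorem between x0 and a near point: a difference quotient at
    x0 is a value of f in the interior. *)
Lemma interior_derivative_approx a b (I : set R) F f x0 e : a < b -> I `<=` `[a, b] ->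
  `]a, b[ `<=` I -> (forall x, I x -> has_derivative_in `[a, b] F x (f x)) ->
  I x0 -> 0 < e -> exists x, [/\ x \in `]a, b[, `|x - x0| < e & `|f x - f x0| < e].
Proof.
move=> ab Iab abI dF Ix0 e0.
have x0ab := Iab _ Ix0; move: (x0ab); rewrite /= in_itv/= => /andP[ax0 x0b].
have e2 : 0 < e / 2 by rewrite divr_gt0.
have [r r0 Hr] := dF x0 Ix0 _ e2.
(* k <= (b - a) / 4 leaves room for a step of length k on the side of x0 that
   contains the midpoint. *)
pose k := Num.min (Num.min (r / 2) (e / 2)) ((b - a) / 4).
have [k0 kr ke kab] : [/\ 0 < k, k < r, k < e & k <= (b - a) / 4].
  have k1 : k <= r / 2 by rewrite /k !ge_min lexx.
  have k2 : k <= e / 2 by rewrite /k !ge_min lexx orbT.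
  have k3 : k <= (b - a) / 4 by rewrite /k !ge_min lexx orbT.
  by split; [rewrite /k !lt_min !divr_gt0 ?subr_gt0|lra|lra|].
have key u v : u \in `[a, b] -> v \in `[a, b] -> I u -> I v -> v - u = k ->
    (u = x0) \/ (v = x0) -> exists x, [/\ x \in `]a, b[, `|x - x0| < e & `|f x - f x0| < e].
  move=> uab vab Iu Iv uv ux0.
  have ltuv : u < v by rewrite -subr_gt0 uv.
  move: (uab) (vab); rewrite !in_itv/= => /andP[au ub] /andP[av vb].
  have Ioo x : x \in `]u, v[ -> x \in `]a, b[.
    by rewrite !in_itv/= => /andP[ux xv]; apply/andP; split; lra.
  have cF : {within `[u, v], continuous F}.
    apply: (has_derivative_within_continuous (d := f)) => x /=; rewrite in_itv/= => /andP[ux xv].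
    have Ix : I x.
      have [->//|xu] := eqVneq x u; have [->//|xv'] := eqVneq x v.
      by apply/abI/Ioo; rewrite /= in_itv/= !lt_neqAle xv xv' ux eq_sym xu.
    apply: has_derivative_inS (dF x Ix) => z /=; rewrite !in_itv/= => /andP[uz zv].
    by rewrite (le_trans au uz) (le_trans zv vb).
  have dFo x : x \in `]u, v[ -> has_derivative_in setT F x (f x).
    by move=> /Ioo xab; apply/(has_derivative_in_itv _ _ xab)/dF/abI.
  have [c cuv cE] := mean_value ltuv cF dFo.
  exists c; split; first exact: Ioo.
    move: cuv; rewrite in_itv/= => /andP[uc cv].
    by rewrite ltr_norml; case: ux0 => [<-|<-]; apply/andP; split; lra.
  have vu0 : 0 < v - u by rewrite uv.
  have bnd : `|(f c - f x0) * (v - u)| <= e / 2 * `|v - u|.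
    rewrite mulrBl -cE; case: ux0 => x0E.
      by have := Hr v vab; rewrite -x0E uv gtr0_norm//; apply.
    have := Hr u uab; rewrite -x0E -[u - v]opprB uv normrN gtr0_norm// => /(_ kr).
    by rewrite -normrN; congr (`|_| <= _); ring.
  move: bnd; rewrite normrM ler_pM2r ?normr_gt0 ?gt_eqF// => /le_lt_trans; apply.
  lra.
have [h|h] := leP x0 ((a + b) / 2).
  apply: (key x0 (x0 + k)) => //; last by left.
  - by rewrite in_itv/=; apply/andP; split; lra.
  - by apply: abI; rewrite /= in_itv/=; apply/andP; split; lra.
  - by rewrite addrAC subrr add0r.
apply: (key (x0 - k) x0) => //; last by right.
- by rewrite in_itv/=; apply/andP; split; lra.
- by apply: abI; rewrite /= in_itv/=; apply/andP; split; lra.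
- by rewrite opprB addrC subrK.
Qed.

(** A violation at any point, possibly an endpoint, is carried to an interior point
    by interior_derivative_approx and continuity of L_vv. *)
Lemma legendre_necessary a b alpha ya yb L (ys : R -> R) sg delta : a < b -> 0 < alpha < 1 ->
  class_C2 a b L -> admissible a b alpha ya yb L ys -> extremal a b alpha ya L ys ->
  (forall c, c \in `]a, b] ->
       exists B : R, forall x, x \in `[c, b] -> `|RL_left a b alpha ys x| <= B) ->
  `|sg| = 1 -> 0 < delta ->
  (forall y : R -> R, admissible a b alpha ya yb L y -> (weak_dist a b alpha ya y ys < delta%:E)%E ->
    0 <= sg * (J a b alpha L y - J a b alpha L ys)) ->
  forall x, fd_points a b ya x -> 0 <= sg * pdv (pdv L) x (ys x) (RL_left a b alpha ys x).
Proof.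
move=> ab alpha01 HL adm ext bnd sg1 delta0 mini x0 fx0.
have [cys _ _ exs _] := adm.
have [_ _ _ [_ [_ _ _ HLvv]]] := HL.
have fdab x : fd_points a b ya x -> x \in `[a, b].
  by rewrite /fd_points; case: ifP => _ //=; exact: subset_itv_oc_cc.
have oofd x : x \in `]a, b[ -> fd_points a b ya x.
  by rewrite /fd_points; case: ifP => _ /=; [exact: subset_itv_oo_cc|exact: subset_itv_oo_oc].
have exo x : x \in `]a, b[ -> RL_left_exists a b alpha ys x by move=> /oofd/exs.
rewrite leNgt; apply/negP => neg.
pose f := RL_left a b alpha ys.
have e0 : 0 < - (sg * pdv (pdv L) x0 (ys x0) (f x0)) by rewrite oppr_gt0.
have x0ab := fdab _ fx0.
have [r r0 Hr] := class_C0_eps (ys x0) (f x0) HLvv x0ab e0.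
have [r1 r10 Hr1] := (within_continuousP _ _).1 cys x0 x0ab r r0.
have dF x : fd_points a b ya x -> has_derivative_in `[a, b]
    (fun x => (Gamma_fun (1 - alpha))^-1 * RL_left_int a alpha ys x) x (f x).
  by move=> fx; apply: has_derivative_inZ; exact: derivable_inP ab (fdab _ fx) (exs x fx).2.
have rr0 : 0 < Num.min r r1 by rewrite lt_min r0.
have [x [xab xx0 fxx0]] := interior_derivative_approx ab fdab oofd dF fx0 rr0.
move: xx0 fxx0; rewrite !lt_min => /andP[xr xr1] /andP[fr _].
have xab' := subset_itv_oo_cc xab.
have close := Hr x (ys x) (f x) xab' xr (Hr1 x xab' xr1) fr.
have neg' : sg * pdv (pdv L) x (ys x) (f x) < 0.
  rewrite -(subrK (pdv (pdv L) x0 (ys x0) (f x0)) (pdv (pdv L) x (ys x) (f x))) mulrDr.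
  rewrite -ltrBrDr sub0r; apply: le_lt_trans (ler_norm _) _.
  by rewrite normrM sg1 mul1r.
have [eta [d [s [E [eta0 d0 mE sab [Leta window]]]]]] :=
  needle_set ab HLvv cys exo bnd xab sg1 neg'.
exact: (needle_contradiction ab alpha01 HL adm ext bnd sg1 delta0 mini eta0 d0 mE sab Leta window).
Qed.

End legendre.

Theorem theorem3p2 (R : realType) (a b alpha ya yb : R)
    (L : R -> R -> R -> R) (ys : R -> R)
    (hab : a < b) (halpha : 0 < alpha < 1)
    (hL : class_C2 a b L)
    (hadm : admissible a b alpha ya yb L ys)
    (hext : extremal a b alpha ya L ys)
    (hbnd : forall c, c \in `]a, b] ->
       exists M : R, forall x, x \in `[c, b] -> `|RL_left a b alpha ys x| <= M) :
  (weak_minimum a b alpha ya yb L ys ->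
     forall x, fd_points a b ya x ->
       0 <= pdv (pdv L) x (ys x) (RL_left a b alpha ys x)) /\
  (weak_maximum a b alpha ya yb L ys ->
     forall x, fd_points a b ya x ->
       pdv (pdv L) x (ys x) (RL_left a b alpha ys x) <= 0).
Proof.
split=> [] [delta delta0 opt] x fx.
  rewrite -[X in 0 <= X]mul1r.
  apply: (legendre_necessary hab halpha hL hadm hext hbnd (normr1 R) delta0) fx => y ady wdy.
  by rewrite mul1r subr_ge0; exact: opt.
rewrite -oppr_ge0 -mulN1r.
apply: (legendre_necessary hab halpha hL hadm hext hbnd (normrN1 R) delta0) fx => y ady wdy.
by rewrite mulN1r oppr_ge0 subr_le0; exact: opt.
Qed.
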